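(* Let $r\ge 2$ be an even integer, and let $s$, $(a_{ij})_{1\le j<i\le s}$, $(b_i)_{1\le i\le s}$ be the parameters of an explicit Runge–Kutta method of order $r$. Let $\psi_2(t_1,t_0)$ be the corresponding shadowed Runge–Kutta map and let $\Theta_2,\Theta_4,\dots,\Theta_r$ be the maps obtained by composition from $\psi_1$ and $\psi_2$, all as defined in the context. Then $\Theta_r(t+h,t)$, which is given by explicit formulas (evaluations of $\mathbf A$, $\mathbf A'$, $\nabla f$ and inversion of $3\times 3$ matrices), is an explicit symplectic integrator of order $r$ for the Hamiltonian $$H(\mathbf q,\mathbf p,t)=\frac{1}{2m}\|\mathbf p-e\mathbf A(\mathbf q,t)\|_2^2+e\,\phi(\mathbf q,t).$$ That is: (1) for all $t,h\in\mathbb R$ the map $\Theta_r(t+h,t)$ is symplectic (on the open set where it is defined, i.e. where the matrices to be inverted are invertible); (2) if $\Psi(t+h,t)$ denotes the exact flow map of Hamilton's equations of $H$ from time $t$ to time $t+h$, then, for every fixed $t$ and every fixed $(\mathbf q,\mathbf p)\in\mathbb R^3\times\mathbb R^3$, $$\Theta_r(t+h,t)(\mathbf q,\mathbf p)=\Psi(t+h,t)(\mathbf q,\mathbf p)+\mathcal O(h^{r+1})\quad\text{as } h\to0 .$$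
   Context: Constants: $m>0$ (mass), $e\in\mathbb R$ (charge). $\mathbf A:\mathbb R^3\times\mathbb R\to\mathbb R^3$ (vector potential) and $\phi:\mathbb R^3\times\mathbb R\to\mathbb R$ (scalar potential) are smooth functions of position $\mathbf q$ and time $t$. Hamilton's equations are $\dot{\mathbf q}=\partial H/\partial\mathbf p$, $\dot{\mathbf p}=-\partial H/\partial\mathbf q$. Vectors $\mathbf q,\mathbf p,\mathbf A$ are row vectors; $\nabla$ denotes the row vector of the three spatial derivatives; $[\mathbf A']_{ij}=\partial A_i/\partial q_j$; $\mathbf I$ is the $3\times3$ identity. A product such as $\mathbf p\,M$ is a row vector times a matrix. A differentiable map of (an open subset of) $\mathbb R^3\times\mathbb R^3$ is symplectic if its Jacobian $D$ satisfies $D^{T}JD=J$ with $J=\begin{pmatrix}0&\mathbf I\\-\mathbf I&0\end{pmatrix}$. Put $f(\mathbf q,t)=\frac{e^2}{2m}\|\mathbf A(\mathbf q,t)\|_2^2+e\,\phi(\mathbf q,t)$. Runge–Kutta method: an explicit $s$-stage Runge–Kutta method with coefficients $a_{ij}$ ($j<i$), $b_i$ and nodes $c_i=\sum_{j<i}a_{ij}$ has order $r$ if for every smooth ODE $\dot y=F(y,t)$ in any dimension, the one-step update $y+h\sum_i b_iK_i$, $K_i=F(y+h\sum_{j<i}a_{ij}K_j,\,t+hc_i)$, differs from the exact solution at time $t+h$ started at $y$ at time $t$ by $\mathcal O(h^{r+1})$. Map $\psi_1$: for $\tau\in\mathbb R$, $\psi_1(\tau):[\mathbf q,\mathbf p]\mapsto[\mathbf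 q+\tau\mathbf p/m,\ \mathbf p]$. Map $\psi_2$: for $t,h\in\mathbb R$ (possibly $h<0$) define successively for $i=1,\dots,s$ $$\mathbf k_i(\mathbf q)=-\tfrac em\mathbf A\Big(\mathbf q+h\sum_{j=1}^{i-1}a_{ij}\mathbf k_j(\mathbf q),\,t+h\sum_{j=1}^{i-1}a_{ij}\Big),$$ $$\mathbf k_i'(\mathbf q)=-\tfrac em\mathbf A'\Big(\mathbf q+h\sum_{j=1}^{i-1}a_{ij}\mathbf k_j(\mathbf q),\,t+h\sum_{j=1}^{i-1}a_{ij}\Big)\Big(\mathbf I+h\sum_{j=1}^{i-1}a_{ij}\mathbf k_j'(\mathbf q)\Big),$$ $$\nabla l_i(\mathbf q)=\nabla f\Big(\mathbf q+h\sum_{j=1}^{i-1}a_{ij}\mathbf k_j(\mathbf q),\,t+h\sum_{j=1}^{i-1}a_{ij}\Big)\Big(\mathbf I+h\sum_{j=1}^{i-1}a_{ij}\mathbf k_j'(\mathbf q)\Big).$$ Then $\psi_2(t+h,t):[\mathbf q,\mathbf p]\mapsto[\mathbf Q,\mathbf P]$ is $$\mathbf Q=\mathbf q+h\sum_{i=1}^sb_i\mathbf k_i(\mathbf q),\qquad \mathbf P=\Big(\mathbf p-h\sum_{i=1}^sb_i\nabla l_i(\mathbf q)\Big)\Big(\mathbf I+h\sum_{i=1}^sb_i\mathbf k_i'(\mathbf q)\Big)^{-1}.$$ Compositions: for $t,h\in\mathbb R$, $$\Theta_2(t+h,t)=\psi_1(h/2)\circ\psi_2(t+h,t)\circ\psi_1(h/2),$$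 and for even $j\ge2$, with $\gamma_j=1/(2-2^{1/(j+1)})$, $$\Theta_{j+2}(t+h,t)=\Theta_j\big(t+h,\,t+(1-\gamma_j)h\big)\circ\Theta_j\big(t+(1-\gamma_j)h,\,t+\gamma_jh\big)\circ\Theta_j\big(t+\gamma_jh,\,t\big).$$ In all of these, $\psi_2$ is built from the same Runge–Kutta method of order $r$. *)

(* Defs.v *)
From HB Require Import structures.
From mathcomp Require Import all_boot all_order all_algebra.
From mathcomp Require Import all_classical all_reals all_analysis.

Set Implicit Arguments.
Unset Strict Implicit.
Unset Printing Implicit Defensive.

Import Order.TTheory GRing.Theory Num.Theory.
Import numFieldNormedType.Exports.

Local Open Scope classical_set_scope.
Local Open Scope ring_scope.

(* On a finite-dimensional [U] this is the usual class C^n. *)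
Fixpoint Cn (R : realType) (U V : normedModType R) (n : nat) (f : U -> V) : Prop :=
  if n is n'.+1 then
    (forall x, differentiable f x) /\ (forall v, Cn n' (fun x => 'D_v f x))
  else continuous f.

Definition smooth (R : realType) (U V : normedModType R) (f : U -> V) : Prop :=
  forall n, Cn n f.

Definition grad (R : realType) n (g : 'rV[R]_n -> R) (x : 'rV[R]_n) : 'rV[R]_n :=
  \row_j 'D_(delta_mx 0 j) g x.

(* Entry (i, j) is the j-th partial derivative of f_i.  The library's
   [jacobian] acts on row vectors from the right, hence the transpose. *)
Definition Jac (R : realType) n p (f : 'rV[R]_n -> 'rV[R]_p) (x : 'rV[R]_n) :
    'M[R]_(p, n) :=
  (jacobian f x)^T.

(* [y] is a (local) solution near [t0] of y' = F(y, t), y(t0) = y0. *)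
Definition solves (R : realType) (V : normedModType R) (F : V -> R -> V)
    (t0 : R) (y0 : V) (y : R -> V) : Prop :=
  y t0 = y0 /\ \forall t \near t0, is_derive t (1 : R) y (F (y t) t).

(* Explicit recursions K_i = G_i (\sum_(j < i) a_ij K_j); only the entries of
   [a] strictly below the diagonal are used.  The argument [n] is fuel, and
   [stageE] is the defining equation. *)
Fixpoint stage_rec (R : realType) (V : lmodType R) s (a : 'M[R]_s)
    (G : 'I_s -> V -> V) (n : nat) (i : 'I_s) : V :=
  if n is n'.+1 then
    G i (\sum_(j < s | (j < i)%N) a i j *: stage_rec a G n' j)
  else 0.

Definition stage (R : realType) (V : lmodType R) s (a : 'M[R]_s)
    (G : 'I_s -> V -> V) (i : 'I_s) : V :=
  stage_rec a G s i.

Lemma stageE (R : realType) (V : lmodType R) s (a : 'M[R]_s)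
    (G : 'I_s -> V -> V) (i : 'I_s) :
  stage a G i = G i (\sum_(j < s | (j < i)%N) a i j *: stage a G j).
Proof.
have fuel n n' (k : 'I_s) : (k < n)%N -> (k < n')%N ->
    stage_rec a G n k = stage_rec a G n' k.
  elim: n n' k => [//|n IHn] [//|n'] k kn kn' /=.
  congr (G k _); apply: eq_bigr => j jk; congr (_ *: _).
  by apply: IHn; apply: (leq_trans jk).
rewrite /stage (fuel s s.+1 i) //=; exact: leqW.
Qed.

Definition node (R : realType) s (a : 'M[R]_s) (i : 'I_s) : R :=
  \sum_(j < s | (j < i)%N) a i j.

Definition rk_step (R : realType) s (a : 'M[R]_s) (b : 'I_s -> R)
    (V : lmodType R) (F : V -> R -> V) (t h : R) (y : V) : V :=
  y + h *: \sum_(i < s) b i *: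
        stage a (fun i v => F (y + h *: v) (t + h * node a i)) i.

Definition rk_order (R : realType) s (a : 'M[R]_s) (b : 'I_s -> R) (r : nat) : Prop :=
  forall (d : nat) (F : 'rV[R]_d -> R -> 'rV[R]_d),
  smooth (fun x : 'rV[R]_d * R => F x.1 x.2) ->
  forall (t0 : R) (y0 : 'rV[R]_d) (y : R -> 'rV[R]_d), solves F t0 y0 y ->
  (fun h : R => rk_step a b F t0 h y0 - y (t0 + h)) =O_ 0 (fun h : R => h ^+ r.+1).

(* A phase-space point is the row vector [row_mx q p]. *)
Notation phase R := 'rV[R]_(3 + 3).

(* Values of [pm_fun] outside [pm_dom] are meaningless ([invmx] is total). *)
Record pmap (R : realType) := PMap {
  pm_dom : set (phase R);
  pm_fun :> phase R -> phase R }.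

Definition pcomp (R : realType) (g f : pmap R) : pmap R :=
  PMap [set z | pm_dom f z /\ pm_dom g (f z)] (fun z => g (f z)).

Definition sympl_mx (R : realType) : 'M[R]_(3 + 3) := block_mx 0 1%:M (- 1%:M) 0.

Definition symplectic (R : realType) (f : pmap R) : Prop :=
  open (pm_dom f) /\
  forall z, pm_dom f z ->
    differentiable f z /\
    (Jac f z)^T *m sympl_mx R *m Jac f z = sympl_mx R.

Definition sqnorm2 (R : realType) n (v : 'rV[R]_n) : R := \sum_i v 0 i ^+ 2.

Section Potentials.
Context (R : realType) (m e : R).
Context (A : 'rV[R]_3 -> R -> 'rV[R]_3) (phi : 'rV[R]_3 -> R -> R).

Definition hamiltonian (q p : 'rV[R]_3) (t : R) : R :=
  (2 * m)^-1 * sqnorm2 (p - e *: A q t) + e * phi q t.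

Definition hamilton_field (z : phase R) (t : R) : phase R :=
  let q := lsubmx z in let p := rsubmx z in
  row_mx (grad (fun p' => hamiltonian q p' t) p)
         (- grad (fun q' => hamiltonian q' p t) q).

(* [Psi t1 t0] is the exact flow map from time [t0] to time [t1].  Solutions may
   blow up, so for each initial condition [Psi] is only constrained for [t1]
   near [t0]. *)
Definition exact_flow (Psi : R -> R -> phase R -> phase R) : Prop :=
  forall t0 z, solves hamilton_field t0 z (fun t1 => Psi t1 t0 z).

Definition fpot (q : 'rV[R]_3) (t : R) : R :=
  e ^+ 2 / (2 * m) * sqnorm2 (A q t) + e * phi q t.

Definition psi1 (tau : R) : pmap R :=
  PMap setT (fun z => row_mx (lsubmx z + (tau / m) *: rsubmx z) (rsubmx z)).

Context (s : nat) (a : 'M[R]_s) (b : 'I_s -> R).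

Section Shadow.
Context (t h : R) (q : 'rV[R]_3).

Definition k_ (i : 'I_s) : 'rV[R]_3 :=
  stage a (fun i v => - (e / m) *: A (q + h *: v) (t + h * node a i)) i.

Definition arg_ (i : 'I_s) : 'rV[R]_3 :=
  q + h *: \sum_(j < s | (j < i)%N) a i j *: k_ j.

Definition k'_ (i : 'I_s) : 'M[R]_3 :=
  stage a (fun i M => - (e / m) *:
    (Jac (fun x => A x (t + h * node a i)) (arg_ i) *m (1%:M + h *: M))) i.

Definition gradl_ (i : 'I_s) : 'rV[R]_3 :=
  grad (fun x => fpot x (t + h * node a i)) (arg_ i) *m
    (1%:M + h *: \sum_(j < s | (j < i)%N) a i j *: k'_ j).

Definition shadow_mx : 'M[R]_3 := 1%:M + h *: \sum_(i < s) b i *: k'_ i.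

End Shadow.

Definition psi2 (t1 t0 : R) : pmap R :=
  let h := t1 - t0 in
  PMap [set z | shadow_mx t0 h (lsubmx z) \in unitmx]
    (fun z => let q := lsubmx z in let p := rsubmx z in
      row_mx (q + h *: \sum_(i < s) b i *: k_ t0 h q i)
             ((p - h *: \sum_(i < s) b i *: gradl_ t0 h q i)
                *m invmx (shadow_mx t0 h q))).

Definition gamma_ (j : nat) : R := (2 - 2 `^ (j.+1%:R^-1))^-1.

(* [Theta_rec n] is Theta_{2n+2}. *)
Fixpoint Theta_rec (n : nat) (t1 t0 : R) : pmap R :=
  let h := t1 - t0 in
  if n is n'.+1 then
    let g := gamma_ (n'.*2.+2) in
    pcomp (Theta_rec n' t1 (t0 + (1 - g) * h))
      (pcomp (Theta_rec n' (t0 + (1 - g) * h) (t0 + g * h))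
             (Theta_rec n' (t0 + g * h) t0))
  else pcomp (psi1 (h / 2)) (pcomp (psi2 t1 t0) (psi1 (h / 2))).

(* Meaningful for even [r >= 2]. *)
Definition Theta (r : nat) : R -> R -> pmap R := Theta_rec (r./2).-1.

End Potentials.

(* Main.v *)
Require Import Defs.
From HB Require Import structures.
From mathcomp Require Import all_boot all_order all_algebra.
From mathcomp Require Import all_classical all_reals all_analysis.
From mathcomp Require Import ring lra.
Import Order.TTheory GRing.Theory Num.Theory.
Import numFieldNormedType.Exports.
Local Open Scope classical_set_scope.
Local Open Scope ring_scope.
Set Implicit Arguments.
Unset Strict Implicit.
Unset Printing Implicit Defensive.

(* The Hamiltonian is p^2 / 2m, whose flow is psi_1, plus a part linear in p,
   whose flow psi_2 approximates to order r; both are seen as autonomous vector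
   fields X_1, X_2 on (phase space) x (time).  Pulling smooth functions back along
   a one-step map gives a power series in h with coefficients in the algebra of
   endomorphisms of smooth functions.  Modulo h^(r+1), psi_1 and psi_2 give
   exp(h X_1) and exp(h X_2), the exact flow gives exp(h (X_1 + X_2)), and
   composing maps multiplies the series, so the order of Theta_r is Yoshida's
   computation with symmetric noncommutative series.

   The order of the Runge-Kutta method is only known for exact solutions, whose
   existence is not needed: the Taylor polynomial of a flow is the exact solution
   of a perturbed field.  That a pointwise O(h^(r+1)) is locally uniform follows
   from smoothness, by comparing Taylor coefficients.  For psi_2 this is applied to
   the system of (q, p), the variational matrix M and the quadrature w, whose first
   integral p M + w recovers P.

   psi_2 is symplectic because the recursions for k'_i and grad l_i differentiate
   those for k_i and l_i: it is the cotangent lift of a point map Q combined with a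
   gauge transformation, and second derivatives are symmetric. *)

(** * Functions of class C^n between finite-dimensional normed modules *)

(** Composition evaluates the error of one map at the image of another, a base point that moves with
    the step; this is why every estimate is kept locally uniform in the base point. The exact flow
    alone is compared at a single point, since nothing is assumed about its dependence on initial
    data. A Runge-Kutta step is in general not reversible, so [psi2] and [Theta] need not be
    self-adjoint as maps. Their expansions below [h^(r+1)], however, are products of truncated
    exponentials, which satisfy P(-h) P(h) = 1 to that order, and this is all that Yoshida's
    argument uses: symmetry gives each even coefficient from the preceding ones, and the weight
    [gamma_] removes the odd one. That weight is the real solution of 2 g^k + (1 - 2 g)^k = 0 with k
    = j + 1 odd. Passing to pullbacks makes composition a product in an algebra, so no
    Baker-Campbell-Hausdorff formula is needed. The same calculus, applied to translations, also
    yields the symmetry of second derivatives on which symplecticity rests. *)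

Class findim (R : realType) (U : normedModType R) : Prop := Findim {
  findim_basis : exists n (e : 'I_n -> U) (c : 'I_n -> {linear U -> R}),
    (forall i, continuous (c i)) /\ forall x, x = \sum_(i < n) c i x *: e i }.

Section Findim.
Context (R : realType).
Implicit Types U V W : normedModType R.

Lemma is_diff_lin U V (l : {linear U -> V}) x : continuous l ->
  is_diff x (l : U -> V) (l : U -> V).
Proof.
by move=> cl; apply: DiffDef; [exact: linear_differentiable|exact: diff_lin].
Qed.

Global Instance findim_R : findim R.
Proof.
split; exists 1%N, (fun=> 1), (fun=> idfun); split => [i|x]; first by move=> x.
by rewrite big_ord1 /= /GRing.scale /= mulr1.
Qed.

Definition mklin U V (f : U -> V) (lf : linear f) : {linear U -> V} :=
  let M := GRing.isLinear.Build _ _ _ _ f lf in HB.pack f M.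

Lemma coord_is_linear m n (i : 'I_m) (j : 'I_n) :
  linear (fun M : 'M[R]_(m, n) => M i j : R).
Proof. by move=> k M N; rewrite !mxE. Qed.

Definition coord_lin m n (i : 'I_m) (j : 'I_n) : {linear 'M[R]_(m, n) -> R} :=
  mklin (coord_is_linear i j).

Global Instance findim_mx m n : findim 'M[R]_(m, n).
Proof.
split; exists #|{: 'I_m * 'I_n}|,
  (fun k => delta_mx (enum_val k).1 (enum_val k).2),
  (fun k => coord_lin (enum_val k).1 (enum_val k).2); split.
  by move=> i; exact: coord_continuous.
move=> M; rewrite [LHS]matrix_sum_delta pair_bigA /=.
by rewrite (reindex (@enum_val _ {: 'I_m * 'I_n})) //=; apply: onW_bij; exact: enum_val_bij.
Qed.

Global Instance findim_prod U V : findim U -> findim V -> findim (U * V)%type.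
Proof.
move=> [[n [e [c [cc ce]]]]] [[m [e' [c' [cc' ce']]]]].
split; exists (n + m)%N.
exists (fun k : 'I_(n + m) => match fintype.split k with inl i => (e i, 0) | inr j => (0, e' j) end).
have l1 i : linear (fun p : U * V => c i p.1) by move=> k p q; rewrite linearP.
have l2 i : linear (fun p : U * V => c' i p.2) by move=> k p q; rewrite linearP.
pose L1 i := mklin (l1 i); pose L2 i := mklin (l2 i).
exists (fun k : 'I_(n + m) => match fintype.split k with inl i => L1 i | inr j => L2 j end); split.
  move=> k; case: (fintype.split k) => i p /=.
    by apply: (@continuous_comp _ _ _ fst (c i)); [exact: cvg_fst|exact: cc].
  by apply: (@continuous_comp _ _ _ snd (c' i)); [exact: cvg_snd|exact: cc'].
move=> [x y]; rewrite big_split_ord /=.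
under eq_bigr do rewrite (unsplitK (inl _)).
under [X in _ + X]eq_bigr do rewrite (unsplitK (inr _)).
rewrite {1}[x]ce {1}[y]ce'.
have -> : \sum_(i < n) L1 i (x, y) *: ((e i, 0) : U * V) = (\sum_(i < n) c i x *: e i, 0).
  elim/big_ind2 : _ => //= [a b a' b' -> ->|i _].
    by congr (_, _); rewrite addr0.
  by congr (_, _); rewrite scaler0.
have -> : \sum_(i < m) L2 i (x, y) *: ((0, e' i) : U * V) = (0, \sum_(i < m) c' i y *: e' i).
  elim/big_ind2 : _ => //= [a b a' b' -> ->|i _].
    by congr (_, _); rewrite addr0.
  by congr (_, _); rewrite scaler0.
by congr (_, _); rewrite ?addr0 ?add0r.
Qed.

Lemma continuous_sumr U V n (F : 'I_n -> U -> V) :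
  (forall i, continuous (F i)) -> continuous (fun x => \sum_(i < n) F i x).
Proof.
move=> cF; rewrite -fct_sumE; elim/big_ind : _ => //= [|f g cf cg] x.
  exact: cst_continuous.
by apply: continuousD; [exact: cf|exact: cg].
Qed.

(** The family in [findim] need not be free: it is enough that a vector is recovered from finitely
    many continuous coordinates, since a linear map is then a finite sum of scalar functions times
    constants. *)
Lemma lin_continuous U V (fU : findim U) (l : {linear U -> V}) : continuous l.
Proof.
case: fU => -[n [e [c [cc ce]]]].
have -> : (l : U -> V) = (fun x => \sum_(i < n) c i x *: l (e i)).
  apply/funext => x; rewrite {1}[x]ce linear_sum.
  by apply: eq_bigr => i _; rewrite linearZ.
apply: continuous_sumr => i x.
by apply: continuousZr_tmp; exact: cc.
Qed.

Section Scale.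
Context (V : normedModType R).
(** A named copy of scaling, to which a bilinear structure can be attached so that the differential
    of a bilinear map applies. *)
Definition scaleb (k : R) (v : V) := k *: v.
Lemma scaleb_bilinear :
  bilinear_for (GRing.Scale.Law.clone _ _ *:%R _) (GRing.Scale.Law.clone _ _ *:%R _) scaleb.
Proof.
by split=> [u'|u] a x y /=; rewrite /scaleb ?scalerDl ?scalerDr ?scalerA // mulrC.
Qed.
HB.instance Definition _ := bilinear_isBilinear.Build R R V V _ _ scaleb scaleb_bilinear.
End Scale.

Lemma is_diff_scale U V (k dk : U -> R) (f df : U -> V) x :
  is_diff x k dk -> is_diff x f df ->
  is_diff x (fun y => k y *: f y) (fun v => k x *: df v + dk v *: f x).
Proof.
move=> dkx dfx.
have sc : continuous (fun p : R * V => scaleb p.1 p.2).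
  by move=> p; apply: continuousZ; [exact: cvg_fst|exact: cvg_snd].
have ds : is_diff (k x, f x) (fun p : R * V => scaleb p.1 p.2)
    (fun q => scaleb (k x) q.2 + scaleb q.1 (f x)).
  apply: DiffDef; first exact: differentiable_bilin.
  by rewrite diff_bilin.
exact: (is_diff_comp (is_diff_pair dkx dfx) ds).
Qed.

End Findim.

Section Cn.
Context (R : realType).
Implicit Types U V W : normedModType R.

Lemma is_diff_derive U V (f df : U -> V) x v : is_diff x f df -> 'D_v f x = df v.
Proof. by move=> fx; rewrite deriveE ?diff_val. Qed.

Lemma CnW U V n (f : U -> V) : Cn n.+1 f -> Cn n f.
Proof.
elim: n f => [|n IHn] f.
  by move=> [df _] x; apply: differentiable_continuous.
by move=> [df Df]; split => // v; exact/IHn.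
Qed.

Lemma Cn_cst U V n (a : V) : Cn n (fun _ : U => a).
Proof.
elim: n a => [|n IHn] a; first exact: cst_continuous.
split => [x|v]; first exact: differentiable_cst.
have -> : (fun x => 'D_v (fun _ : U => a) x) = fun=> 0; last exact: IHn.
by apply/funext => x; rewrite derive_cst.
Qed.

Lemma Cn_lin U V n (l : {linear U -> V}) : continuous l -> Cn n l.
Proof.
move=> cl; case: n => [//|n]; split => [x|v].
  exact: (@ex_diff _ _ _ _ _ _ _ (is_diff_lin x cl)).
have -> : (fun x => 'D_v l x) = fun=> l v; last exact: Cn_cst.
by apply/funext => x; rewrite (is_diff_derive _ (is_diff_lin x cl)).
Qed.

Lemma CnD U V n (f g : U -> V) : Cn n f -> Cn n g -> Cn n (fun x => f x + g x).
Proof.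
elim: n f g => [|n IHn] f g.
  by move=> cf cg x; apply: continuousD; [exact: cf|exact: cg].
move=> [df Df] [dg Dg]; split => [x|v]; first exact: differentiableD.
have -> : (fun x => 'D_v (fun x => f x + g x) x) = fun x => 'D_v f x + 'D_v g x;
  last exact: (IHn _ _ (Df v) (Dg v)).
by apply/funext => x; rewrite deriveD //; exact: diff_derivable.
Qed.

Lemma Cn_scale U V n (k : U -> R) (f : U -> V) : Cn n k -> Cn n f ->
  Cn n (fun x => k x *: f x).
Proof.
elim: n k f => [|n IHn] k f.
  by move=> cf cg x; apply: continuousZ; [exact: cf|exact: cg].
move=> Ck Cf; have [[dk Dk] [df Df]] := (Ck, Cf); split => [x|v].
  by have /differentiableP dkx := dk x; have /differentiableP dfx := df x;
    have [] := is_diff_scale dkx dfx.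
have -> : (fun x => 'D_v (fun x => k x *: f x) x) =
    fun x => k x *: 'D_v f x + 'D_v k x *: f x; last first.
  by apply: CnD; apply: IHn; [exact: CnW|exact: Df|exact: Dk|exact: CnW].
apply/funext => x.
have /differentiableP dkx := dk x; have /differentiableP dfx := df x.
by rewrite (is_diff_derive _ (is_diff_scale dkx dfx)) !deriveE.
Qed.

Lemma Cn_sum U V n I (l : seq I) (F : I -> U -> V) (P : pred I) :
  (forall i, P i -> Cn n (F i)) -> Cn n (fun x => \sum_(i <- l | P i) F i x).
Proof.
move=> CF; rewrite -fct_sumE; elim/big_ind : _ => //= [|f g]; first exact: Cn_cst.
exact: CnD.
Qed.

(** [Cn] differentiates along fixed vectors, whereas the chain rule differentiates [g] along the
    moving vector ['D_v f x]. Expanding that vector in coordinates of [V] leaves scalar factors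
    times derivatives of [g] in fixed directions, and the induction applies to both. *)
Lemma Cn_comp U V W n (f : U -> V) (g : V -> W) : findim V -> Cn n f -> Cn n g ->
  Cn n (fun x => g (f x)).
Proof.
case=> -[d [e [c [cc ce]]]].
elim: n W f g => [|n IHn] W f g.
  by move=> cf cg x; apply: continuous_comp; [exact: cf|exact: cg].
move=> Cf Cg; have [[df Df] [dg Dg]] := (Cf, Cg); split => [x|v].
  exact: differentiable_comp.
have -> : (fun x => 'D_v (fun x => g (f x)) x) =
    fun x => \sum_(i < d) c i ('D_v f x) *: 'D_(e i) g (f x).
  apply/funext => x; have /differentiableP dfx := df x.
  have /differentiableP dgx := dg (f x).
  rewrite (is_diff_derive _ (is_diff_comp dfx dgx)) /= deriveE //.
  rewrite [X in 'd g _ X]ce linear_sum; apply: eq_bigr => i _.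
  by rewrite linearZ deriveE.
apply: Cn_sum => i _; apply: Cn_scale; last exact: IHn (CnW Cf) (Dg _).
by apply: (IHn _ _ (c i)); [exact: Df|exact: Cn_lin].
Qed.

End Cn.

(** * Locally uniform big-O in a step size *)

Section BigO.
Context (R : realType).
Implicit Types P U V W : normedModType R.

(** The neighbourhood is one of pairs (base point, step), so the constant serves all base points
    close to [x0]. *)
Definition bO P W n (x0 : P) (E : P * R -> W) :=
  exists C, \forall p \near (x0, 0 : R), `|E p| <= C * `|p.2| ^+ n.

Lemma near_all_pt P (x0 : P) (Q : P -> Prop) : (forall x, Q x) ->
  \forall x \near x0, Q x.
Proof. exact: nearW. Qed.

Lemma near_all P (x0 : P) (Q : P * R -> Prop) : (forall p, Q p) ->
  \forall p \near (x0, 0 : R), Q p.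
Proof. by move=> Qp; near=> p; exact: Qp. Unshelve. all: by end_near. Qed.

Lemma near_box P (x0 : P) (Q : P * R -> Prop) :
  (\forall p \near (x0, 0 : R), Q p) ->
  exists2 e, 0 < e & forall x h, `|x0 - x| < e -> `|h| < e -> Q (x, h).
Proof.
move=> H; have /(nbhs_ballP (x0, 0 : R))[e e0 he] : nbhs (x0, 0 : R) Q by [].
exists e => // x h xe hep; apply: he; split; rewrite /= -ball_normE /ball_ //=.
by rewrite sub0r normrN.
Qed.

Lemma box_near P (x0 : P) (Q : P * R -> Prop) e : 0 < e ->
  (forall x h, `|x0 - x| < e -> `|h| < e -> Q (x, h)) ->
  \forall p \near (x0, 0 : R), Q p.
Proof.
move=> e0 he; apply/(nbhs_ballP (x0, 0 : R)); exists e => // -[x h] [/=].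
by rewrite -!ball_normE /ball_ /= sub0r normrN; exact: he.
Qed.

Lemma bO_ge0 P W n (x0 : P) (E : P * R -> W) : bO n x0 E ->
  exists2 C, 0 <= C & \forall p \near (x0, 0 : R), `|E p| <= C * `|p.2| ^+ n.
Proof.
case=> C EC; exists `|C| => //; apply: filterS EC => p /le_trans; apply.
by rewrite ler_wpM2r // ?exprn_ge0 // ler_norm.
Qed.

Lemma bO_near P W n (x0 : P) (E E' : P * R -> W) :
  (\forall p \near (x0, 0 : R), E p = E' p) -> bO n x0 E -> bO n x0 E'.
Proof.
by move=> EE' [C EC]; exists C; apply: filterS2 EE' EC => p ->.
Qed.

Lemma near_snd P (x0 : P) (Q : R -> Prop) : (\forall h \near (0 : R), Q h) ->
  \forall p \near (x0, 0 : R), Q p.2.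
Proof.
move=> Q0; have : snd p @[p --> (x0, 0 : R)] --> (0 : R) by exact: cvg_snd.
by apply.
Qed.

Lemma near_fst P (x0 : P) (Q : P -> Prop) : (\forall x \near x0, Q x) ->
  \forall p \near (x0, 0 : R), Q p.1.
Proof.
move=> Q0; have : fst p @[p --> (x0, 0 : R)] --> x0 by exact: cvg_fst.
by apply.
Qed.

Lemma near_norm_lt (e : R) : 0 < e -> \forall h \near (0 : R), `|h| < e.
Proof.
by move=> e0; apply/nbhs_norm0P; exists e.
Qed.

Lemma bO_leq P W m n (x0 : P) (E : P * R -> W) : (m <= n)%N -> bO n x0 E -> bO m x0 E.
Proof.
move=> mn /bO_ge0[C C0 EC]; exists C.
have h1 : \forall p \near (x0, 0 : R), `|p.2| < 1 
  by exact: (near_snd (Q := fun h => `|h| < 1) x0 (near_norm_lt ltr01)).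
apply: filterS (filterI h1 EC) => p [p1] /le_trans; apply.
by rewrite ler_wpM2l // ler_wiXn2l // ltW.
Qed.

Lemma bOD P W n (x0 : P) (E E' : P * R -> W) : bO n x0 E -> bO n x0 E' ->
  bO n x0 (fun p => E p + E' p).
Proof.
move=> [C EC] [C' EC']; exists (C + C'); apply: filterS2 EC EC' => p EC EC'.
by rewrite (le_trans (ler_normD _ _)) // mulrDl lerD.
Qed.

Lemma bO0 P W n (x0 : P) : bO n x0 (fun _ => 0 : W).
Proof. by exists 0; apply: near_all => p; rewrite normr0 mul0r. Qed.

Lemma bO_sum P W n m (x0 : P) (E : 'I_m -> P * R -> W) (Q : pred 'I_m) :
  (forall i, Q i -> bO n x0 (E i)) ->
  bO n x0 (fun p => \sum_(i < m | Q i) E i p).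
Proof.
move=> CF; rewrite -fct_sumE; elim/big_ind : _ => //= [|f g]; first exact: bO0.
exact: bOD.
Qed.

Lemma bO_le P V W n (x0 : P) (E : P * R -> V) (E' : P * R -> W) K :
  (\forall p \near (x0, 0 : R), `|E' p| <= K * `|E p|) -> bO n x0 E -> bO n x0 E'.
Proof.
move=> EE' [C EC]; exists (`|K| * C); apply: filterS2 EE' EC => p EE' EC.
apply: (le_trans EE'); rewrite -mulrA (@le_trans _ _ (`|K| * `|E p|)) //.
  by rewrite ler_wpM2r // ler_norm.
by rewrite ler_wpM2l.
Qed.

Lemma bON P W n (x0 : P) (E : P * R -> W) : bO n x0 E -> bO n x0 (fun p => - E p).
Proof.
by apply: (bO_le (K := 1)); apply: near_all => p; rewrite mul1r normrN.
Qed.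

Lemma bOB P W n (x0 : P) (E E' : P * R -> W) : bO n x0 E -> bO n x0 E' ->
  bO n x0 (fun p => E p - E' p).
Proof. by move=> EO /bON; exact: bOD. Qed.

Lemma bO_cvg P W (x0 : P) (E : P * R -> W) (l : W) :
  E p @[p --> (x0, 0 : R)] --> l -> bO 0 x0 E.
Proof.
move=> El; exists (`|l| + 1); near=> p; rewrite expr0 mulr1.
have -> : E p = l + (E p - l) by rewrite addrC subrK.
rewrite (le_trans (ler_normD _ _)) // lerD2l ltW //.
by near: p; move/cvgrPdist_lt : El => /(_ 1 ltr01); apply: filterS => p; rewrite distrC.
Unshelve. all: by end_near. Qed.

Lemma bO_scale P W m n (x0 : P) (k : P * R -> R) (E : P * R -> W) :
  bO m x0 k -> bO n x0 E -> bO (m + n) x0 (fun p => k p *: E p).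
Proof.
move=> [C EC] [C' EC']; exists (C * C'); apply: filterS2 EC EC' => p EC EC'.
by rewrite normrZ exprD mulrACA ler_pM.
Qed.

Lemma bO_pow P n (x0 : P) : bO n x0 (fun p : P * R => p.2 ^+ n).
Proof. by exists 1; apply: near_all => p; rewrite mul1r normrX. Qed.

Lemma bO_lin P V W n (x0 : P) (l : {linear V -> W}) (E : P * R -> V) :
  continuous l -> bO n x0 E -> bO n x0 (fun p => l (E p)).
Proof.
move=> /linear_lipschitz[K _ lK]; apply: (bO_le (K := K)); exact: near_all.
Qed.

(** The tool for evaluating an estimate at a moved base point and a rescaled step; uniformity in the
    base point is what makes it valid. *)
Lemma bO_subst P P' W n (x0 : P) (y0 : P') (E : P * R -> W) (s : P' * R -> P * R) K :
  (s p @[p --> (y0, 0 : R)] --> (x0, 0 : R)) ->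
  (\forall p \near (y0, 0 : R), `|(s p).2| <= K * `|p.2|) ->
  bO n x0 E -> bO n y0 (fun p => E (s p)).
Proof.
move=> sx sK /bO_ge0[C C0 EC]; exists (C * `|K| ^+ n).
apply: filterS2 sK (sx _ EC) => p sK /= /le_trans; apply.
rewrite -mulrA ler_wpM2l // -exprMn lerXn2r ?nnegrE ?mulr_ge0 //.
by rewrite (le_trans sK) // ler_wpM2r // ler_norm.
Qed.

(** By the mean value theorem on [[0, h]] or [[h, 0]], the increment is [h] times the derivative at
    some [c] with [|c| <= |h|], which gains one power of [h]. *)
Lemma bO_int_scalar P n (x0 : P) (E E' : P * R -> R) :
  (\forall x \near x0, E (x, 0) = 0) ->
  (\forall p \near (x0, 0 : R), is_derive (p.2 : R) (1 : R) (fun s => E (p.1, s)) (E' p)) ->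
  bO n x0 E' -> bO n.+1 x0 E.
Proof.
move=> /near_fst E0 dE /bO_ge0[C C0 EC].
exists C; have [e e0 he] := near_box (filterI E0 (filterI dE EC)).
apply: (box_near e0) => x h xe hep.
have he' s : `|s| <= `|h| -> E (x, 0) = 0 /\
    is_derive s (1 : R) (fun s => E (x, s)) (E' (x, s)) /\ `|E' (x, s)| <= C * `|s| ^+ n.
  move=> sh; apply: (he x s) => //; exact: le_lt_trans hep.
suff [c ch ->] : exists2 c, `|c| <= `|h| & E (x, h) = E' (x, c) * h.
  rewrite normrM exprSr mulrA ler_wpM2r //.
  have [_ [_ /le_trans]] := he' c ch; apply.
  by rewrite ler_wpM2l // lerXn2r ?nnegrE.
have Ex0 : E (x, 0) = 0 by have [] := he' 0; rewrite ?normr0.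
have [h0|h0] := leP 0 h.
  have inh c : c \in `[0, h]%R -> `|c| <= `|h|.
    by rewrite in_itv /= => /andP[? ?]; rewrite !ger0_norm.
  have [s sh||c /inh ch] := @MVT_segment _ (fun s => E (x, s)) (fun s => E' (x, s)) 0 h h0.
  - by have [_ []] := he' s (inh s (subset_itv_oo_cc sh)).
  - apply: derivable_within_continuous.
    by move=> s /inh sh; have [_ [ds _]] := he' s sh.
  - by rewrite Ex0 !subr0 => ->; exists c.
have inh c : c \in `[h, 0]%R -> `|c| <= `|h|.
  rewrite in_itv /= => /andP[? ?]; rewrite !ler0_norm ?lerN2 //.
  exact: ltW.
have [s sh||c /inh ch] := @MVT_segment _ (fun s => E (x, s)) (fun s => E' (x, s)) h 0 (ltW h0).
- by have [_ []] := he' s (inh s (subset_itv_oo_cc sh)).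
- apply: derivable_within_continuous.
  by move=> s /inh sh; have [_ [ds _]] := he' s sh.
- by rewrite Ex0 !sub0r mulrN => /oppr_inj ->; exists c.
Qed.

(** The mean value theorem holds as an equality only for scalar functions, hence the passage to
    coordinates. *)
Lemma bO_int P W n (x0 : P) (E E' : P * R -> W) : findim W ->
  (\forall x \near x0, E (x, 0) = 0) ->
  (\forall p \near (x0, 0 : R), is_derive (p.2 : R) (1 : R) (fun s => E (p.1, s)) (E' p)) ->
  bO n x0 E' -> bO n.+1 x0 E.
Proof.
case=> -[d [e [c [cc ce]]]] E0 dE EO.
have -> : E = fun p => \sum_(i < d) c i (E p) *: e i by apply/funext => p; exact: ce.
apply: bO_sum => i _.
rewrite -(addn0 n.+1); apply: bO_scale; last by apply: bO_cvg; exact: cvg_cst.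
apply: (@bO_int_scalar _ _ _ _ (fun p => c i (E' p))); last exact: bO_lin.
- by apply: filterS E0 => x ->; rewrite linear0.
- apply: filterS dE => -[x h] /= [dp <-].
  have dpx : is_diff h (fun s : R => E (x, s)) ('d (fun s : R => E (x, s)) h).
    by apply: differentiableP; exact/derivable1_diffP.
  have := is_diff_comp dpx (is_diff_lin (E (x, h)) (cc i)).
  move=> dcx; apply: DeriveDef; first exact/derivable1_diffP.
  by rewrite (is_diff_derive _ dcx) /= deriveE.
Qed.

End BigO.

(** * Smooth functions, Lie derivatives and Taylor polynomials of flows *)

Section Smooth.
Context (R : realType).
Implicit Types P U V W : normedModType R.

Lemma smooth_differentiable U V (f : U -> V) x : smooth f -> differentiable f x.
Proof. by move=> /(_ 1%N)[df _]; exact: df. Qed.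

Lemma smooth_continuous U V (f : U -> V) : smooth f -> continuous f.
Proof. by move=> /(_ 0%N). Qed.

Lemma smooth_derive U V (f : U -> V) v : smooth f -> smooth (fun x => 'D_v f x).
Proof. by move=> sf n; have [_] := sf n.+1; exact. Qed.

Lemma smooth_cst U V (a : V) : smooth (fun _ : U => a).
Proof. by move=> n; exact: Cn_cst. Qed.

Lemma smooth_lin U V (l : {linear U -> V}) : findim U -> smooth l.
Proof. by move=> fU n; apply: Cn_lin; exact: lin_continuous. Qed.

Lemma smooth_is_linear U V (f : U -> V) : findim U -> linear f -> smooth f.
Proof. by move=> fU lf; exact: (@smooth_lin _ _ (mklin lf)). Qed.

Lemma smoothD U V (f g : U -> V) : smooth f -> smooth g -> smooth (fun x => f x + g x).
Proof. by move=> sf sg n; exact: CnD. Qed.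

Lemma smooth_scale U V (k : U -> R) (f : U -> V) : smooth k -> smooth f ->
  smooth (fun x => k x *: f x).
Proof. by move=> sf sg n; exact: Cn_scale. Qed.

Lemma smoothM U (f g : U -> R) : smooth f -> smooth g -> smooth (fun x => f x * g x).
Proof. exact: smooth_scale. Qed.

Lemma smoothZ U V (k : R) (f : U -> V) : smooth f -> smooth (fun x => k *: f x).
Proof. by apply: smooth_scale; exact: smooth_cst. Qed.

Lemma smoothN U V (f : U -> V) : smooth f -> smooth (fun x => - f x).
Proof.
move=> sf; under [X in smooth X]eq_fun do rewrite -scaleN1r.
exact: smoothZ.
Qed.

Lemma smoothB U V (f g : U -> V) : smooth f -> smooth g -> smooth (fun x => f x - g x).
Proof. by move=> sf /smoothN; exact: smoothD. Qed.

Lemma smooth_sum U V I (l : seq I) (F : I -> U -> V) (Q : pred I) :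
  (forall i, Q i -> smooth (F i)) -> smooth (fun x => \sum_(i <- l | Q i) F i x).
Proof. by move=> sF n; apply: Cn_sum => i Qi; exact: sF. Qed.

Lemma smooth_prod U I (l : seq I) (F : I -> U -> R) :
  (forall i, smooth (F i)) -> smooth (fun x => \prod_(i <- l) F i x).
Proof.
move=> sF; elim: l => [|i l IHl].
  by under [X in smooth X]eq_fun do rewrite big_nil; exact: smooth_cst.
by under [X in smooth X]eq_fun do rewrite big_cons; exact: smoothM.
Qed.

Lemma smooth_exp U (f : U -> R) n : smooth f -> smooth (fun x => f x ^+ n).
Proof.
move=> sf; elim: n => [|n IHn]; first exact: smooth_cst.
under [X in smooth X]eq_fun do rewrite exprS.
exact: smoothM.
Qed.

Lemma smooth_comp U V W (f : U -> V) (g : V -> W) : findim V -> smooth f -> smooth g ->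
  smooth (fun x => g (f x)).
Proof. by move=> fV sf sg n; exact: Cn_comp. Qed.

Lemma smooth_id U : findim U -> smooth (fun x : U => x).
Proof. by move=> fU; apply: smooth_is_linear. Qed.

Lemma smooth_fst U V : findim U -> findim V -> smooth (fun x : U * V => x.1).
Proof. by move=> fU fV; apply: smooth_is_linear. Qed.

Lemma smooth_snd U V : findim U -> findim V -> smooth (fun x : U * V => x.2).
Proof. by move=> fU fV; apply: smooth_is_linear. Qed.

Lemma smooth_fst_comp U V W (f : U -> V * W) : findim V -> findim W ->
  smooth f -> smooth (fun x => (f x).1).
Proof. by move=> fV fW sf; apply: (smooth_comp _ sf); exact: smooth_fst. Qed.

Lemma smooth_snd_comp U V W (f : U -> V * W) : findim V -> findim W ->
  smooth f -> smooth (fun x => (f x).2).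
Proof. by move=> fV fW sf; apply: (smooth_comp _ sf); exact: smooth_snd. Qed.

Lemma smooth_pair U V W (f : U -> V) (g : U -> W) : findim V -> findim W ->
  smooth f -> smooth g -> smooth (fun x => (f x, g x)).
Proof.
move=> fV fW sf sg.
have l1 : linear (fun v : V => (v, 0 : W)).
  by move=> k v w; congr (_, _); rewrite /= scaler0 addr0.
have l2 : linear (fun w : W => (0 : V, w)).
  by move=> k v w; congr (_, _); rewrite /= scaler0 addr0.
have -> : (fun x => (f x, g x)) = fun x => (f x, 0) + (0, g x).
  by apply/funext => x; congr (_, _); rewrite /= ?addr0 ?add0r.
apply: smoothD.
  exact: (smooth_comp fV sf (smooth_is_linear fV l1)).
exact: (smooth_comp fW sg (smooth_is_linear fW l2)).
Qed.

Lemma smooth_coord U m n (f : U -> 'M[R]_(m, n)) i j : smooth f ->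
  smooth (fun x => f x i j : R).
Proof.
move=> sf; exact: (smooth_comp _ sf (smooth_lin (coord_lin R i j) _)).
Qed.

Lemma smooth_mx U m n (f : U -> 'M[R]_(m, n)) :
  (forall i j, smooth (fun x => f x i j : R)) -> smooth f.
Proof.
move=> sf.
have -> : f = fun x => \sum_i \sum_j (f x i j : R) *: delta_mx i j.
  by apply/funext => x; exact: matrix_sum_delta.
do 2![apply: smooth_sum => ? _]; apply: smooth_scale; first exact: sf.
exact: smooth_cst.
Qed.

Lemma smooth_mulmx U m n p (f : U -> 'M[R]_(m, n)) (g : U -> 'M[R]_(n, p)) :
  smooth f -> smooth g -> smooth (fun x => f x *m g x).
Proof.
move=> sf sg; apply: smooth_mx => i j.
under [X in smooth X]eq_fun do rewrite mxE.
by apply: smooth_sum => k _; apply: smoothM; exact: smooth_coord.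
Qed.

Lemma smooth_det U n (f : U -> 'M[R]_n) : smooth f -> smooth (fun x => \det (f x)).
Proof.
move=> sf; apply: smooth_sum => t _; apply: smoothM; first exact: smooth_cst.
by apply: smooth_prod => i; exact: smooth_coord.
Qed.

Lemma smooth_adj U n (f : U -> 'M[R]_n) : smooth f -> smooth (fun x => \adj (f x)).
Proof.
move=> sf; apply: smooth_mx => i j.
under [X in smooth X]eq_fun do rewrite mxE.
apply: smoothM; first exact: smooth_cst.
apply: smooth_det; apply: smooth_mx => k l.
under [X in smooth X]eq_fun do rewrite !mxE.
exact: smooth_coord.
Qed.

Lemma smooth_row_mx U m n p (f : U -> 'M[R]_(m, n)) (g : U -> 'M[R]_(m, p)) :
  smooth f -> smooth g -> smooth (fun x => row_mx (f x) (g x)).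
Proof.
move=> sf sg; apply: smooth_mx => i j; rewrite -(splitK j).
case: (fintype.split j) => k /=.
  by under [X in smooth X]eq_fun do rewrite row_mxEl; exact: smooth_coord.
by under [X in smooth X]eq_fun do rewrite row_mxEr; exact: smooth_coord.
Qed.

Lemma derive_basis U W n (e : 'I_n -> U) (c : 'I_n -> U -> R) (g : U -> W) x v :
  (forall u, u = \sum_i c i u *: e i) -> differentiable g x ->
  'D_v g x = \sum_i c i v *: 'D_(e i) g x.
Proof.
move=> ce dg; rewrite deriveE // {1}[v]ce linear_sum; apply: eq_bigr => i _.
by rewrite linearZ deriveE.
Qed.

Definition Lie U W (X : U -> U) (g : U -> W) (x : U) : W := 'D_(X x) g x.

(** The direction [X x] varies with [x], while [smooth] only speaks of fixed directions; coordinates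
    separate the two. *)
Lemma smooth_Lie U W (X : U -> U) (g : U -> W) : findim U -> smooth X -> smooth g ->
  smooth (Lie X g).
Proof.
move=> fU sX sg; have [[n [e [c [cc ce]]]]] := fU.
have -> : Lie X g = fun x => \sum_i c i (X x) *: 'D_(e i) g x.
  apply/funext => x; apply: (derive_basis (c := c)) => //.
  exact: smooth_differentiable.
apply: smooth_sum => i _; apply: smooth_scale; last exact: smooth_derive.
exact: (smooth_comp fU sX (smooth_lin (c i) _)).
Qed.

Lemma smooth_iter_Lie U W (X : U -> U) (g : U -> W) k : findim U -> smooth X ->
  smooth g -> smooth (iter k (Lie X) g).
Proof. by move=> fU sX sg; elim: k => //= k IHk; exact: smooth_Lie. Qed.

(** The truncation of [exp (h X)] acting on [g]. It has [N] terms, hence degree [N - 1], and the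
    natural remainder is of order [h^N]. *)
Definition tay U W N (X : U -> U) (g : U -> W) (x : U) (h : R) : W :=
  \sum_(k < N) (h ^+ k / k`!%:R) *: iter k (Lie X) g x.

Lemma is_derive_tay U W N (X : U -> U) (g : U -> W) x (h : R) :
  is_derive h 1 (tay N.+1 X g x) (tay N X (Lie X g) x h).
Proof.
have -> : tay N.+1 X g x = cst (g x) +
    \sum_(k < N) (fun h => (h ^+ k.+1 / (k.+1)`!%:R) *: iter k (Lie X) (Lie X g) x).
  apply/funext => s; rewrite /tay big_ord_recl /= expr0 divr1 scale1r.
  rewrite -[RHS]/(_ + _) fct_sumE; congr (_ + _).
  by apply: eq_bigr => k _; rewrite -iterSr.
rewrite -[tay _ _ _ _ _]add0r; apply: is_deriveD.
apply: is_derive_sum => k; set a := iter _ _ _ _.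
have dk : is_diff h (fun s : R => s ^+ k.+1)
    (fun v => v * (k.+1%:R * h ^+ k)).
  have dX : derivable (fun s : R => s ^+ k.+1) h 1 by exact: exprn_derivable.
  apply: DiffDef; first exact/derivable1_diffP.
  rewrite diff1E; last exact/derivable1_diffP.
  by apply/funext => v /=; rewrite exp_derive1 -mulr_natl.
have dS := is_diff_scale dk (is_diff_cst ((k.+1)`!%:R^-1 *: a) h).
have -> : (fun s : R => (s ^+ k.+1 / (k.+1)`!%:R) *: a) =
    (fun s : R => s ^+ k.+1 *: cst ((k.+1)`!%:R^-1 *: a) s).
  by apply/funext => s; rewrite scalerA.
apply: DeriveDef; first by apply: diff_derivable; case: dS.
rewrite (is_diff_derive _ dS) /= scaler0 add0r mul1r scalerA; congr (_ *: _).
by rewrite factS natrM invfM mulrAC mulrA mulfV ?pnatr_eq0 // mul1r mulrC.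
Qed.

Lemma tay0 U W N (X : U -> U) (g : U -> W) x : tay N.+1 X g x 0 = g x.
Proof.
rewrite /tay big_ord_recl /= expr0 divr1 scale1r big1 ?addr0 // => k _.
by rewrite exprS !mul0r scale0r.
Qed.

Lemma bO_smooth_comp P U W (x0 : P) (u : P * R -> U) (y0 : U) (g : U -> W) : smooth g ->
  u p @[p --> (x0, 0 : R)] --> y0 -> bO 0 x0 (fun p => g (u p)).
Proof.
move=> sg uy; apply: (bO_cvg (l := g y0)).
by apply: (cvg_comp _ _ uy); exact: smooth_continuous.
Qed.

(* [c] solves the equation of [X] up to the defect [rho]; no exact flow of [X]
   is needed. *)
Lemma approx_flow P U W (X : U -> U) (x0 : P) (iota : P -> U) (c rho : P * R -> U) N :
  findim U -> findim W -> smooth X ->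
  c p @[p --> (x0, 0 : R)] --> iota x0 ->
  {for x0, continuous iota} ->
  (\forall x \near x0, c (x, 0) = iota x) ->
  (\forall p \near (x0, 0 : R),
    is_derive (p.2 : R) (1 : R) (fun s => c (p.1, s)) (X (c p) + rho p)) ->
  bO N.-1 x0 rho ->
  forall g : U -> W, smooth g ->
  bO N x0 (fun p => g (c p) - tay N X g (iota p.1) p.2).
Proof.
move=> fU fW sX cx ci c0 dc; elim: N => [_ g sg|N IHN rhoO g sg].
  apply: bOB; first exact: bO_smooth_comp cx.
  have -> : (fun p : P * R => tay 0 X g (iota p.1) p.2) = fun=> 0.
    by apply/funext => p; rewrite /tay big_ord0.
  exact: bO0.
(* The derivative in [h] of the error for [g] is the error of one order less for [Lie X g], plus the
   defect seen through the derivative of [g]. Integration restores the lost power, which is why a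
   defect of order [N.-1] suffices. *)
pose E' p := Lie X g (c p) - tay N X (Lie X g) (iota p.1) p.2 + 'D_(rho p) g (c p).
apply: (bO_int (E' := E')) => //.
- by apply: filterS c0 => x cx0; rewrite cx0 tay0 subrr.
- apply: filterS dc => -[x h] /= [dcx cE].
  have dch : is_diff h (fun s : R => c (x, s)) ('d (fun s : R => c (x, s)) h).
    by apply: differentiableP; exact/derivable1_diffP.
  have dg : is_diff (c (x, h)) g ('d g (c (x, h))).
    by apply: differentiableP; exact: smooth_differentiable.
  have dgc := is_diff_comp dch dg.
  rewrite /E' addrAC; apply: is_deriveB; last exact: is_derive_tay.
  apply: DeriveDef; first exact/derivable1_diffP.
  rewrite (is_diff_derive _ dgc) /= -(is_diff_derive _ dch) cE linearD.
  by rewrite /Lie !deriveE //; exact: smooth_differentiable.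
- apply: bOD.
    apply: IHN; last exact: smooth_Lie.
    by apply: bO_leq rhoO; exact: leq_pred.
  have [[n [e [co [cco ce]]]]] := fU.
  have -> : (fun p => 'D_(rho p) g (c p)) =
      fun p => \sum_i co i (rho p) *: 'D_(e i) g (c p).
    apply/funext => p; apply: (derive_basis (c := co)) => //.
    exact: smooth_differentiable.
  apply: bO_sum => i _; rewrite -[N]addn0; apply: bO_scale; first exact: bO_lin.
  by apply: (@bO_smooth_comp _ _ _ _ _ _ (fun x => 'D_(e i) g x)) cx; exact: smooth_derive.
Qed.

(** The partial derivatives are bounded near [y0], and the mean value theorem on the segment from
    [y] to [x] turns this bound into a Lipschitz constant. *)
Lemma smooth_lip_scalar U (g : U -> R) y0 : findim U -> smooth g ->
  exists K, exists2 e, 0 < e & forall x y, `|y0 - x| < e -> `|y0 - y| < e ->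
    `|g x - g y| <= K * `|x - y|.
Proof.
move=> fU sg; have [[n [b [c [cc ce]]]]] := fU.
have [k kP] : exists k : 'I_n -> R, forall i x, `|c i x| <= k i * `|x|.
  have /choice[k kP] : forall i, exists k, forall x, `|c i x| <= k * `|x|.
    by move=> i; have [k _ kP] := linear_lipschitz (cc i); exists k.
  by exists k.
have : \forall w \near y0, forall i, `|'D_(b i) g w| <= `|'D_(b i) g y0| + 1.
  apply: filter_forall => i.
  have /cvgrPdist_lt /(_ 1 ltr01) := smooth_continuous (smooth_derive (b i) sg) (x := y0).
  apply: filterS => w /= wy.
  have -> : 'D_(b i) g w = 'D_(b i) g y0 - ('D_(b i) g y0 - 'D_(b i) g w).
    by rewrite opprB addrC subrK.
  by rewrite (le_trans (ler_normB _ _)) // lerD2l ltW.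
move=> /nbhs_normP[e e0 he].
exists (\sum_i k i * (`|'D_(b i) g y0| + 1)), e => // x y xe ye.
pose f (s : R) := g (y + s *: (x - y)).
pose df (s : R) := 'D_(x - y) g (y + s *: (x - y)).
have fP (s : R) : is_derive s (1 : R) f (df s).
  have dl : is_diff s (fun s : R => y + s *: (x - y)) (fun v => v *: (x - y)).
    have := is_diff_scale (is_diff_id s) (is_diff_cst (x - y) s).
    move=> /(is_diffD (is_diff_cst y s))[H1 H2]; apply: DiffDef; first exact: H1.
    etransitivity; first exact: H2.
    by apply/funext => v; rewrite /= -[LHS]/(_ + (_ + _)) /= scaler0 !add0r.
  have dg := differentiableP (smooth_differentiable (y + s *: (x - y)) sg).
  have dgl := is_diff_comp dl dg.
  apply: DeriveDef; first exact/derivable1_diffP.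
  by rewrite (is_diff_derive _ dgl) /= scale1r /df deriveE.
have [|t t01] := @MVT_segment _ f df 0 1 ler01.
  apply: derivable_within_continuous => s _; exact: (@ex_derive _ _ _ _ _ _ _ (fP s)).
rewrite /f scale1r scale0r addr0 [y + _]addrC subrK subr0 mulr1 => ->.
(* The intermediate point is a convex combination of [x] and [y], so it stays in the ball where the
   partial derivatives are bounded. *)
have tw : `|y0 - (y + t *: (x - y))| < e.
  have -> : y0 - (y + t *: (x - y)) = (1 - t) *: (y0 - y) + t *: (y0 - x).
    rewrite scalerBl scale1r -addrA [- _ + _]addrC -scalerBr opprD addrA.
    by congr (_ + _); rewrite -scalerN !opprB [y0 - x + _]addrC addrA subrK.
  move: t01; rewrite in_itv /= => /andP[t0 t1].
  rewrite (le_lt_trans (ler_normD _ _)) // !normrZ (ger0_norm t0) ger0_norm ?subr_ge0 //.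
  have [->|tn0] := eqVneq t 0; first by rewrite subr0 mul0r addr0 mul1r.
  have tp : 0 < t by rewrite lt_neqAle eq_sym tn0.
  rewrite (@lt_le_trans _ _ ((1 - t) * e + t * e)) //.
    by rewrite ler_ltD ?ltr_pM2l // ler_wpM2l ?subr_ge0 // ltW.
  by rewrite -mulrDl subrK mul1r.
have dgE : df t = \sum_i c i (x - y) *: 'D_(b i) g (y + t *: (x - y)).
  by apply: (derive_basis (c := c)) => //; exact: smooth_differentiable.
rewrite dgE (le_trans (ler_norm_sum _ _ _)) // mulr_suml ler_sum // => i _.
rewrite normrZ mulrAC ler_pM //.
exact: (he _ tw i).
Qed.

Lemma bO_lip P U W (x0 : P) (u v : P * R -> U) (y0 : U) (g : U -> W) n :
  findim U -> findim W -> smooth g ->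
  u p @[p --> (x0, 0 : R)] --> y0 -> v p @[p --> (x0, 0 : R)] --> y0 ->
  bO n x0 (fun p => u p - v p) -> bO n x0 (fun p => g (u p) - g (v p)).
Proof.
move=> fU fW sg uy vy uv; have [[d [b [c [cc ce]]]]] := fW.
have -> : (fun p => g (u p) - g (v p)) =
    (fun p => \sum_i (c i (g (u p)) - c i (g (v p))) *: b i).
  apply/funext => p; rewrite {1}[g (u p)]ce {1}[g (v p)]ce -sumrB.
  by apply: eq_bigr => i _; rewrite scalerBl.
apply: bO_sum => i _; rewrite -[n]addn0.
apply: bO_scale; last by apply: bO_cvg; exact: cvg_cst.
have [K [e e0 gK]] := smooth_lip_scalar y0 fU
  (smooth_comp fW sg (smooth_lin (c i) fW)).
apply: (bO_le (K := K)) uv.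
move/cvgrPdist_lt : uy => /(_ _ e0) uy; move/cvgrPdist_lt : vy => /(_ _ e0) vy.
by apply: filterS2 uy vy => p; exact: gK.
Qed.

End Smooth.

(** * Uniqueness of Taylor coefficients and uniformity of remainders *)

Section Taylor.
Context (R : realType).
Implicit Types P U V W : normedModType R.

Lemma sum_expZ_bigO_eq0 W n (a : nat -> W) C :
  (\forall h \near (0 : R), `|\sum_(k < n) h ^+ k *: a k| <= C * `|h| ^+ n) ->
  forall k, (k < n)%N -> a k = 0.
Proof.
elim: n C => [//|n IHn] C HC.
(* Moving the top term to the other side only enlarges the constant, so the induction hypothesis
   kills all lower coefficients first. *)
have a0 k : (k < n)%N -> a k = 0.
  apply: (IHn (`|C| + `|a n|)) k.
  apply: filterS2 (near_norm_lt (@ltr01 R)) HC => h h1.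
  rewrite big_ord_recr /= => hC.
  have -> : \sum_(k < n) h ^+ k *: a k =
      (\sum_(k < n) h ^+ k *: a k + h ^+ n *: a n) - h ^+ n *: a n by rewrite addrK.
  rewrite (le_trans (ler_normB _ _)) // mulrDl lerD //; last first.
    by rewrite normrZ normrX mulrC.
  rewrite (le_trans hC) // (@le_trans _ _ (`|C| * `|h| ^+ n.+1)) //.
    by rewrite ler_wpM2r ?exprn_ge0 // ler_norm.
  by rewrite ler_wpM2l // exprS ler_piMl ?exprn_ge0 // ltW.
move=> k; rewrite ltnS leq_eqVlt => /predU1P[->|/a0 //].
apply/eqP; rewrite -normr_eq0 -[_ == _]negbK; apply/negP => an0.
have {}an0 : 0 < `|a n| by rewrite lt_neqAle eq_sym an0 normr_ge0.
have /nbhs_norm0P[e /= e0 he] := HC.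
have C1 : 0 < `|C| + 1 by rewrite ltr_wpDl.
(* Small enough for the assumed bound to hold at [h], and for [h (|C| + 1) < |a n|], which
   contradicts [|a n| <= C h]. *)
pose h := Num.min (e / 2) (`|a n| / (`|C| + 1) / 2).
have h0 : 0 < h by rewrite lt_min !divr_gt0.
have := he h; rewrite big_ord_recr /= big1 => [|j _]; last by rewrite a0 ?scaler0.
rewrite add0r normrZ normrX (gtr0_norm h0) exprSr mulrA [C * _]mulrC.
have he' : h < e.
  by rewrite /h gt_min ltr_pdivrMr // mulr_natr mulr2n ltrDl e0.
move=> /(_ he'); rewrite -mulrA ler_pM2l ?exprn_gt0 //.
apply/negP; rewrite -ltNge.
have hle : h * (`|C| + 1) < `|a n|.
  rewrite -ltr_pdivlMr // /h gt_min; apply/orP; right.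
  by rewrite ltr_pdivrMr // mulr_natr mulr2n ltrDl divr_gt0.
by apply: le_lt_trans hle; rewrite mulrC ler_pM2l // (le_trans (ler_norm _)) // lerDl.
Qed.

Lemma tayB_bO P U W (x0 : P) (X : U -> U) (g : U -> W) (iota : P -> U) M N :
  findim U -> smooth X -> smooth g -> {for x0, continuous iota} -> (N <= M)%N ->
  bO N x0 (fun p => tay M X g (iota p.1) p.2 - tay N X g (iota p.1) p.2).
Proof.
move=> fU sX sg ci NM.
have cv : iota p.1 @[p --> (x0, 0 : R)] --> iota x0.
  exact: (cvg_comp _ _ (@cvg_fst _ _ (nbhs x0) (nbhs (0 : R)) _)).
have -> : (fun p : P * R => tay M X g (iota p.1) p.2 - tay N X g (iota p.1) p.2) =
    fun p => \sum_(k < M | (N <= k)%N) (p.2 ^+ k / k`!%:R) *: iter k (Lie X) g (iota p.1).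
  apply/funext => p; rewrite /tay (bigID (fun k : 'I_M => (N <= k)%N)) /=.
  apply/eqP; rewrite -addrA addrC eq_sym -subr_eq subrr eq_sym subr_eq0; apply/eqP.
  rewrite (big_ord_widen M (fun k => (p.2 ^+ k / k`!%:R) *: iter k (Lie X) g (iota p.1)) NM).
  by apply: eq_bigl => k; rewrite -ltnNge.
apply: bO_sum => k Nk; apply: (bO_leq Nk); rewrite -[k in bO k]addn0.
apply: bO_scale.
  rewrite -[k in bO k]addn0.
  under [X in bO _ _ X]eq_fun do rewrite -[_ / _]/(_ *: _).
  apply: bO_scale; first exact: bO_pow.
  by apply: (@bO_cvg _ _ R); exact: cvg_cst.
by apply: bO_smooth_comp cv; exact: smooth_iter_Lie.
Qed.

Lemma is_derive_pair U V (f : R -> U) (g : R -> V) (df : U) (dg : V) (h : R) :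
  is_derive h 1 f df -> is_derive h 1 g dg ->
  is_derive h 1 (fun s => (f s, g s)) (df, dg).
Proof.
move=> [/derivable1_diffP/differentiableP Df <-] [/derivable1_diffP/differentiableP Dg <-].
have Dp := is_diff_pair Df Dg; apply: DeriveDef.
  by apply/derivable1_diffP; case: Dp.
by rewrite (is_diff_derive _ Dp) (is_diff_derive _ Df) (is_diff_derive _ Dg).
Qed.

(** The Taylor remainder in [h] of a smooth function is already locally uniform. The pointwise
    bounds, whose constants may vary wildly with [x], are used only to show that every Taylor
    coefficient below [h^n] vanishes. *)
Lemma smooth_pointwise_bO U W (E : U * R -> W) n : findim U -> findim W -> smooth E ->
  (forall x, exists C, \forall h \near (0 : R), `|E (x, h)| <= C * `|h| ^+ n) ->
  forall x0, bO n x0 E.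
Proof.
move=> fU fW sE EC.
(* The flow of this constant field translates the step, so the terms [iter k (Lie X) E (x, 0)] are
   the derivatives of [E] in [h] at [h = 0], and [approx_flow] becomes Taylor's formula. *)
pose X (_ : U * R) := (0 : U, 1 : R).
have sX : smooth X by exact: smooth_cst.
have ET x0 : bO n x0 (fun p => E p - tay n X E (p.1, 0) p.2).
  apply: (@approx_flow _ _ _ _ X x0 (fun x => (x, 0)) (fun p => p) (fun=> 0)) => //.
  - by apply: smooth_continuous; apply: smooth_pair => //;
      [exact: smooth_id|exact: smooth_cst].
  - exact: nearW.
  - apply: near_all => p; rewrite addr0.
    exact: is_derive_pair.
  - exact: bO0.
have T0 x h : tay n X E (x, 0) h = 0.
  rewrite /tay big1 // => k _.
  suff -> : iter k (Lie X) E (x, 0) = 0 by rewrite scaler0.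
  have [C hC] := EC x; have [C' /near_box[e e0 hC']] := ET x.
  pose b k := k`!%:R^-1 *: iter k (Lie X) E (x, 0) : W.
  suff /eqP : b k = 0.
    by rewrite scaler_eq0 invr_eq0 pnatr_eq0 gtn_eqF ?fact_gt0 //= => /eqP.
  apply: (@sum_expZ_bigO_eq0 _ n b (C + C')) => //.
  apply: filterS2 (near_norm_lt e0) hC => h' h'e hC.
  have -> : \sum_(k < n) h' ^+ k *: b k = tay n X E (x, 0) h'.
    by apply: eq_bigr => j _; rewrite scalerA.
  have -> : tay n X E (x, 0) h' = E (x, h') - (E (x, h') - tay n X E (x, 0) h').
    by rewrite opprB addrC subrK.
  rewrite (le_trans (ler_normB _ _)) // mulrDl lerD //.
  by apply: hC' => //; rewrite subrr normr0.
by move=> x0; have := ET x0; apply: bO_near; apply: near_all => p; rewrite T0 subr0.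
Qed.

End Taylor.

(** * Runge-Kutta methods *)

Section RungeKutta.
Context (R : realType) (s : nat) (a : 'M[R]_s) (b : 'I_s -> R).
Implicit Types P U V W : normedModType R.

Lemma stage_ind (Q : 'I_s -> Prop) :
  (forall i : 'I_s, (forall j : 'I_s, (j < i)%N -> Q j) -> Q i) -> forall i, Q i.
Proof.
move=> HQ i; have [n] := ubnP (nat_of_ord i); elim: n i => // n IHn i /ltnSE ni.
by apply: HQ => j ji; apply: IHn; exact: leq_trans ni.
Qed.

Lemma smooth_stage U V (G : 'I_s -> U -> V -> V) : findim U -> findim V ->
  (forall i, smooth (fun p : U * V => G i p.1 p.2)) ->
  forall i, smooth (fun x => stage a (fun i => G i x) i).
Proof.
move=> fU fV sG; apply: stage_ind => i IH.
under [X in smooth X]eq_fun do rewrite stageE.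
apply: (smooth_comp (V := (U * V)%type) (g := fun p => G i p.1 p.2)
  (f := fun x => (x, \sum_(j < s | (j < i)%N) a i j *: stage a (fun i => G i x) j))) => //.
apply: smooth_pair => //; first exact: smooth_id.
by apply: smooth_sum => j ji; apply: smoothZ; exact: IH.
Qed.

Definition rk_stage V (F : V -> R -> V) (x : V * R) (h : R) (i : 'I_s) : V :=
  stage a (fun i v => F (x.1 + h *: v) (x.2 + h * node a i)) i.

Lemma smooth_rk_stage V (F : V -> R -> V) i : findim V ->
  smooth (fun x : V * R => F x.1 x.2) ->
  smooth (fun p : (V * R) * R => rk_stage F p.1 p.2 i).
Proof.
move=> fV sF.
apply: (smooth_stage (U := ((V * R) * R)%type)
  (G := fun i p v => F (p.1.1 + p.2 *: v) (p.1.2 + p.2 * node a i))) => {}i.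
have s1 : smooth (fun q : ((V * R) * R) * V => q.1) by exact: smooth_fst.
have s11 : smooth (fun q : ((V * R) * R) * V => q.1.1).
  exact: smooth_fst_comp.
have s12 : smooth (fun q : ((V * R) * R) * V => q.1.2).
  exact: smooth_snd_comp.
apply: (smooth_comp (V := (V * R)%type) (g := fun x => F x.1 x.2)
  (f := fun q : ((V * R) * R) * V => (q.1.1.1 + q.1.2 *: q.2, q.1.1.2 + q.1.2 * node a i))) => //.
apply: smooth_pair; apply: smoothD.
- exact: smooth_fst_comp.
- by apply: smooth_scale => //; exact: smooth_snd.
- exact: smooth_snd_comp.
- by apply: smoothM => //; exact: smooth_cst.
Qed.

Lemma rk_stepE V (F : V -> R -> V) t h y :
  rk_step a b F t h y = y + h *: \sum_i b i *: rk_stage F (y, t) h i.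
Proof. by []. Qed.

Lemma smooth_rk_step V (F : V -> R -> V) : findim V ->
  smooth (fun x : V * R => F x.1 x.2) ->
  smooth (fun p : (V * R) * R => rk_step a b F p.1.2 p.2 p.1.1).
Proof.
move=> fV sF; apply: smoothD.
  by apply: smooth_fst_comp; exact: smooth_fst.
apply: smooth_scale; first exact: smooth_snd.
apply: smooth_sum => i _; apply: smoothZ.
have := @smooth_rk_stage V F i fV sF.
by congr smooth; apply/funext => -[[y t] h].
Qed.

Section Taylor.
Context (V : normedModType R) (fV : findim V) (F : V -> R -> V)
  (sF : smooth (fun x : V * R => F x.1 x.2)).

Definition ext_field (x : V * R) : V * R := (F x.1 x.2, 1).

Let Fu (x : V * R) := F x.1 x.2.

Lemma smooth_ext_field : smooth ext_field.
Proof. by apply: smooth_pair => //; exact: smooth_cst. Qed.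

Lemma Lie_fst : Lie ext_field (fst : V * R -> V) = Fu.
Proof.
apply/funext => x; have lf : linear (fst : V * R -> V) by [].
have cl : continuous (mklin lf) by apply: lin_continuous.
exact: (is_diff_derive (ext_field x) (is_diff_lin x cl)).
Qed.

(** A curve of degree [N] in the step, whence the [N.+1] terms; the time component is exact. *)
Definition tay_flow N (p : (V * R) * R) : V * R :=
  (tay N.+1 ext_field fst p.1 p.2, p.1.2 + p.2).

Lemma smooth_tay U W (X : U -> U) (g : U -> W) N : findim U -> smooth X -> smooth g ->
  smooth (fun p : U * R => tay N X g p.1 p.2).
Proof.
move=> fU sX sg; apply: smooth_sum => k _; apply: smooth_scale.
  apply: smoothM; last exact: smooth_cst.
  by apply: smooth_exp; exact: smooth_snd.
apply: (smooth_comp (V := U) (f := fst) (g := iter k (Lie X) g)) => //.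
  exact: smooth_fst.
exact: smooth_iter_Lie.
Qed.

Lemma smooth_tay_flow N : smooth (tay_flow N).
Proof.
have sx := smooth_ext_field.
apply: smooth_pair.
  by apply: smooth_tay => //; exact: smooth_fst.
apply: smoothD; last exact: smooth_snd.
by apply: smooth_snd_comp; exact: smooth_fst.
Qed.

Lemma tay_flow0 N x : tay_flow N (x, 0) = x.
Proof. by rewrite /tay_flow /= tay0 addr0; case: x. Qed.

Lemma cvg_tay_flow N (x0 : V * R) : tay_flow N p @[p --> (x0, 0 : R)] --> x0.
Proof.
by have := smooth_continuous (@smooth_tay_flow N) (x := (x0, 0)); rewrite /continuous_at tay_flow0.
Qed.

(** The first term is the derivative in the step of the polynomial in [tay_flow], so this is the
    residual left when that polynomial is inserted in the equation. *)
Definition tay_defect N (p : (V * R) * R) : V := tay N ext_field Fu p.1 p.2 - Fu (tay_flow N p).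

Lemma is_derive_tay_flow N x (h : R) :
  is_derive h 1 (fun h => tay_flow N (x, h))
    (ext_field (tay_flow N (x, h)) + (tay_defect N (x, h), 0)).
Proof.
have -> : ext_field (tay_flow N (x, h)) + (tay_defect N (x, h), 0) =
    (tay N ext_field Fu x h, 0 + 1).
  by congr (_, _) => /=; [rewrite addrC subrK|rewrite addr0 add0r].
rewrite /tay_flow -/Fu -Lie_fst; apply: is_derive_pair; first exact: is_derive_tay.
exact: (@is_deriveD _ _ _ (cst x.2) id h 1 0 1).
Qed.

Lemma tay_flow_approx_lt N n (x0 : V * R) W (g : V * R -> W) : findim W -> smooth g ->
  bO n.-1 x0 (tay_defect N) ->
  bO n x0 (fun p => g (tay_flow N p) - tay n ext_field g p.1 p.2).
Proof.
move=> fW sg dO; have sx := smooth_ext_field.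
apply: (@approx_flow _ _ _ _ ext_field x0 id (tay_flow N) (fun p => (tay_defect N p, 0))) => //.
- exact: cvg_tay_flow.
- by apply: near_all_pt => x; exact: tay_flow0.
- by apply: near_all => -[x h]; exact: is_derive_tay_flow.
- have l1 : linear (fun v : V => (v, 0 : R)).
    by move=> k v w; congr (_, _); rewrite /= scaler0 addr0.
  have cl : continuous (mklin l1) by apply: lin_continuous.
  exact: (bO_lin cl dO).
Qed.

(** A bootstrap: a defect of order [n] makes the curve accurate to order [n.+1], and evaluating [F]
    along it then shows the defect itself to be of order [n.+1]. It stops at [N], the number of
    terms in the derivative of the polynomial. *)
Lemma tay_defect_bO N (x0 : V * R) : bO N x0 (tay_defect N).
Proof.
suff : forall n, (n <= N)%N -> bO n x0 (tay_defect N) by apply.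
have sx := smooth_ext_field.
elim=> [_|n IHn nN].
  apply: (@bO_cvg _ _ _ _ _ (tay_defect N (x0, 0))).
  apply: smooth_continuous; apply: smoothB; first exact: smooth_tay.
  by apply: (smooth_comp (g := Fu) _ (@smooth_tay_flow N)).
have H1 := tay_flow_approx_lt (n := n.+1) fV sF (IHn (ltnW nN)).
have H2 := @tayB_bO _ _ _ _ x0 ext_field Fu id N n.+1 (findim_prod fV (findim_R R)) sx sF (@cvg_id _ _) nN.
move: (bOB H2 H1); apply: bO_near; apply: near_all => p.
by rewrite opprB addrA subrK.
Qed.

Lemma tay_flow_approx N (x0 : V * R) W (g : V * R -> W) : findim W -> smooth g ->
  bO N.+1 x0 (fun p => g (tay_flow N p) - tay N.+1 ext_field g p.1 p.2).
Proof. by move=> fW sg; apply: tay_flow_approx_lt => //; exact: tay_defect_bO. Qed.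

End Taylor.

End RungeKutta.

(** * Locally uniform expansion of a Runge-Kutta step *)

Section RungeKuttaOrder.
Context (R : realType) (s : nat) (a : 'M[R]_s) (b : 'I_s -> R) (r : nat)
  (rk_r : rk_order a b r) (d : nat) (F : 'rV[R]_d -> R -> 'rV[R]_d)
  (sF : smooth (fun x : 'rV[R]_d * R => F x.1 x.2)).

Let V := 'rV[R]_d.
Let fV : findim V := findim_mx R 1 d.
Let fVR : findim (V * R)%type := findim_prod fV (findim_R R).
Let sX := smooth_ext_field fV sF.
Let Fu (x : V * R) := F x.1 x.2.
Let Y (x : V * R) (h : R) : V := tay r.+1 (ext_field F) fst x h.

(* The Taylor polynomial [Y x] is an exact solution of the field perturbed by
   its own defect, to which the order hypothesis applies. *)
Let Fhat (x : V * R) (v : V) (t : R) : V := F v t + tay_defect F r (x, t - x.2).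

Let sDef : smooth (tay_defect F r).
Proof.
apply: smoothB; first exact: smooth_tay.
by apply: (smooth_comp (g := Fu) _ (smooth_tay_flow fV sF r)).
Qed.

Let sFhat x : smooth (fun y : V * R => Fhat x y.1 y.2).
Proof.
apply: smoothD; first exact: sF.
apply: (smooth_comp (f := fun y : V * R => (x, y.2 - x.2)) (g := tay_defect F r)) => //.
apply: smooth_pair => //; first exact: smooth_cst.
by apply: smoothB; [exact: smooth_snd|exact: smooth_cst].
Qed.

Let Fhat_solves x : solves (Fhat x) x.2 x.1 (fun t => Y x (t - x.2)).
Proof.
split; first by rewrite /Y subrr tay0.
apply: near_all_pt => t.
have HY := @is_derive_tay R _ V r (ext_field F) fst x (t - x.2).
have -> : Fhat x (Y x (t - x.2)) t = tay r (ext_field F) (Lie (ext_field F) fst) x (t - x.2).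
  rewrite /Fhat /tay_defect /= Lie_fst //.
  have -> : x.2 + (t - x.2) = t by rewrite addrC subrK.
  by rewrite addrC subrK.
have /derivable1_diffP/differentiableP dY := @ex_derive _ _ _ _ _ _ _ HY.
have ds : is_diff t (fun t : R => t - x.2) id.
  have [H1 H2] := is_diffB (is_diff_id t) (is_diff_cst x.2 t).
  apply: DiffDef; first exact: H1.
  etransitivity; first exact: H2.
  by apply/funext => v; rewrite -[LHS]/(v - 0) subr0.
have dc := is_diff_comp ds dY.
apply: DeriveDef; first by apply/derivable1_diffP; case: dc.
by rewrite (is_diff_derive _ dc) /= -(is_diff_derive _ dY); case: HY.
Qed.

Let stage_arg (G : V -> R -> V) (x : V * R) (i : 'I_s) (p : (V * R) * R) : V * R :=
  (x.1 + p.2 *: \sum_(j < s | (j < i)%N) a i j *: rk_stage a G x p.2 j, x.2 + p.2 * node a i).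

Let cvg_stage_arg (G : V -> R -> V) (x : V * R) i : smooth (fun y : V * R => G y.1 y.2) ->
  stage_arg G x i p @[p --> (x, 0 : R)] --> x.
Proof.
move=> sG.
have := @smooth_continuous R ((V * R) * R)%type (V * R)%type (stage_arg G x i) _ (x, 0).
rewrite /continuous_at /stage_arg /= scale0r mul0r !addr0 -surjective_pairing; apply.
apply: smooth_pair => //.
  apply: smoothD; first exact: smooth_cst.
  apply: smooth_scale; first exact: smooth_snd.
  apply: smooth_sum => j _; apply: smoothZ.
  have := @smooth_rk_stage _ _ a V G j fV sG.
  apply: (smooth_comp (f := fun p : (V * R) * R => (x, p.2))).
  by apply: smooth_pair => //; [exact: smooth_cst|exact: smooth_snd].
apply: smoothD; first exact: smooth_cst.
by apply: smoothM; [exact: smooth_snd|exact: smooth_cst].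
Qed.

Let bO_pair0 n (x0 : V * R) (E : (V * R) * R -> V) : bO n x0 E ->
  bO n x0 (fun p => (E p, 0 : R)).
Proof.
have l1 : linear (fun v : V => (v, 0 : R)).
  by move=> k v w; congr (_, _); rewrite /= scaler0 addr0.
have cl : continuous (mklin l1) by apply: lin_continuous.
exact: (bO_lin cl).
Qed.

Let bOZ n (x0 : V * R) (k : R) (E : (V * R) * R -> V) : bO n x0 E ->
  bO n x0 (fun p => k *: E p).
Proof.
move=> EO; rewrite -[n]add0n; apply: bO_scale EO.
by apply: (@bO_cvg _ _ R); exact: cvg_cst.
Qed.

(** The perturbation at the node is of order [h^r], and the stages before [i] enter through a
    locally Lipschitz function. The factor [h] in front of the sum of stages later supplies the
    missing power. *)
Let stage_bO x i : bO r x (fun p => rk_stage a F x p.2 i - rk_stage a (Fhat x) x p.2 i).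
Proof.
move: i; apply: stage_ind => i IH.
have -> : (fun p : (V * R) * R => rk_stage a F x p.2 i - rk_stage a (Fhat x) x p.2 i) =
    fun p => Fu (stage_arg F x i p) - Fu (stage_arg (Fhat x) x i p)
      - tay_defect F r (x, p.2 * node a i).
  apply/funext => p; rewrite {1 2}/rk_stage !stageE {2}/Fhat opprD addrA.
  by congr (_ - tay_defect _ _ (_, _)); rewrite /= [x.2 + _]addrC addrK.
apply: bOB.
  apply: (@bO_lip _ _ _ _ _ _ _ x) => //.
  - exact: cvg_stage_arg.
  - by apply: cvg_stage_arg; exact: sFhat.
  - suff : bO r x (fun p => p.2 *: \sum_(j < s | (j < i)%N)
        a i j *: (rk_stage a F x p.2 j - rk_stage a (Fhat x) x p.2 j)).
      move/bO_pair0; apply: bO_near; apply: near_all => p.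
      congr (_, _); rewrite /= ?subrr //.
      rewrite opprD addrACA subrr add0r -scalerBr -sumrB; congr (_ *: _).
      by apply: eq_bigr => j _; rewrite scalerBr.
    rewrite -[r]add0n; apply: bO_scale.
      by apply: bO_leq (bO_pow 1 x).
    by apply: bO_sum => j ji; apply: bOZ; exact: IH.
have := tay_defect_bO fV sF r x.
apply: (@bO_subst _ _ _ _ _ _ _ _ (fun p => (x, p.2 * node a i)) `|node a i|).
  have := @smooth_continuous R ((V * R) * R)%type ((V * R) * R)%type
    (fun p : (V * R) * R => (x, p.2 * node a i)) _ (x, 0).
  rewrite /continuous_at /= mul0r; apply.
  apply: smooth_pair => //; first exact: smooth_cst.
  by apply: smoothM; [exact: smooth_snd|exact: smooth_cst].
by apply: near_all => p; rewrite /= normrM mulrC.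
Qed.

(** The perturbed field [Fhat x] depends on the base point, so the order hypothesis is applied to a
    different equation for each [x] and its constant is not controlled in [x]. *)
Let rk_pointwise (x : V * R) : exists C, \forall h \near (0 : R),
  `|rk_step a b F x.2 h x.1 - Y x h| <= C * `|h| ^+ r.+1.
Proof.
have := rk_r (sFhat x) (Fhat_solves x).
move=> /eqO_exP[C _ HC].
have : bO r.+1 x (fun p => rk_step a b F x.2 p.2 x.1 - rk_step a b (Fhat x) x.2 p.2 x.1).
  suff : bO r.+1 x (fun p => p.2 *: \sum_i b i *:
      (rk_stage a F x p.2 i - rk_stage a (Fhat x) x p.2 i)).
    apply: bO_near; apply: near_all => p.
    rewrite !rk_stepE opprD addrACA subrr add0r -scalerBr -sumrB; congr (_ *: _).
    by rewrite -surjective_pairing; apply: eq_bigr => i _; rewrite scalerBr.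
  apply: (@bO_scale _ _ _ 1 r); first exact: (bO_pow 1 x).
  by apply: bO_sum => i _; apply: bOZ; exact: stage_bO.
case=> C' /near_box[e e0 he].
exists (C' + C); apply: filterS2 (near_norm_lt e0) HC => h h0 HC.
have := he x h; rewrite subrr normr0 => /(_ e0 h0) /= HC'.
move: HC; rewrite normrX [x.2 + h]addrC addrK => HC.
rewrite mulrDl; apply: le_trans (lerD HC' HC); apply: le_trans (ler_normD _ _).
by rewrite addrA subrK.
Qed.

Lemma rk_approx (x0 : V * R) (W : normedModType R) (g : V * R -> W) : findim W -> smooth g ->
  bO r.+1 x0 (fun p => g (rk_step a b F p.1.2 p.2 p.1.1, p.1.2 + p.2)
    - tay r.+1 (ext_field F) g p.1 p.2).
Proof.
move=> fW sg.
(* Both the step and its Taylor polynomial are smooth in base point and step, so the pointwise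
   constants can be replaced by a locally uniform one. *)
have E1 : bO r.+1 x0 (fun p => rk_step a b F p.1.2 p.2 p.1.1 - Y p.1 p.2).
  apply: (smooth_pointwise_bO _ _ _ rk_pointwise).
  apply: smoothB; first exact: smooth_rk_step.
  by apply: smooth_tay => //; exact: smooth_fst.
have E3 : bO r.+1 x0 (fun p => (rk_step a b F p.1.2 p.2 p.1.1, p.1.2 + p.2) - tay_flow F r p).
  move: (bO_pair0 E1); apply: bO_near; apply: near_all => p.
  by congr (_, _); rewrite /= subrr.
have cv : (rk_step a b F p.1.2 p.2 p.1.1, p.1.2 + p.2) @[p --> (x0, 0 : R)] --> x0.
  have := @smooth_continuous R ((V * R) * R)%type (V * R)%type
    (fun p => (rk_step a b F p.1.2 p.2 p.1.1, p.1.2 + p.2)) _ (x0, 0).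
  rewrite /continuous_at /= rk_stepE scale0r !addr0 -surjective_pairing; apply.
  apply: smooth_pair => //; first exact: smooth_rk_step.
  apply: smoothD; last exact: smooth_snd.
  by apply: smooth_snd_comp; exact: smooth_fst.
have E4 := bO_lip fVR fW sg cv (cvg_tay_flow fV sF r (x0 := x0)) E3.
move: (bOD E4 (tay_flow_approx fV sF r x0 fW sg)); apply: bO_near.
by apply: near_all => p; rewrite addrA subrK.
Qed.

End RungeKuttaOrder.

(** * Truncated power series with noncommutative coefficients *)

Section TruncatedSeries.
Context (R : realFieldType) (B : algType R).
Implicit Types P Q S T E : {poly B}.

Definition eqm n P Q := forall k, (k < n)%N -> P`_k = Q`_k.

Lemma eqm_refl n P : eqm n P P. Proof. by []. Qed.

Lemma eqm_trans n P Q S : eqm n P Q -> eqm n Q S -> eqm n P S.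
Proof. by move=> PQ QS k kn; rewrite PQ // QS. Qed.

Lemma eqmM n P P' Q Q' : eqm n P P' -> eqm n Q Q' -> eqm n (P * Q) (P' * Q').
Proof.
move=> PP QQ k kn; rewrite !coefM; apply: eq_bigr => j _; congr (_ * _).
  by apply: PP; exact: leq_ltn_trans (leq_ord j) kn.
by apply: QQ; exact: leq_ltn_trans (leq_subr _ _) kn.
Qed.

(* The substitution [h := c h]. *)
Definition scalep (c : R) P := \poly_(i < size P) (c ^+ i *: P`_i).

Lemma coef_scalep c P i : (scalep c P)`_i = c ^+ i *: P`_i.
Proof.
by rewrite coef_poly; case: ltnP => // /(nth_default 0) ->; rewrite scaler0.
Qed.

Lemma scalepM c P Q : scalep c (P * Q) = scalep c P * scalep c Q.
Proof.
apply/polyP => k; rewrite coef_scalep !coefM scaler_sumr; apply: eq_bigr => i _.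
rewrite !coef_scalep -scalerAl -scalerAr scalerA -exprD subnKC //.
exact: leq_ord.
Qed.

Lemma scalep_comp c d P : scalep c (scalep d P) = scalep (c * d) P.
Proof. by apply/polyP => k; rewrite !coef_scalep scalerA exprMn. Qed.

Lemma scalep1 P : scalep 1 P = P.
Proof. by apply/polyP => k; rewrite coef_scalep expr1n scale1r. Qed.

Lemma eqm_scalep n c P Q : eqm n P Q -> eqm n (scalep c P) (scalep c Q).
Proof. by move=> PQ k kn; rewrite !coef_scalep PQ. Qed.

Lemma scalep_one c : scalep c 1 = 1 :> {poly B}.
Proof.
apply/polyP => -[|k]; rewrite coef_scalep coef1 ?scale1r //= scaler0 //.
Qed.

(** In a product of series with constant term 1, the first discrepancies add up: every other product
    involving them has higher degree. This additivity is what turns the order condition into a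
    scalar equation in the weights. *)
Lemma coefM_perturb k P P' Q Q' : (0 < k)%N -> P`_0 = 1 -> Q`_0 = 1 ->
  eqm k P P' -> eqm k Q Q' ->
  (P * Q)`_k = (P' * Q')`_k + (P`_k - P'`_k) + (Q`_k - Q'`_k).
Proof.
move=> k0 P0 Q0 PP QQ.
have -> : P * Q = P' * Q' + (P - P') * Q + P' * (Q - Q').
  by rewrite mulrBl mulrBr -addrA subrKA addrC subrK.
rewrite !coefD; congr (_ + _ + _).
  rewrite coefM big_ord_recr /= subnn Q0 mulr1 big1 ?add0r ?coefB // => i _.
  by rewrite coefB PP ?subrr ?mul0r.
rewrite coefM big_ord_recl /= subn0 -PP // P0 mul1r big1 ?addr0 ?coefB // => i _.
by rewrite coefB QQ ?subrr ?mulr0 // /bump /= add1n ltn_subrL k0.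
Qed.

(** Self-adjointness of a one-step method, read on its expansion: the steps [-h] and [h] cancel. *)
Definition symmetric_series n P := eqm n (scalep (-1) P * P) 1.

(* Comparing the coefficients of [h^k] in [P(-h) P(h) = 1] determines [P`_k]
   from the previous coefficients when [k] is even. *)
Lemma symmetric_series_even n k P E : (k < n)%N -> (0 < k)%N -> ~~ odd k ->
  P`_0 = 1 -> eqm k P E -> symmetric_series n P -> symmetric_series n E -> eqm k.+1 P E.
Proof.
move=> kn k0 ek P0 PE sP sE j; rewrite ltnS leq_eqVlt => /predU1P[->|]; last exact: PE.
have H := coefM_perturb k0 (P := scalep (-1) P) (P' := scalep (-1) E) _ P0 (eqm_scalep (-1) PE) PE.
have := H _; rewrite (sP k) // (sE k) // coef_scalep expr0 scale1r => /(_ P0).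
rewrite !coef_scalep -signr_odd (negbTE ek) expr0 !scale1r -addrA => /eqP.
rewrite eq_sym -subr_eq0 addrAC subrr add0r -mulr2n -scaler_nat scaler_eq0 pnatr_eq0 /=.
by rewrite subr_eq0 => /eqP.
Qed.

Definition expp N (X : B) := \poly_(k < N.+1) (k`!%:R^-1 *: X ^+ k).

Lemma coef_expp N X k : (k <= N)%N -> (expp N X)`_k = k`!%:R^-1 *: X ^+ k.
Proof. by move=> kN; rewrite coef_poly ltnS kN. Qed.

Lemma exppD N X c d :
  eqm N.+1 (scalep c (expp N X) * scalep d (expp N X)) (scalep (c + d) (expp N X)).
Proof.
move=> k; rewrite ltnS => kN; rewrite coefM coef_scalep coef_expp //.
rewrite [c + d]addrC exprDn !scaler_suml; apply: eq_bigr => i _.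
have ik : (i <= k)%N by exact: leq_ord.
rewrite !coef_scalep !coef_expp ?(leq_trans _ kN) ?leq_subr //.
rewrite !scalerA -scalerAl -scalerAr scalerA -exprD subnKC //; congr (_ *: _).
rewrite -mulr_natr -(bin_fact ik) !natrM.
have fi : i`!%:R != 0 :> R by rewrite pnatr_eq0 -lt0n fact_gt0.
have fk : (k - i)`!%:R != 0 :> R by rewrite pnatr_eq0 -lt0n fact_gt0.
have fb : 'C(k, i)%:R != 0 :> R by rewrite pnatr_eq0 -lt0n bin_gt0.
by field; rewrite fi fk fb.
Qed.

Lemma expp_symmetric N X : symmetric_series N.+1 (expp N X).
Proof.
move=> k kN; have := exppD X (-1) 1 kN; rewrite scalep1 => ->.
rewrite addNr coef_scalep coef1 expr0n; case: k kN => [|k] kN; rewrite ?scale0r //.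
by rewrite coef_expp // scale1r expr0 invr1 scale1r.
Qed.

(** In degree 2 the left side contributes [Y * X] where the square of the sum contributes half of
    [Y * X + X * Y]. *)
Lemma expp_comm X Y : eqm 3 (expp 2 Y * expp 2 X) (expp 2 (Y + X)) -> Y * X = X * Y.
Proof.
move=> /(_ 2%N isT); rewrite coefM !big_ord_recr big_ord0 /= !coef_expp //.
rewrite !expr0 !expr1 invr1 !scale1r mul1r mulr1 add0r => /(congr1 ( *:%R 2)).
rewrite !scalerDr !scalerA mulfV ?pnatr_eq0 // !scale1r !expr2 mulrDl !mulrDr.
rewrite scaler_nat mulr2n => H.
apply: (addrI (Y * Y + Y * X)); apply: (addIr (X * X)).
by rewrite -[RHS]addrA -H addrC -[Y * Y + _ + _]addrA [Y * Y + _]addrC addrA.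
Qed.

(** Yoshida's composition on series; the middle weight is the length of the substep from [t + g h]
    to [t + (1 - g) h]. *)
Fixpoint triple_jump (g : nat -> R) P n : {poly B} :=
  if n is n'.+1 then
    let T := triple_jump g P n' in
    scalep (g n') T * scalep (1 - 2 * g n') T * scalep (g n') T
  else P.

(** Each jump gains two degrees: the equation for [g] removes the odd discrepancy of degree 2n+3,
    and symmetry then forces the even coefficient of degree 2n+4. *)
Lemma triple_jump_order (g : nat -> R) N (X : B) P n :
  (forall n, 2 * g n ^+ (n.*2.+3) + (1 - 2 * g n) ^+ n.*2.+3 = 0) ->
  symmetric_series N.+1 P -> eqm 2 P (expp N X) -> (n.*2.+2 <= N)%N ->
  symmetric_series N.+1 (triple_jump g P n) /\ eqm n.*2.+3 (triple_jump g P n) (expp N X).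
Proof.
move=> gE sP PE; have E0 : (expp N X)`_0 = 1.
  by rewrite coef_expp // expr0 invr1 scale1r.
elim: n => [|n IHn] nN.
  (* Agreement to first order and symmetry already give second order. *)
  split => //=; apply: (symmetric_series_even (n := N.+1)) => //; first by rewrite PE // E0.
  exact: expp_symmetric.
have [|sT TE] := IHn; first by rewrite (leq_trans _ nN) // doubleS !ltnS leqW.
rewrite [triple_jump _ _ _]/=; set T := triple_jump g P n in sT TE *.
set c := g n; set d := 1 - 2 * c.
have T0 : T`_0 = 1 by rewrite TE // E0.
have s0 e : (scalep e T)`_0 = 1 by rewrite coef_scalep expr0 scale1r.
have symT e : eqm N.+1 (scalep (- e) T * scalep e T) 1.
  rewrite -mulN1r mulrC -scalep_comp -scalepM -(scalep_one e).
  exact: eqm_scalep.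
(* A palindromic product of symmetric series is symmetric: the factors cancel from the middle
   outwards. *)
have sTT : symmetric_series N.+1 (scalep c T * scalep d T * scalep c T).
  rewrite /symmetric_series !scalepM !scalep_comp !mulN1r.
  set a' := scalep (- c) T; set b' := scalep (- d) T.
  have -> : a' * b' * a' * (scalep c T * scalep d T * scalep c T) =
      a' * (b' * (a' * scalep c T) * scalep d T) * scalep c T by rewrite !mulrA.
  apply: eqm_trans (symT c); rewrite -[X in eqm _ _ (X * _)]mulr1.
  apply: eqmM => //; apply: eqmM => //; apply: eqm_trans (symT d).
  rewrite -[X in eqm _ _ (X * _)]mulr1.
  by apply: eqmM => //; apply: eqmM => //; exact: symT.
split => //.
(* The three weights sum to 1, so the exponentials compose without error and can serve as reference
   for the product. *)
have EE : eqm N.+1 (scalep c (expp N X) * scalep d (expp N X) * scalep c (expp N X)) (expp N X).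
  apply: eqm_trans (eqmM (exppD _ _ _) (eqm_refl _)) _.
  apply: eqm_trans (exppD _ _ _) _.
  by rewrite /d (_ : c + _ + c = 1) ?scalep1 //; ring.
have k3 : (n.*2.+3 < N.+1)%N by rewrite ltnS (leq_trans _ nN) // doubleS.
rewrite doubleS; refine (@symmetric_series_even N.+1 n.*2.+4 _ (expp N X) _ _ _ _ _ sTT
  (expp_symmetric (N:=N) X)) => //.
- by rewrite /= odd_double.
- by rewrite !coefM !big_ord1 /= !coefM !big_ord1 /= !s0 !mulr1.
(* In degree 2n+3 the three discrepancies add up to that of [T] times 2 c^(2n+3) + d^(2n+3), which
   is zero. *)
move=> k; rewrite ltnS leq_eqVlt => /predU1P[->|kn]; last first.
  rewrite -(EE k); last by rewrite (ltn_trans kn).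
  exact: (eqmM (eqmM (eqm_scalep c TE) (eqm_scalep d TE)) (eqm_scalep c TE)).
rewrite -(EE n.*2.+3) //.
rewrite (coefM_perturb (P' := scalep c (expp N X) * scalep d (expp N X)) (Q' := scalep c (expp N X))) //.
- rewrite (coefM_perturb (P := scalep c T) (Q := scalep d T)
      (P' := scalep c (expp N X)) (Q' := scalep d (expp N X))) //;
    try exact: (eqm_scalep _ TE).
  have cancel (u v w : B) : u + v + w - u = v + w by rewrite addrAC [u + v]addrC addrK.
  rewrite cancel.
  rewrite !coef_scalep -!scalerBr -[RHS]addr0 -addrA; congr (_ + _).
  rewrite -!scalerDl -[RHS](scale0r (T`_n.*2.+3 - (expp N X)`_n.*2.+3)); congr (_ *: _).
  by rewrite -[RHS](gE n) -/c -/d; ring.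
- by rewrite !coefM !big_ord1 /= !s0 !mulr1.
- exact: (eqmM (eqm_scalep c TE) (eqm_scalep d TE)).
- exact: (eqm_scalep c TE).
Qed.

End TruncatedSeries.

(** * The algebra of endomorphisms of smooth functions *)

Record smoothfun (R : realType) (U : normedModType R) := SFun {
  smf_val :> U -> R;
  smfP : smooth smf_val }.

Section SmoothFunctions.
Context (R : realType) (U : normedModType R).
Implicit Types f g : smoothfun U.

Lemma smf_eq f g : f =1 g -> f = g.
Proof.
case: f g => [f sf] [g sg] /= /funext fg; rewrite fg in sf *.
by congr SFun; exact: Prop_irrelevance.
Qed.

HB.instance Definition _ := gen_eqMixin (smoothfun U).
HB.instance Definition _ := gen_choiceMixin (smoothfun U).

Definition smf_zero : smoothfun U := SFun (smooth_cst U (0 : R)).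
Definition smf_opp f : smoothfun U := SFun (smoothN (smfP f)).
Definition smf_add f g : smoothfun U := SFun (smoothD (smfP f) (smfP g)).
Definition smf_scale (k : R) f : smoothfun U := SFun (smoothZ k (smfP f)).

Lemma smf_addA : associative smf_add.
Proof. by move=> f g h; apply: smf_eq => x /=; rewrite addrA. Qed.
Lemma smf_addC : commutative smf_add.
Proof. by move=> f g; apply: smf_eq => x /=; rewrite addrC. Qed.
Lemma smf_add0 : left_id smf_zero smf_add.
Proof. by move=> f; apply: smf_eq => x /=; rewrite add0r. Qed.
Lemma smf_addN : left_inverse smf_zero smf_opp smf_add.
Proof. by move=> f; apply: smf_eq => x /=; rewrite addNr. Qed.

HB.instance Definition _ :=
  GRing.isZmodule.Build (smoothfun U) smf_addA smf_addC smf_add0 smf_addN.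

Lemma smf_scaleA k l f : smf_scale k (smf_scale l f) = smf_scale (k * l) f.
Proof. by apply: smf_eq => x /=; rewrite scalerA. Qed.
Lemma smf_scale1 : left_id 1 smf_scale.
Proof. by move=> f; apply: smf_eq => x /=; rewrite scale1r. Qed.
Lemma smf_scaleDr : right_distributive smf_scale +%R.
Proof. by move=> k f g; apply: smf_eq => x /=; rewrite scalerDr. Qed.
Lemma smf_scaleDl f : {morph smf_scale^~ f : k l / k + l}.
Proof. by move=> k l; apply: smf_eq => x /=; rewrite scalerDl. Qed.

HB.instance Definition _ := GRing.Zmodule_isLmodule.Build R (smoothfun U)
  smf_scaleA smf_scale1 smf_scaleDr smf_scaleDl.

Lemma smfZ k f x : (k *: f) x = k * f x. Proof. by []. Qed.
Lemma smf_sumE n (F : 'I_n -> smoothfun U) x : (\sum_i F i) x = \sum_i F i x.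
Proof. by elim/big_ind2 : _ => // f y g z <- <-. Qed.

End SmoothFunctions.

(** Bundled so that composition becomes the product of an [R]-algebra, which is then the coefficient
    algebra of the series above. *)
Record endo (R : realType) (U : normedModType R) := Endo {
  endo_val :> smoothfun U -> smoothfun U;
  endoP : linear endo_val }.

Section Endomorphisms.
Context (R : realType) (U : normedModType R).
Implicit Types S T : endo U.

Lemma endo_eq S T : S =1 T -> S = T.
Proof.
case: S T => [f sf] [g sg] /= /funext fg; rewrite fg in sf *.
by congr Endo; exact: Prop_irrelevance.
Qed.

HB.instance Definition _ := gen_eqMixin (endo U).
HB.instance Definition _ := gen_choiceMixin (endo U).

Lemma endo_linD T f g : T (f + g) = T f + T g.
Proof. by have := endoP T 1 f g; rewrite !scale1r. Qed.
Lemma endo_lin0 T : T 0 = 0.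
Proof. by apply: (addIr (T 0)); rewrite -endo_linD !add0r. Qed.
Lemma endo_linZ T k f : T (k *: f) = k *: T f.
Proof. by rewrite -[k *: f]addr0 endoP endo_lin0 addr0. Qed.
Lemma endo_lin_sum T n (F : 'I_n -> smoothfun U) : T (\sum_i F i) = \sum_i T (F i).
Proof. by elim/big_ind2 : _ => [|f y g z <- <-|//]; [exact: endo_lin0|exact: endo_linD]. Qed.

Lemma endo_zero_lin : linear (fun _ : smoothfun U => 0 : smoothfun U).
Proof. by move=> k f g; rewrite scaler0 addr0. Qed.
Lemma endo_opp_lin T : linear (fun f => - T f).
Proof. by move=> k f g; rewrite endoP opprD scalerN. Qed.
Lemma endo_add_lin S T : linear (fun f => S f + T f).
Proof. by move=> k f g; rewrite !endoP scalerDr addrACA. Qed.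
Lemma endo_scale_lin l T : linear (fun f => l *: T f).
Proof. by move=> k f g; rewrite endoP scalerDr !scalerA mulrC. Qed.
Lemma endo_one_lin : linear (fun f : smoothfun U => f).
Proof. by []. Qed.
Lemma endo_mul_lin S T : linear (fun f => S (T f)).
Proof. by move=> k f g; rewrite !endoP. Qed.

Definition endo_zero := Endo endo_zero_lin.
Definition endo_opp T := Endo (endo_opp_lin T).
Definition endo_add S T := Endo (endo_add_lin S T).
Definition endo_scale k T := Endo (endo_scale_lin k T).
Definition endo_one := Endo endo_one_lin.
Definition endo_mul S T := Endo (endo_mul_lin S T).

Lemma endo_addA : associative endo_add.
Proof. by move=> f g h; apply: endo_eq => x /=; rewrite addrA. Qed.
Lemma endo_addC : commutative endo_add.
Proof. by move=> f g; apply: endo_eq => x /=; rewrite addrC. Qed.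
Lemma endo_add0 : left_id endo_zero endo_add.
Proof. by move=> f; apply: endo_eq => x /=; rewrite add0r. Qed.
Lemma endo_addN : left_inverse endo_zero endo_opp endo_add.
Proof. by move=> f; apply: endo_eq => x /=; rewrite addNr. Qed.

HB.instance Definition _ :=
  GRing.isZmodule.Build (endo U) endo_addA endo_addC endo_add0 endo_addN.

Lemma endo_mulA : associative endo_mul.
Proof. by move=> f g h; exact: endo_eq. Qed.
Lemma endo_mul1 : left_id endo_one endo_mul.
Proof. by move=> f; exact: endo_eq. Qed.
Lemma endo_mulr1 : right_id endo_one endo_mul.
Proof. by move=> f; exact: endo_eq. Qed.
Lemma endo_mulDl : left_distributive endo_mul +%R.
Proof. by move=> f g h; exact: endo_eq. Qed.
Lemma endo_mulDr : right_distributive endo_mul +%R.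
Proof. by move=> f g h; apply: endo_eq => x /=; rewrite endo_linD. Qed.
Lemma endo_one_neq0 : endo_one != 0.
Proof.
apply/eqP => /(congr1 (fun T : endo U => T (SFun (smooth_cst U (1 : R))) 0)) /= /eqP.
by rewrite oner_eq0.
Qed.

HB.instance Definition _ := GRing.Zmodule_isNzRing.Build (endo U)
  endo_mulA endo_mul1 endo_mulr1 endo_mulDl endo_mulDr endo_one_neq0.

Lemma endo_scaleA k l T : endo_scale k (endo_scale l T) = endo_scale (k * l) T.
Proof. by apply: endo_eq => x /=; rewrite scalerA. Qed.
Lemma endo_scale1 : left_id 1 endo_scale.
Proof. by move=> f; apply: endo_eq => x /=; rewrite scale1r. Qed.
Lemma endo_scaleDr : right_distributive endo_scale +%R.
Proof. by move=> k f g; apply: endo_eq => x /=; rewrite scalerDr. Qed.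
Lemma endo_scaleDl T : {morph endo_scale^~ T : k l / k + l}.
Proof. by move=> k l; apply: endo_eq => x /=; rewrite scalerDl. Qed.

HB.instance Definition _ := GRing.Zmodule_isLmodule.Build R (endo U)
  endo_scaleA endo_scale1 endo_scaleDr endo_scaleDl.

Lemma endo_scaleAl (k : R) S T : k *: (S * T) = (k *: S) * T.
Proof. exact: endo_eq. Qed.
HB.instance Definition _ := GRing.Lmodule_isLalgebra.Build R (endo U) endo_scaleAl.
Lemma endo_scaleAr (k : R) S T : k *: (S * T) = S * (k *: T).
Proof. by apply: endo_eq => f /=; rewrite endo_linZ. Qed.
HB.instance Definition _ := GRing.Lalgebra_isAlgebra.Build R (endo U) endo_scaleAr.

Lemma endoME S T f : (S * T) f = S (T f). Proof. by []. Qed.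
Lemma endoZE k T f : (k *: T) f = k *: T f. Proof. by []. Qed.
Lemma endo_sumE n (F : 'I_n -> endo U) f : (\sum_i F i) f = \sum_i F i f.
Proof. by elim/big_ind2 : _ => // S y T z <- <-. Qed.

End Endomorphisms.

(** * Expansion of one-step maps through pullback of functions *)

Section Representation.
Context (R : realType) (U : normedModType R) (fU : findim U).
Implicit Types (P Q : {poly endo U}) (X Y : U -> U).

Lemma Lie_endo_lin X (sX : smooth X) :
  linear (fun g : smoothfun U => SFun (smooth_Lie fU sX (smfP g))).
Proof.
move=> k f g; apply: smf_eq => x /=; rewrite /Lie.
have df := smooth_differentiable x (smfP f).
have dg := smooth_differentiable x (smfP g).
rewrite -[LHS]/('D_(X x) ((k *: (f : U -> R)) + (g : U -> R)) x).
rewrite deriveD ?deriveZ //; try exact: diff_derivable.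
by apply: derivableZ; exact: diff_derivable.
Qed.

Definition Lie_endo X (sX : smooth X) := Endo (Lie_endo_lin sX).

Lemma Lie_endo_pow X (sX : smooth X) k (g : smoothfun U) x :
  (Lie_endo sX ^+ k) g x = iter k (Lie X) g x.
Proof.
elim: k g x => [//|k IHk] g x; rewrite exprSr endoME IHk iterSr.
by [].
Qed.

Lemma Lie_endoD X Y (sX : smooth X) (sY : smooth Y) (sXY : smooth (fun x => X x + Y x)) :
  Lie_endo sXY = Lie_endo sX + Lie_endo sY.
Proof.
apply: endo_eq => g; apply: smf_eq => x.
rewrite -[LHS]/('D_(X x + Y x) g x) -[RHS]/('D_(X x) g x + 'D_(Y x) g x).
have dg := smooth_differentiable x (smfP g).
by rewrite !deriveE // linearD.
Qed.

Lemma horner_endo P h n (g : smoothfun U) x : (size P <= n)%N ->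
  P.[h%:A] g x = \sum_(k < n) h ^+ k * P`_k g x.
Proof.
move=> Pn; rewrite (horner_coef_wide _ Pn) endo_sumE smf_sumE.
apply: eq_bigr => k _.
have -> : (h%:A : endo U) ^+ k = (h ^+ k)%:A.
  by elim: {k}(nat_of_ord k) => [|k IHk]; rewrite ?scale1r // !exprS IHk -scalerAl mul1r scalerA.
by rewrite -scalerAr mulr1 endoZE smfZ.
Qed.

Lemma horner_expp N X (sX : smooth X) h (g : smoothfun U) x :
  (expp N (Lie_endo sX)).[h%:A] g x = tay N.+1 X g x h.
Proof.
rewrite (horner_endo _ _ _ (size_poly _ _)); apply: eq_bigr => k _.
rewrite coef_expp ?leq_ord // endoZE smfZ Lie_endo_pow mulrA.
by congr (_ * _).
Qed.

(* [P] is the Taylor expansion in [h], up to order [N], of the pullback by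
   the maps [Phi (., h)]. *)
Definition represents N (Phi : U * R -> U) P := forall x0 : U,
  (Phi p @[p --> (x0, 0 : R)] --> x0) /\
  forall g : smoothfun U, bO N.+1 x0 (fun p => g (Phi p) - P.[p.2%:A] g p.1).

Lemma cvg_pairP (V W P : normedModType R) (y0 : P) (f : P * R -> V) (g : P * R -> W)
    (a : V) (b : W) : f p @[p --> (y0, 0 : R)] --> a -> g p @[p --> (y0, 0 : R)] --> b ->
  (f p, g p) @[p --> (y0, 0 : R)] --> (a, b).
Proof. by move=> fa gb; apply: (cvg_pair fa gb). Qed.

Lemma cvg_pair2 (x0 : U) (Psi : U * R -> U) (k : R) :
  Psi p @[p --> (x0, 0 : R)] --> x0 ->
  (fun p : U * R => (Psi p, k * p.2)) p @[p --> (x0, 0 : R)] --> (x0, 0 : R).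
Proof.
move=> cP; apply: cvg_pairP => //; rewrite -[X in _ --> X](mulr0 k).
by apply: cvgMl_tmp; exact: cvg_snd.
Qed.

Lemma represents_eqm N Phi P Q : eqm N.+1 P Q -> represents N Phi P -> represents N Phi Q.
Proof.
move=> PQ rP x0; have [cP bP] := rP x0; split=> // g.
have : bO N.+1 x0 (fun p => P.[p.2%:A] g p.1 - Q.[p.2%:A] g p.1).
  pose n := maxn (size P) (size Q).
  have -> : (fun p : U * R => P.[p.2%:A] g p.1 - Q.[p.2%:A] g p.1) =
      fun p => \sum_(k < n | (N.+1 <= k)%N) p.2 ^+ k *: (P`_k - Q`_k) g p.1.
    apply/funext => p; rewrite (horner_endo _ _ _ (leq_maxl _ _ : (size P <= n)%N)).
    rewrite (horner_endo _ _ _ (leq_maxr _ _ : (size Q <= n)%N)).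
    rewrite -sumrB (bigID (fun k : 'I_n => (N.+1 <= k)%N)) /= [X in _ + X]big1 ?addr0.
      by apply: eq_bigr => k _; rewrite -mulrBr.
    by move=> k; rewrite -ltnNge => kN; rewrite PQ // subrr.
  apply: bO_sum => k Nk; apply: (bO_leq Nk); rewrite -[k in bO k]addn0.
  apply: bO_scale; first exact: bO_pow.
  apply: (@bO_smooth_comp _ _ _ _ _ (@fst U R) x0); last exact: cvg_fst.
  exact: smfP.
move=> /(bOD (bP g)); apply: bO_near; apply: near_all => p.
by rewrite addrA subrK.
Qed.

(** Pullback is contravariant, so the series of the inner map stands on the left. The estimate for
    [Phi] is used at the moving point [Psi p]; each [P_k g] is again a smooth function, to which the
    expansion of [Psi] applies. *)
Lemma represents_comp N Phi Psi P Q : represents N Phi P -> represents N Psi Q ->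
  represents N (fun p => Phi (Psi p, p.2)) (Q * P).
Proof.
move=> rP rQ x0; have [cP bP] := rP x0; have [cQ bQ] := rQ x0.
have cpair : (fun p : U * R => (Psi p, p.2)) p @[p --> (x0, 0 : R)] --> (x0, 0 : R).
  by apply: cvg_pairP => //; exact: cvg_snd.
split=> [|g]; first exact: (cvg_comp _ _ cpair cP).
have H1 : bO N.+1 x0 (fun p => g (Phi (Psi p, p.2)) - P.[p.2%:A] g (Psi p)).
  apply: (bO_subst (s := fun p => (Psi p, p.2)) (K := 1) cpair _ (bP g)).
  by apply: near_all => p; rewrite mul1r.
have H2 : bO N.+1 x0 (fun p => P.[p.2%:A] g (Psi p) - (Q * P).[p.2%:A] g p.1).
  have -> : (fun p : U * R => P.[p.2%:A] g (Psi p) - (Q * P).[p.2%:A] g p.1) =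
      fun p => \sum_(k < size P) p.2 ^+ k *: (P`_k g (Psi p) - Q.[p.2%:A] (P`_k g) p.1).
    apply/funext => p; rewrite (horner_endo _ _ _ (leqnn _)).
    (* Evaluation is multiplicative despite noncommuting coefficients because [h%:A] is central. *)
    have -> : (Q * P).[p.2%:A] = Q.[p.2%:A] * P.[p.2%:A].
      apply: hornerM_comm; rewrite /comm_poly.
      by rewrite -!scalerAr -!scalerAl mulr1 mul1r.
    rewrite endoME.
    have -> : P.[p.2%:A] g = \sum_(k < size P) p.2 ^+ k *: P`_k g.
      by apply: smf_eq => y; rewrite (horner_endo _ _ _ (leqnn _)) smf_sumE.
    rewrite endo_lin_sum smf_sumE -sumrB; apply: eq_bigr => k _.
    by rewrite endo_linZ smfZ -mulrBr.
  apply: bO_sum => k _; rewrite -[N.+1]add0n; apply: bO_scale; last exact: bQ.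
  by apply: bO_leq (bO_pow k x0).
move: (bOD H1 H2); apply: bO_near; apply: near_all => p.
by rewrite addrA subrK.
Qed.

(** [c] may be negative, as it is for the middle substep of the triple jump, which runs backwards in
    time. *)
Lemma represents_scale N Phi P c : represents N Phi P ->
  represents N (fun p => Phi (p.1, c * p.2)) (scalep c P).
Proof.
move=> rP x0; have [cP bP] := rP x0.
have cpair : (fun p : U * R => (p.1, c * p.2)) p @[p --> (x0, 0 : R)] --> (x0, 0 : R).
  by apply: cvg_pair2; exact: cvg_fst.
split=> [|g]; first exact: (cvg_comp _ _ cpair cP).
have := bO_subst (s := fun p => (p.1, c * p.2)) (K := `|c|) cpair _ (bP g).
have H : \forall p \near (x0, 0 : R), `|(p.1, c * p.2).2| <= `|c| * `|p.2|.
  by apply: near_all => p; rewrite /= normrM.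
move=> /(_ H); apply: bO_near; apply: near_all => p /=; congr (_ - _).
rewrite (horner_endo _ _ _ (leqnn _)) (horner_endo _ _ _ (size_poly _ _)).
apply: eq_bigr => k _; rewrite coef_scalep endoZE smfZ exprMn mulrA.
by congr (_ * _); rewrite mulrC.
Qed.

Lemma represents_flow N X (sX : smooth X) (Phi : U * R -> U) : smooth Phi ->
  (forall x, Phi (x, 0) = x) ->
  (forall x (h : R), is_derive h 1 (fun h => Phi (x, h)) (X (Phi (x, h)))) ->
  represents N Phi (expp N (Lie_endo sX)).
Proof.
move=> sP P0 dP x0.
have cP : Phi p @[p --> (x0, 0 : R)] --> x0.
  by have := smooth_continuous sP (x := (x0, 0)); rewrite /continuous_at P0.
split=> // g.
have := @approx_flow _ _ _ _ X x0 id Phi (fun=> 0) N.+1 fU (findim_R R) sX cP (@cvg_id _ _).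
have H1 : \forall x \near x0, Phi (x, 0) = id x by exact: near_all_pt.
have H2 : \forall p \near (x0, 0 : R),
    is_derive (p.2 : R) (1 : R) (fun s => Phi (p.1, s)) (X (Phi p) + 0).
  by apply: near_all => -[x h]; rewrite addr0; exact: dP.
move=> /(_ H1 H2 (bO0 _ _ _) g (smfP g)).
by apply: bO_near; apply: near_all => p; rewrite horner_expp.
Qed.

End Representation.

(** * Gradients, Jacobians and small matrices *)

Section Calculus.
Context (R : realType).
Implicit Types U V W : normedModType R.

Lemma partial_derive U V W (g : U * V -> W) x y v : differentiable g (x, y) ->
  'D_v (fun x => g (x, y)) x = 'D_(v, 0) g (x, y).
Proof.
move=> /differentiableP dg.
have di := is_diff_pair (is_diff_id x) (is_diff_cst y x).
by rewrite (is_diff_derive _ (is_diff_comp di dg)) /= (is_diff_derive _ dg).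
Qed.

Lemma derive_jacobianE n p (f : 'rV[R]_n -> 'rV[R]_p) x v : differentiable f x ->
  'D_v f x = v *m (Jac f x)^T.
Proof. by move=> df; rewrite deriveEjacobian // /Jac trmxK. Qed.

Lemma JacE n p (f : 'rV[R]_n -> 'rV[R]_p) x i j : differentiable f x ->
  Jac f x i j = 'D_(delta_mx 0 j) f x 0 i.
Proof. by move=> df; rewrite derive_jacobianE // -rowE !mxE. Qed.

Lemma derive_gradE n (g : 'rV[R]_n -> R) x v : differentiable g x ->
  'D_v g x = \sum_j v 0 j * grad g x 0 j.
Proof.
move=> dg; rewrite (@derive_basis _ _ _ n (fun j => delta_mx 0 j) (fun j v => v 0 j)) //.
  by apply: eq_bigr => j _; rewrite mxE.
by move=> u; exact: row_sum_delta.
Qed.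

Lemma smooth_grad n (g : 'rV[R]_n -> R -> R) : smooth (fun x : 'rV[R]_n * R => g x.1 x.2) ->
  smooth (fun x : 'rV[R]_n * R => grad (g ^~ x.2) x.1).
Proof.
move=> sg; apply: smooth_mx => i j.
have -> : (fun x : 'rV[R]_n * R => grad (g ^~ x.2) x.1 i j) =
    fun x => 'D_(delta_mx 0 j, 0) (fun x : 'rV[R]_n * R => g x.1 x.2) x.
  apply/funext => -[x t]; rewrite mxE /=.
  rewrite -(partial_derive (g := fun x : 'rV[R]_n * R => g x.1 x.2)) //.
  exact: smooth_differentiable.
exact: smooth_derive.
Qed.

Lemma smooth_partial U V W (g : U * V -> W) y : findim U -> findim V ->
  smooth g -> smooth (fun x => g (x, y)).
Proof.
move=> fU fV; apply: (smooth_comp (f := fun x : U => (x, y))).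
by apply: smooth_pair => //; [exact: smooth_id|exact: smooth_cst].
Qed.

Lemma smooth_Jac n p (f : 'rV[R]_n -> R -> 'rV[R]_p) :
  smooth (fun x : 'rV[R]_n * R => f x.1 x.2) ->
  smooth (fun x : 'rV[R]_n * R => Jac (f ^~ x.2) x.1).
Proof.
move=> sf; apply: smooth_mx => i j.
have -> : (fun x : 'rV[R]_n * R => Jac (f ^~ x.2) x.1 i j) =
    fun x => 'D_(delta_mx 0 j, 0) (fun x : 'rV[R]_n * R => f x.1 x.2) x 0 i.
  apply/funext => -[x t] /=; rewrite JacE; last first.
    exact: (smooth_differentiable _ (smooth_partial t _ _ sf)).
  rewrite -(partial_derive (g := fun x : 'rV[R]_n * R => f x.1 x.2)) //.
  exact: smooth_differentiable.
by apply: smooth_coord; exact: smooth_derive.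
Qed.

(** The norm is the largest absolute value of an entry, whence the factor [n]. *)
Lemma norm_mulmx k n p (u : 'M[R]_(k, n)) (v : 'M[R]_(n, p)) :
  `|u *m v| <= n%:R * `|u| * `|v|.
Proof.
rewrite {1}/Num.Def.normr /= mx_normrE; apply: bigmax_le => [|[i j] _ /=].
  by rewrite !mulr_ge0.
rewrite mxE (le_trans (ler_norm_sum _ _ _)) //.
have -> : n%:R * `|u| * `|v| = \sum_(l < n) `|u| * `|v|.
  by rewrite sumr_const card_ord -[RHS]mulr_natl mulrA.
apply: ler_sum => l _; rewrite normrM ler_pM //.
  by rewrite {2}/Num.Def.normr /= mx_normrE; exact: (le_bigmax _ _ (i, l)).
by rewrite {2}/Num.Def.normr /= mx_normrE; exact: (le_bigmax _ _ (l, j)).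
Qed.

(** A row vector killed by [M] would satisfy [|v| <= |v| / 2]. *)
Lemma near_id_unitmx n (M : 'M[R]_n) : n%:R * `|M - 1%:M| <= 2^-1 -> M \in unitmx.
Proof.
move=> M1; rewrite -row_free_unit; apply: inj_row_free => v vM.
apply/eqP; rewrite -normr_eq0 eq_le normr_ge0 andbT.
have : `|v| <= n%:R * `|v| * `|M - 1%:M|.
  apply: le_trans (norm_mulmx _ _).
  by rewrite mulmxBr vM mulmx1 sub0r normrN.
rewrite mulrAC => /le_trans/(_ (ler_wpM2r (normr_ge0 v) M1)).
lra.
Qed.

Lemma near_id_norm n (M : 'M[R]_n) (v : 'rV[R]_n) : n%:R * `|M - 1%:M| <= 2^-1 ->
  `|v| <= 2 * `|v *m M|.
Proof.
move=> M1.
have : `|v| <= `|v *m M| + n%:R * `|v| * `|M - 1%:M|.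
  apply: le_trans (lerD (lexx _) (norm_mulmx _ _)).
  rewrite mulmxBr mulmx1 -[X in `|X| <= _](subrK (v *m M)) addrC.
  by rewrite (le_trans (ler_normD _ _)) // distrC.
rewrite mulrAC => H; have := ler_wpM2r (normr_ge0 v) M1; lra.
Qed.

Lemma mulmx_bilinear n p q :
  bilinear_for (GRing.Scale.Law.clone _ _ *:%R _) (GRing.Scale.Law.clone _ _ *:%R _)
    (fun (u : 'M[R]_(n, p)) (v : 'M[R]_(p, q)) => u *m v).
Proof.
by split=> [v|u] k x y /=; rewrite ?mulmxDl ?mulmxDr -?scalemxAl -?scalemxAr.
Qed.

Definition mulmxb n p q (u : 'M[R]_(n, p)) (v : 'M[R]_(p, q)) := u *m v.
HB.instance Definition _ n p q :=
  bilinear_isBilinear.Build R 'M[R]_(n, p) 'M[R]_(p, q) 'M[R]_(n, q) _ _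
    (@mulmxb n p q) (@mulmx_bilinear n p q).

Lemma is_diff_mulmx U n p q (u du : U -> 'M[R]_(n, p)) (v dv : U -> 'M[R]_(p, q)) x :
  is_diff x u du -> is_diff x v dv ->
  is_diff x (fun y => u y *m v y) (fun w => u x *m dv w + du w *m v x).
Proof.
move=> dux dvx.
have cm : continuous (fun w : 'M[R]_(n, p) * 'M[R]_(p, q) => mulmxb w.1 w.2).
  apply: smooth_continuous; apply: smooth_mulmx; first exact: smooth_fst.
  exact: smooth_snd.
have db : is_diff (u x, v x) (fun w : 'M[R]_(n, p) * 'M[R]_(p, q) => mulmxb w.1 w.2)
    (fun w => mulmxb (u x) w.2 + mulmxb w.1 (v x)).
  by apply: DiffDef; [exact: differentiable_bilin|rewrite diff_bilin].
exact: (is_diff_comp (is_diff_pair dux dvx) db).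
Qed.

Lemma bO_cvg0 (P W : normedModType R) n (x0 : P) (E : P * R -> W) : bO n.+1 x0 E ->
  E p @[p --> (x0, 0 : R)] --> (0 : W).
Proof.
move=> /(bO_leq (ltn0Sn n : (1 <= n.+1)%N))/bO_ge0[C C0 EC]; apply/cvgrPdist_lt => d d0.
have C1 : 0 < C + 1 by rewrite ltr_wpDl.
have dC : 0 < d / (C + 1) by rewrite divr_gt0.
have H := near_snd (Q := fun h => `|h| < d / (C + 1)) x0 (near_norm_lt dC).
apply: filterS2 EC H => p EC; rewrite sub0r normrN ltr_pdivlMr //.
apply: le_lt_trans; rewrite (le_trans EC) // expr1 mulrC ler_wpM2l // lerDl //.
Qed.

End Calculus.

(** * The Hamiltonian field and its splitting *)

Section Fields.
Context (R : realType) (m e : R) (m_gt0 : 0 < m)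
  (A : 'rV[R]_3 -> R -> 'rV[R]_3) (phi : 'rV[R]_3 -> R -> R)
  (A_smooth : smooth (fun x : 'rV[R]_3 * R => A x.1 x.2))
  (phi_smooth : smooth (fun x : 'rV[R]_3 * R => phi x.1 x.2)).

Let f := fpot m e A phi.

Lemma smooth_sqnorm2 (U : normedModType R) n (g : U -> 'rV[R]_n) : smooth g ->
  smooth (fun x => sqnorm2 (g x)).
Proof.
by move=> sg; apply: smooth_sum => i _; apply: smooth_exp; exact: smooth_coord.
Qed.

Lemma smooth_fpot : smooth (fun x : 'rV[R]_3 * R => f x.1 x.2).
Proof.
apply: smoothD; apply: smoothM => //; try exact: smooth_cst.
exact: smooth_sqnorm2.
Qed.

(** The time component is 0: time advances only with the potential part, so that the sum of both
    fields advances it at unit speed. *)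
Definition kinetic_field (x : phase R * R) : phase R * R :=
  (row_mx (m^-1 *: rsubmx x.1) 0, 0).

(** Hamilton's equations of [- (e / m) p A^T + f], the part of the Hamiltonian that is affine in
    [p]. *)
Definition potential_field (z : phase R) (t : R) : phase R :=
  row_mx (- (e / m) *: A (lsubmx z) t)
    ((e / m) *: (rsubmx z *m Jac (A ^~ t) (lsubmx z)) - grad (f ^~ t) (lsubmx z)).

Lemma smooth_lsubmx (U : normedModType R) k n p (g : U -> 'M[R]_(k, n + p)) :
  smooth g -> smooth (fun x => lsubmx (g x)).
Proof.
move=> sg; apply: smooth_mx => i j.
under [X in smooth X]eq_fun do rewrite mxE.
exact: smooth_coord.
Qed.

Lemma smooth_rsubmx (U : normedModType R) k n p (g : U -> 'M[R]_(k, n + p)) :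
  smooth g -> smooth (fun x => rsubmx (g x)).
Proof.
move=> sg; apply: smooth_mx => i j.
under [X in smooth X]eq_fun do rewrite mxE.
exact: smooth_coord.
Qed.

Lemma smooth_kinetic_field : smooth kinetic_field.
Proof.
apply: smooth_pair; last exact: smooth_cst.
apply: smooth_row_mx; last exact: smooth_cst.
by apply: smoothZ; apply: smooth_rsubmx; exact: smooth_fst.
Qed.

Lemma smooth_at (U W : normedModType R) n (g : 'rV[R]_n * R -> W) (q : U -> 'rV[R]_n) (t : U -> R) :
  smooth g -> smooth q -> smooth t -> smooth (fun x => g (q x, t x)).
Proof.
move=> sg sq st; apply: (smooth_comp (f := fun x => (q x, t x))) => //.
exact: smooth_pair.
Qed.

Lemma smooth_potential_field :
  smooth (fun x : phase R * R => potential_field x.1 x.2).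
Proof.
have s1 : smooth (fun x : phase R * R => x.1) by exact: smooth_fst.
have s2 : smooth (fun x : phase R * R => x.2) by exact: smooth_snd.
have sl := smooth_lsubmx s1; have sr := smooth_rsubmx s1.
apply: smooth_row_mx.
  by apply: smoothZ; exact: (smooth_at A_smooth).
apply: smoothB; last exact: (smooth_at (smooth_grad smooth_fpot)).
apply: smoothZ; apply: smooth_mulmx => //.
exact: (smooth_at (smooth_Jac A_smooth)).
Qed.

(** Expanding the square yields the splitting; the term in the squared norm of [A] joins the scalar
    potential to form [f]. *)
Lemma hamiltonianE q p t : hamiltonian m e A phi q p t =
  (2 * m)^-1 * sqnorm2 p - (e / m) * (p *m (A q t)^T) 0 0 + f q t.
Proof.
have m0 : m != 0 by rewrite gt_eqF.
rewrite /f /fpot addrA; congr (_ + _).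
rewrite mxE /sqnorm2 !mulr_sumr -sumrB -big_split /=; apply: eq_bigr => i _.
by rewrite !mxE; field.
Qed.

Lemma derive_sqnorm2 n (p v : 'rV[R]_n) :
  'D_v (@sqnorm2 R n) p = 2 * \sum_j p 0 j * v 0 j.
Proof.
have dc j : is_derive p v (fun p : 'rV[R]_n => p 0 j : R) (v 0 j).
  have cl : continuous (coord_lin R (0 : 'I_1) j) by apply: lin_continuous.
  have dl := is_diff_lin p cl.
  by apply: DeriveDef; [apply: diff_derivable; case: dl|rewrite (is_diff_derive _ dl)].
have -> : @sqnorm2 R n = \sum_j ((fun p : 'rV[R]_n => p 0 j : R) * (fun p => p 0 j)).
  by apply/funext => u; rewrite fct_sumE; apply: eq_bigr => j _; rewrite expr2.
rewrite derive_sum => [|j]; last exact: derivableM.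
rewrite mulr_sumr; apply: eq_bigr => j _.
rewrite deriveM // !derive_val /=; rewrite /GRing.scale /=; ring.
Qed.

Lemma sum_delta n (j : 'I_n) (x : 'I_n -> R) :
  \sum_k (delta_mx 0 j : 'rV[R]_n) 0 k * x k = x j.
Proof.
rewrite (bigD1 j) //= mxE !eqxx mul1r big1 ?addr0 // => k kj.
by rewrite mxE (negbTE kj) mul0r.
Qed.

Lemma grad_p_hamiltonian q p t :
  grad (fun p => hamiltonian m e A phi q p t) p = m^-1 *: p - (e / m) *: A q t.
Proof.
have m0 : m != 0 by rewrite gt_eqF.
apply/rowP => j; rewrite mxE.
have -> : (fun p => hamiltonian m e A phi q p t) = ((2 * m)^-1 *: (@sqnorm2 R 3)
   + (- (e / m)) *: (fun p => (p *m (A q t)^T) 0 0)) + cst (f q t).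
  by apply/funext => u; rewrite hamiltonianE -mulNr.
have ds : smooth (@sqnorm2 R 3) by apply: smooth_sqnorm2; exact: smooth_id.
have l1 : linear (fun p : 'rV[R]_3 => (p *m (A q t)^T) 0 0 : R).
  by move=> k u v; rewrite mulmxDl -scalemxAl !mxE.
have cl : continuous (mklin l1) by apply: lin_continuous.
have dl := is_diff_lin p cl.
have D1 := derivableP (diff_derivable (v := delta_mx 0 j) (smooth_differentiable p ds)).
have D2 : is_derive p (delta_mx 0 j) (mklin l1) (mklin l1 (delta_mx 0 j)).
  by apply: DeriveDef; [apply: diff_derivable; case: dl|exact: is_diff_derive].
have D := is_deriveD (is_deriveD (is_deriveZ (2 * m)^-1 D1) (is_deriveZ (- (e / m)) D2))
  (is_derive_cst (f q t) p (delta_mx 0 j)).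
etransitivity; first exact: (@derive_val _ _ _ _ _ _ _ D).
rewrite derive_sqnorm2 addr0 /= !mxE /GRing.scale /=.
under eq_bigr do rewrite mulrC.
rewrite !sum_delta !mxE; by field.
Qed.

Lemma grad_q_hamiltonian q p t :
  grad (fun q => hamiltonian m e A phi q p t) q =
  grad (f ^~ t) q - (e / m) *: (p *m Jac (A ^~ t) q).
Proof.
apply/rowP => j; rewrite mxE.
have sAt : smooth (A ^~ t) := smooth_partial t (findim_mx R 1 3) (findim_R R) A_smooth.
have sft : smooth (f ^~ t) := smooth_partial t (findim_mx R 1 3) (findim_R R) smooth_fpot.
have l1 : linear (fun a : 'rV[R]_3 => (p *m a^T) 0 0 : R).
  by move=> k u v; rewrite linearP mulmxDr -scalemxAr !mxE.
have cl : continuous (mklin l1) by apply: lin_continuous.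
have dA := differentiableP (smooth_differentiable q sAt).
have dpA := is_diff_comp dA (is_diff_lin (A q t) cl).
have -> : (fun q => hamiltonian m e A phi q p t) = cst ((2 * m)^-1 * sqnorm2 p)
   + (- (e / m)) *: (mklin l1 \o (A ^~ t)) + (f ^~ t).
  by apply/funext => u; rewrite hamiltonianE -mulNr.
have D1 := derivableP (diff_derivable (v := delta_mx 0 j) (smooth_differentiable q sft)).
have D2 : is_derive q (delta_mx 0 j) (mklin l1 \o (A ^~ t)) (mklin l1 ('D_(delta_mx 0 j) (A ^~ t) q)).
  apply: DeriveDef; first by apply: diff_derivable; case: dpA.
  by rewrite (is_diff_derive _ dpA) /= (is_diff_derive _ dA).
have D := is_deriveD (is_deriveD (is_derive_cst ((2 * m)^-1 * sqnorm2 p) q (delta_mx 0 j))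
  (is_deriveZ (- (e / m)) D2)) D1.
etransitivity; first exact: (@derive_val _ _ _ _ _ _ _ D).
rewrite add0r /= derive_jacobianE; last exact: smooth_differentiable.
rewrite addrC !mxE scaleNr; congr (_ - _ * _).
apply: eq_bigr => k _; rewrite !mxE; congr (_ * _).
have dAq := smooth_differentiable q sAt.
by rewrite sum_delta mxE JacE // deriveE.
Qed.

Lemma smooth_total_field :
  smooth (fun x => kinetic_field x + ext_field potential_field x).
Proof.
apply: smoothD; first exact: smooth_kinetic_field.
by apply: smooth_pair; [exact: smooth_potential_field|exact: smooth_cst].
Qed.

Lemma hamilton_fieldE z t :
  (hamilton_field m e A phi z t, 1) = kinetic_field (z, t) + ext_field potential_field (z, t).
Proof.
congr (_, _); last by rewrite /= add0r.
rewrite /hamilton_field grad_p_hamiltonian grad_q_hamiltonian /=.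
by rewrite /potential_field add_row_mx add0r scaleNr opprB.
Qed.

End Fields.

(** * The shadowed Runge-Kutta map *)

Section Shadowed.
Context (R : realType) (m e : R)
  (A : 'rV[R]_3 -> R -> 'rV[R]_3) (phi : 'rV[R]_3 -> R -> R)
  (A_smooth : smooth (fun x : 'rV[R]_3 * R => A x.1 x.2))
  (phi_smooth : smooth (fun x : 'rV[R]_3 * R => phi x.1 x.2))
  (r s : nat) (a : 'M[R]_s) (b : 'I_s -> R) (rk_r : rk_order a b r).

Let f := fpot m e A phi.
Let X2 := potential_field m e A phi.
(** All components [(q, p)], [M], [w] are flattened into one row vector because [rk_order] speaks of
    equations on row vectors. *)
Let E := 'rV[R]_((3 + 3) + (3 * 3 + 3)).

Let qE (y : E) : 'rV[R]_3 := lsubmx (lsubmx y).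
Let pE (y : E) : 'rV[R]_3 := rsubmx (lsubmx y).
Let ME (y : E) : 'M[R]_3 := vec_mx (lsubmx (rsubmx y)).
Let wE (y : E) : 'rV[R]_3 := rsubmx (rsubmx y).

(* The flow of [potential_field] together with its variational equation [M]
   in [q] and the quadrature [w] of [grad f *m M]; [p *m M + w] is a first integral. *)
Definition shadow_field (y : E) (t : R) : E :=
  row_mx (X2 (lsubmx y) t)
    (row_mx (mxvec (- (e / m) *: (Jac (A ^~ t) (qE y) *m ME y)))
            (grad (f ^~ t) (qE y) *m ME y)).

Definition shadow_init (z : phase R) : E := row_mx z (row_mx (mxvec 1%:M) 0).

Lemma smooth_shadow_field : smooth (fun x : E * R => shadow_field x.1 x.2).
Proof.
have s1 : smooth (fun x : E * R => x.1) by exact: smooth_fst.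
have s2 : smooth (fun x : E * R => x.2) by exact: smooth_snd.
have sz := smooth_lsubmx s1; have sr := smooth_rsubmx s1.
have sq := smooth_lsubmx sz; have sw := smooth_rsubmx sr.
have sM : smooth (fun x : E * R => ME x.1).
  apply: (smooth_comp (g := vec_mx) _ (smooth_lsubmx sr)).
  by apply: smooth_is_linear => k u v; rewrite linearP.
apply: smooth_row_mx; first exact: (smooth_at (smooth_potential_field m e A_smooth phi_smooth)).
apply: smooth_row_mx.
  apply: (smooth_comp (g := mxvec)
    (f := fun x : E * R => - (e / m) *: (Jac (A ^~ x.2) (qE x.1) *m ME x.1))).
    apply: smoothZ; apply: smooth_mulmx => //.
    exact: (smooth_at (smooth_Jac A_smooth)).
  by apply: smooth_is_linear => k u v; rewrite linearP.
apply: smooth_mulmx => //.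
exact: (smooth_at (smooth_grad (smooth_fpot m e A_smooth phi_smooth))).
Qed.

Lemma qE_lin k (u v : E) : qE (k *: u + v) = k *: qE u + qE v.
Proof. by rewrite /qE !linearP. Qed.
Lemma ME_lin k (u v : E) : ME (k *: u + v) = k *: ME u + ME v.
Proof. by rewrite /ME !linearP. Qed.
Lemma wE_lin k (u v : E) : wE (k *: u + v) = k *: wE u + wE v.
Proof. by rewrite /wE !linearP. Qed.

Let qL := mklin qE_lin. Let ML := mklin ME_lin. Let wL := mklin wE_lin.

Lemma shadow_field_q y t : qE (shadow_field y t) = - (e / m) *: A (qE y) t.
Proof. by rewrite /qE /shadow_field /X2 /potential_field !row_mxKl. Qed.
Lemma shadow_field_M y t : ME (shadow_field y t) = - (e / m) *: (Jac (A ^~ t) (qE y) *m ME y).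
Proof. by rewrite /ME /shadow_field row_mxKr row_mxKl mxvecK. Qed.
Lemma shadow_field_w y t : wE (shadow_field y t) = grad (f ^~ t) (qE y) *m ME y.
Proof. by rewrite /wE /shadow_field !row_mxKr. Qed.

Let st (z : phase R) t h i := rk_stage a shadow_field (shadow_init z, t) h i.

Lemma qE_init z : qE (shadow_init z) = lsubmx z.
Proof. by rewrite /qE row_mxKl. Qed.
Lemma pE_init z : pE (shadow_init z) = rsubmx z.
Proof. by rewrite /pE row_mxKl. Qed.
Lemma ME_init z : ME (shadow_init z) = 1%:M.
Proof. by rewrite /ME row_mxKr row_mxKl mxvecK. Qed.
Lemma wE_init z : wE (shadow_init z) = 0.
Proof. by rewrite /wE !row_mxKr. Qed.

(** The equation for [q] involves neither [p], [M] nor [w], and Runge-Kutta stages commute with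
    linear projection onto a closed subsystem. *)
Lemma stage_q z t h i : qE (st z t h i) = k_ m e A a t h (lsubmx z) i.
Proof.
move: i; apply: stage_ind => i IH.
rewrite /st /rk_stage stageE shadow_field_q /= /k_ [in RHS]stageE; congr (_ *: A _ _).
rewrite -[LHS]/(qL _) linearD linearZ linear_sum /= qE_init; congr (_ + _ *: _).
by apply: eq_bigr => j ji; rewrite -/(k_ m e A a t h (lsubmx z) j) -IH // -[LHS]/(qL _) linearZ.
Qed.

Lemma stage_arg_q z t h (i : 'I_s) :
  qE (shadow_init z + h *: \sum_(j < s | (j < i)%N) a i j *: st z t h j) =
  arg_ m e A a t h (lsubmx z) i.
Proof.
rewrite /arg_ -[LHS]/(qL _) linearD linearZ linear_sum /= qE_init; congr (_ + _ *: _).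
by apply: eq_bigr => j ji; rewrite -stage_q // -[LHS]/(qL _) linearZ.
Qed.

Lemma stage_M z t h i : ME (st z t h i) = k'_ m e A a t h (lsubmx z) i.
Proof.
move: i; apply: stage_ind => i IH.
rewrite /st /rk_stage stageE shadow_field_M /= /k'_ [in RHS]stageE stage_arg_q.
congr (_ *: (_ *m _)).
rewrite -[LHS]/(ML _) linearD linearZ linear_sum /= ME_init; congr (_ + _ *: _).
by apply: eq_bigr => j ji; rewrite -/(k'_ m e A a t h (lsubmx z) j) -IH // -[LHS]/(ML _) linearZ.
Qed.

Lemma stage_w z t h i : wE (st z t h i) = gradl_ m e A phi a t h (lsubmx z) i.
Proof.
rewrite /st /rk_stage stageE shadow_field_w /= /gradl_ stage_arg_q.
congr (_ *m _).
rewrite -[LHS]/(ML _) linearD linearZ linear_sum /= ME_init; congr (_ + _ *: _).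
by apply: eq_bigr => j ji; rewrite -stage_M // -[LHS]/(ML _) linearZ.
Qed.

Let Y z t h := rk_step a b shadow_field t h (shadow_init z).

Lemma step_q z t h : qE (Y z t h) = lsubmx z + h *: \sum_(i < s) b i *: k_ m e A a t h (lsubmx z) i.
Proof.
rewrite /Y rk_stepE -[LHS]/(qL _) linearD linearZ linear_sum /= qE_init; congr (_ + _ *: _).
by apply: eq_bigr => j _; rewrite -stage_q -[LHS]/(qL _) linearZ.
Qed.

Lemma step_M z t h : ME (Y z t h) = shadow_mx m e A a b t h (lsubmx z).
Proof.
rewrite /Y rk_stepE -[LHS]/(ML _) linearD linearZ linear_sum /= ME_init; congr (_ + _ *: _).
by apply: eq_bigr => j _; rewrite -stage_M -[LHS]/(ML _) linearZ.
Qed.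

Lemma step_w z t h : wE (Y z t h) = h *: \sum_(i < s) b i *: gradl_ m e A phi a t h (lsubmx z) i.
Proof.
rewrite /Y rk_stepE -[LHS]/(wL _) linearD linearZ linear_sum /= wE_init add0r; congr (_ *: _).
by apply: eq_bigr => j _; rewrite -stage_w -[LHS]/(wL _) linearZ.
Qed.

(** The new momentum is not the [p] component of the Runge-Kutta step: it solves [P M + w = p] with
    the computed [M] and [w], so that the first integral is preserved exactly. *)
Lemma psi2E z t h : psi2 m e A phi a b (t + h) t z =
  row_mx (qE (Y z t h)) ((rsubmx z - wE (Y z t h)) *m invmx (ME (Y z t h))).
Proof.
by rewrite step_q step_M step_w /psi2 /= [t + h]addrC addrK.
Qed.

Lemma psi2_domE z t h : pm_dom (psi2 m e A phi a b (t + h) t) z <-> ME (Y z t h) \in unitmx.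
Proof. by rewrite step_M /psi2 /= [t + h]addrC addrK. Qed.

(** The pair [(q, p)] is a closed subsystem, so functions of it only feel [X2]. *)
Lemma Lie_lsubmx (W : normedModType R) (g : phase R * R -> W) : smooth g ->
  Lie (ext_field shadow_field) (fun x => g (lsubmx x.1, x.2)) =
  (fun x => Lie (ext_field X2) g (lsubmx x.1, x.2)).
Proof.
move=> sg; apply/funext => x; rewrite /Lie.
have l1 : linear (fun x : E * R => (lsubmx x.1, x.2) : phase R * R).
  by move=> k u v; congr (_, _); rewrite /= linearP.
have cl : continuous (mklin l1) by apply: lin_continuous.
have dg := differentiableP (smooth_differentiable (lsubmx x.1, x.2) sg).
have dgl := is_diff_comp (is_diff_lin x cl) dg.
rewrite (is_diff_derive _ dgl) /= (is_diff_derive _ dg).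
by rewrite row_mxKl.
Qed.

Lemma tay_lsubmx N (W : normedModType R) (g : phase R * R -> W) x h : smooth g ->
  tay N (ext_field shadow_field) (fun x => g (lsubmx x.1, x.2)) x h =
  tay N (ext_field X2) g (lsubmx x.1, x.2) h.
Proof.
move=> sg; apply: eq_bigr => k _; congr (_ *: _).
have sX := smooth_ext_field (findim_mx R 1 (3 + 3)) (smooth_potential_field m e A_smooth phi_smooth).
have -> : iter k (Lie (ext_field shadow_field)) (fun x => g (lsubmx x.1, x.2)) =
    (fun x => iter k (Lie (ext_field X2)) g (lsubmx x.1, x.2)).
  elim: (nat_of_ord k) => //= j ->; rewrite Lie_lsubmx //.
  exact: smooth_iter_Lie.
by [].
Qed.

Let G (x : E * R) : 'rV[R]_3 := pE x.1 *m ME x.1 + wE x.1.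

Lemma smooth_shadow_parts : [/\ smooth (fun x : E * R => lsubmx x.1), smooth (fun x : E * R => pE x.1),
  smooth (fun x : E * R => ME x.1) & smooth (fun x : E * R => wE x.1)].
Proof.
have s1 : smooth (fun x : E * R => x.1) by exact: smooth_fst.
have sz := smooth_lsubmx s1; have sr := smooth_rsubmx s1.
split => //; [exact: smooth_rsubmx| |exact: smooth_rsubmx].
apply: (smooth_comp (g := vec_mx) _ (smooth_lsubmx sr)).
by apply: smooth_is_linear => k u v; rewrite linearP.
Qed.

(** By the product rule, the [Jac] terms in the derivatives of [p] and of [M] cancel, and the
    gradient term in that of [p] cancels the derivative of [w]. *)
Lemma shadow_first_integral : Lie (ext_field shadow_field) G = fun=> 0.
Proof.
apply/funext => x; rewrite /Lie.
have pl : linear (fun x : E * R => pE x.1) by move=> k u v; rewrite /pE !linearP.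
have Ml : linear (fun x : E * R => ME x.1) by move=> k u v; rewrite /ME !linearP.
have wl : linear (fun x : E * R => wE x.1) by move=> k u v; rewrite /wE !linearP.
have cp : continuous (mklin pl) by apply: lin_continuous.
have cM : continuous (mklin Ml) by apply: lin_continuous.
have cw : continuous (mklin wl) by apply: lin_continuous.
have dG := is_diffD (is_diff_mulmx (is_diff_lin x cp) (is_diff_lin x cM)) (is_diff_lin x cw).
etransitivity; first exact: (is_diff_derive (ext_field shadow_field x) dG).
rewrite -[LHS]/(pE x.1 *m ME (shadow_field x.1 x.2) + pE (shadow_field x.1 x.2) *m ME x.1
  + wE (shadow_field x.1 x.2)).
rewrite shadow_field_M shadow_field_w.
have -> : pE (shadow_field x.1 x.2) = (e / m) *: (pE x.1 *m Jac (A ^~ x.2) (qE x.1))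
    - grad (f ^~ x.2) (qE x.1).
  by rewrite /pE row_mxKl row_mxKr.
by rewrite mulmxBl -scalemxAl -scalemxAr mulmxA scaleNr addrA addNr add0r addNr.
Qed.

Lemma tay_first_integral N x h : tay N.+1 (ext_field shadow_field) G x h = G x.
Proof.
rewrite /tay big_ord_recl /= expr0 divr1 scale1r big1 ?addr0 // => k _.
suff -> : Lie (ext_field shadow_field) (iter k (Lie (ext_field shadow_field)) G) = fun=> 0.
  by rewrite scaler0.
rewrite -iterS iterSr shadow_first_integral.
elim: (nat_of_ord k) => //= j ->; apply/funext => y; exact: derive_cst.
Qed.

(** The Runge-Kutta step on the large system has the right expansion, and [psi2] differs from its
    [(q, p)] part in the momentum only. That difference is controlled by the first integral and the
    closeness of [M] to the identity. *)
Lemma represents_psi2 (sX : smooth (ext_field X2)) :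
  represents r (fun p => (psi2 m e A phi a b (p.1.2 + p.2) p.1.2 p.1.1, p.1.2 + p.2))
    (expp r (Lie_endo (findim_prod (findim_mx R 1 (3 + 3)) (findim_R R)) sX)) /\
  forall x0 : phase R * R, \forall p \near (x0, 0 : R),
    pm_dom (psi2 m e A phi a b (p.1.2 + p.2) p.1.2) p.1.1.
Proof.
suff H (x0 : phase R * R) : [/\ \forall p \near (x0, 0 : R),
      pm_dom (psi2 m e A phi a b (p.1.2 + p.2) p.1.2) p.1.1,
    (psi2 m e A phi a b (p.1.2 + p.2) p.1.2 p.1.1, p.1.2 + p.2) @[p --> (x0, 0 : R)] --> x0 &
    forall g : smoothfun (phase R * R)%type, bO r.+1 x0 (fun p =>
      g (psi2 m e A phi a b (p.1.2 + p.2) p.1.2 p.1.1, p.1.2 + p.2)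
      - tay r.+1 (ext_field X2) g p.1 p.2)].
  split=> [x0|x0]; last by have [] := H x0.
  have [_ cP gP] := H x0; split=> // g.
  move: (gP g); apply: bO_near; apply: near_all => p.
  by rewrite horner_expp.
pose iota (x : phase R * R) : E * R := (shadow_init x.1, x.2).
pose Yp (p : (phase R * R) * R) := Y p.1.1 p.1.2 p.2.
have sS := smooth_shadow_field.
have s1 : smooth (fun p : (phase R * R) * R => p.1) by exact: smooth_fst.
have s11 := smooth_fst_comp (findim_mx R 1 (3 + 3)) (findim_R R) s1.
have s12 := smooth_snd_comp (findim_mx R 1 (3 + 3)) (findim_R R) s1.
have sh : smooth (fun p : (phase R * R) * R => p.2) by exact: smooth_snd.
have siota : smooth (fun p : (phase R * R) * R => iota p.1).
  apply: smooth_pair => //; apply: smooth_row_mx => //; exact: smooth_cst.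
have ciota : (fun p : (phase R * R) * R => (iota p.1, p.2)) p @[p --> (x0, 0 : R)] --> (iota x0, 0 : R).
  have sc : smooth (fun p : (phase R * R) * R => (iota p.1, p.2)) by exact: smooth_pair.
  by have := smooth_continuous sc (x := (x0, 0)).
have pull (W : normedModType R) (Q : (E * R) * R -> W) : bO r.+1 (iota x0) Q ->
    bO r.+1 x0 (fun p => Q (iota p.1, p.2)).
  apply: (bO_subst (s := fun p => (iota p.1, p.2)) (K := 1) ciota).
  by apply: near_all => p; rewrite mul1r.
have sY : smooth Yp.
  apply: (smooth_comp (f := fun p : (phase R * R) * R => (iota p.1, p.2))
    (g := fun p : (E * R) * R => rk_step a b shadow_field p.1.2 p.2 p.1.1)).
    exact: smooth_pair.
  exact: smooth_rk_step.
have Y0 : Yp (x0, 0) = shadow_init x0.1 by rewrite /Yp /Y rk_stepE scale0r addr0.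
have cY : Yp p @[p --> (x0, 0 : R)] --> shadow_init x0.1.
  by have := smooth_continuous sY (x := (x0, 0)); rewrite /continuous_at Y0.
have H1 (g : smoothfun (phase R * R)%type) : bO r.+1 x0 (fun p =>
    g (lsubmx (Yp p), p.1.2 + p.2) - tay r.+1 (ext_field X2) g p.1 p.2).
  have sgl : smooth (fun x : E * R => g (lsubmx x.1, x.2)).
    apply: (smooth_comp (f := fun x : E * R => (lsubmx x.1, x.2))); last exact: smfP.
    apply: smooth_pair => //; last exact: smooth_snd.
    by apply: smooth_lsubmx; exact: smooth_fst.
  have := pull _ _ (rk_approx rk_r sS (iota x0) (findim_R R) sgl).
  apply: bO_near; apply: near_all => p; rewrite tay_lsubmx; last exact: smfP.
  by rewrite /iota /= /shadow_init row_mxKl -surjective_pairing.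
have sG : smooth G.
  have [_ sp sM sw] := smooth_shadow_parts.
  by apply: smoothD => //; exact: smooth_mulmx.
(* The Taylor polynomial of [G] is constant, so the Runge-Kutta step conserves [G], initially equal
   to [p], up to [h^(r+1)]. *)
have H2 : bO r.+1 x0 (fun p => G (Yp p, p.1.2 + p.2) - rsubmx p.1.1).
  have := pull _ _ (rk_approx rk_r sS (iota x0) (findim_mx R 1 3) sG).
  apply: bO_near; apply: near_all => p; rewrite tay_first_integral.
  by rewrite {2}/G /= pE_init ME_init wE_init mulmx1 addr0.
have cM : ME (Yp p) @[p --> (x0, 0 : R)] --> (1%:M : 'M[R]_3).
  have cl : continuous ML by apply: lin_continuous.
  by have := cvg_comp _ _ cY (cl (shadow_init x0.1)); rewrite /= ME_init.
have H3 : \forall p \near (x0, 0 : R), 3%:R * `|ME (Yp p) - 1%:M| <= 2^-1.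
  have e0 : 0 < (2^-1 / 3%:R : R) by rewrite divr_gt0.
  move/cvgrPdist_lt : cM => /(_ _ e0); apply: filterS => p.
  by rewrite distrC ltr_pdivlMr // mulrC => /ltW.
pose delta (p : (phase R * R) * R) :=
  (rsubmx p.1.1 - wE (Yp p)) *m invmx (ME (Yp p)) - pE (Yp p).
(* Up to sign, [delta] times [M] is the violation bounded in [H2]; since [M] is close to the
   identity, dividing by it costs at most a factor 2. *)
have H4 : bO r.+1 x0 delta.
  apply: (bO_le (K := 2)) H2; apply: filterS H3 => p MY.
  apply: le_trans (near_id_norm _ MY) _; rewrite ler_pM2l //.
  rewrite mulmxBl mulmxKV ?near_id_unitmx // -normrN opprB.
  by rewrite opprB addrA.
have H5 : bO r.+1 x0 (fun p => (psi2 m e A phi a b (p.1.2 + p.2) p.1.2 p.1.1, p.1.2 + p.2)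
    - (lsubmx (Yp p), p.1.2 + p.2)).
  have l1 : linear (fun v : 'rV[R]_3 => (row_mx (0 : 'rV[R]_3) v, 0 : R)).
    move=> k u v; congr (_, _); rewrite /= ?scaler0 ?addr0 //.
    by rewrite scale_row_mx add_row_mx !scaler0 addr0.
  have cl : continuous (mklin l1) by apply: lin_continuous.
  move: (bO_lin cl H4); apply: bO_near; apply: near_all => p.
  congr (_, _); last by rewrite /= subrr.
  rewrite psi2E -[X in _ - X]hsubmxK opp_row_mx add_row_mx subrr.
  by [].
have cl : (lsubmx (Yp p), p.1.2 + p.2) @[p --> (x0, 0 : R)] --> x0.
  have sc : smooth (fun p : (phase R * R) * R => (lsubmx (Yp p), p.1.2 + p.2)).
    by apply: smooth_pair; [exact: smooth_lsubmx|exact: smoothD].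
  have := smooth_continuous sc (x := (x0, 0)).
  rewrite /continuous_at Y0 /shadow_init row_mxKl addr0 -surjective_pairing; exact.
have cP : (psi2 m e A phi a b (p.1.2 + p.2) p.1.2 p.1.1, p.1.2 + p.2) @[p --> (x0, 0 : R)] --> x0.
  have := cvgD (bO_cvg0 H5) cl; rewrite add0r.
  move=> H6; have E6 : (fun p : (phase R * R) * R =>
      (psi2 m e A phi a b (p.1.2 + p.2) p.1.2 p.1.1, p.1.2 + p.2)) =
      (fun p => (psi2 m e A phi a b (p.1.2 + p.2) p.1.2 p.1.1, p.1.2 + p.2)
        - (lsubmx (Yp p), p.1.2 + p.2) + (lsubmx (Yp p), p.1.2 + p.2)).
    by apply/funext => p; rewrite subrK.
  rewrite E6; exact: H6.
split=> [||g] //.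
  by apply: filterS H3 => p /near_id_unitmx; rewrite -psi2_domE.
have fPR := findim_prod (findim_mx R 1 (3 + 3)) (findim_R R).
move: (bOD (bO_lip fPR (findim_R R) (smfP g) cP cl H5) (H1 g)); apply: bO_near.
by apply: near_all => p; rewrite addrA subrK.
Qed.

End Shadowed.

(** * Order of the composition *)

Section StrangSplitting.
Context (R : realFieldType) (B : algType R).

Lemma strang_symmetric N (X Y : B) :
  let S := scalep 2^-1 (expp N X) in symmetric_series N.+1 (S * (expp N Y * S)).
Proof.
move=> S; rewrite /symmetric_series !scalepM.
set S' := scalep (-1) S; set Y' := scalep (-1) (expp N Y).
have YY : eqm N.+1 (Y' * expp N Y) 1 := @expp_symmetric _ _ N Y.
have SS : eqm N.+1 (S' * S) 1.
  rewrite /S' /S scalep_comp mulrC -scalep_comp -scalepM -[X in eqm _ _ X](scalep_one _ 2^-1).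
  by apply: eqm_scalep; exact: expp_symmetric.
have -> : S' * (Y' * S') * (S * (expp N Y * S)) = S' * ((Y' * ((S' * S) * expp N Y)) * S).
  by rewrite !mulrA.
apply: (eqm_trans _ SS); apply: eqmM => //; rewrite -[X in eqm _ _ X]mul1r.
apply: eqmM => //; apply: (eqm_trans _ YY); apply: eqmM => //.
by rewrite -[X in eqm _ _ X]mul1r; exact: (eqmM SS).
Qed.

Lemma strang_order1 N (X Y : B) : (0 < N)%N ->
  let S := scalep 2^-1 (expp N X) in eqm 2 (S * (expp N Y * S)) (expp N (X + Y)).
Proof.
move=> N0 S.
have E0 (Z : B) : (expp N Z)`_0 = 1 by rewrite coef_expp // expr0 invr1 scale1r.
have E1 (Z : B) : (expp N Z)`_1 = Z by rewrite coef_expp // invr1 scale1r expr1.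
have S0 : S`_0 = 1 by rewrite coef_scalep E0 expr0 scale1r.
have S1 : S`_1 = 2^-1 *: X by rewrite coef_scalep E1 expr1.
have eq1 (Q : {poly B}) : Q`_0 = 1 -> eqm 1 Q 1 by move=> Q0 [|]// _; rewrite coef1.
have YS0 : (expp N Y * S)`_0 = 1 by rewrite coefM big_ord1 /= E0 S0 mulr1.
case=> [|[|//]] _.
  by rewrite coefM big_ord1 /= S0 YS0 E0 mulr1.
rewrite (coefM_perturb _ S0 YS0 (eq1 _ S0) (eq1 _ YS0)) //.
rewrite (coefM_perturb _ (E0 Y) S0 (eq1 _ (E0 Y)) (eq1 _ S0)) //.
rewrite !mulr1 !coef1 /= !subr0 !add0r S1 !E1.
by rewrite addrC -addrA -scalerDl addrC (_ : 2^-1 + 2^-1 = 1 :> R) ?scale1r //; lra.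
Qed.

End StrangSplitting.

(** With [c] the k-th root of 2, the middle weight [1 - 2 g] equals [- c g], whose k-th power is
    [- 2 g^k] as k = 2n+3 is odd. The denominator is nonzero because [c = 2] would give 2^k = 2. *)
Lemma gamma_cancel (R : realType) n : let g := gamma_ R n.*2.+2 in
  2 * g ^+ n.*2.+3 + (1 - 2 * g) ^+ n.*2.+3 = 0.
Proof.
rewrite /gamma_; set k := n.*2.+3; set c := 2 `^ (k%:R^-1); set g := (2 - c)^-1.
have c0 : 0 <= c by exact: powR_ge0.
have ck : c ^+ k = 2.
  rewrite -powR_mulrn // -powRrM mulVf ?powRr1 //.
  by rewrite pnatr_eq0.
have c2 : 2 - c != 0.
  apply/eqP => /eqP; rewrite subr_eq0 => /eqP c2.
  move: ck; rewrite -c2 /k exprS => /eqP.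
  rewrite -subr_eq0 -[X in _ - X]mulr1 -mulrBr mulf_eq0 pnatr_eq0 /= subr_eq0 => /eqP H.
  have : 1 < (2 : R) ^+ n.*2.+2 by rewrite exprn_egt1 // ltr1n.
  by rewrite H ltxx.
have -> : 1 - 2 * g = - (c * g) by rewrite /g; field.
rewrite exprNn exprMn ck -signr_odd /k /= odd_double /= expr1; ring.
Qed.

Section ThetaOrder.
Context (R : realType) (m e : R) (m_gt0 : 0 < m)
  (A : 'rV[R]_3 -> R -> 'rV[R]_3) (phi : 'rV[R]_3 -> R -> R)
  (A_smooth : smooth (fun x : 'rV[R]_3 * R => A x.1 x.2))
  (phi_smooth : smooth (fun x : 'rV[R]_3 * R => phi x.1 x.2))
  (r s : nat) (a : 'M[R]_s) (b : 'I_s -> R) (rk_r : rk_order a b r).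

Let U := (phase R * R)%type.
Let fU : findim U := findim_prod (findim_mx R 1 (3 + 3)) (findim_R R).
Let s1 : smooth (kinetic_field m : U -> U) := smooth_kinetic_field m.
Let s2 : smooth (ext_field (potential_field m e A phi) : U -> U) :=
  smooth_ext_field (findim_mx R 1 (3 + 3)) (smooth_potential_field m e A_smooth phi_smooth).
Let L1 := Lie_endo fU s1.
Let L2 := Lie_endo fU s2.

Definition time_map (Phi : R -> R -> Defs.pmap R) (p : U * R) : U :=
  (Phi (p.1.2 + p.2) p.1.2 p.1.1, p.1.2 + p.2).

Lemma represents_psi1 N :
  represents N (fun p : U * R => (psi1 m p.2 p.1.1, p.1.2)) (expp N L1).
Proof.
apply: represents_flow => [|x|x h].
- have sx : smooth (fun p : U * R => p.1) by exact: smooth_fst.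
  have sz := smooth_fst_comp (findim_mx R 1 (3 + 3)) (findim_R R) sx.
  apply: smooth_pair; last exact: smooth_snd_comp.
  apply: smooth_row_mx; last exact: smooth_rsubmx.
  apply: smoothD; first exact: smooth_lsubmx.
  apply: smooth_scale; last exact: smooth_rsubmx.
  by apply: smoothM; [exact: smooth_snd|exact: smooth_cst].
- by case: x => z t /=; rewrite mul0r scale0r addr0 hsubmxK.
- apply: is_derive_pair => /=; last exact: is_derive_cst.
  have -> : (fun h => row_mx (lsubmx x.1 + (h / m) *: rsubmx x.1) (rsubmx x.1)) =
      cst x.1 + (fun h : R => h *: cst (row_mx (m^-1 *: rsubmx x.1) 0 : phase R) h).
    apply/funext => u; rewrite -[RHS]/(x.1 + u *: row_mx _ _).
    by rewrite scale_row_mx scaler0 scalerA -[X in _ = X + _]hsubmxK add_row_mx addr0.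
  have dS := is_diff_scale (is_diff_id h) (is_diff_cst (row_mx (m^-1 *: rsubmx x.1) 0 : phase R) h).
  have dS1 : is_derive h 1 (fun h : R => h *: cst (row_mx (m^-1 *: rsubmx x.1) 0 : phase R) h)
      (row_mx (m^-1 *: rsubmx x.1) 0).
    apply: DeriveDef; first by apply: diff_derivable; case: dS.
    by rewrite (is_diff_derive _ dS) /= scaler0 add0r scale1r.
  have := is_deriveD (is_derive_cst x.1 h (1 : R)) dS1.
  by rewrite add0r row_mxKr.
Qed.

Lemma filter_sub_near (x0 : U) (D D' : U * R -> Prop) : (forall p, D p -> D' p) ->
  (\forall p \near (x0, 0 : R), D p) -> \forall p \near (x0, 0 : R), D' p.
Proof. exact: filterS. Qed.

Lemma filter_sub_near3 (x0 : U) (D1 D2 D3 D' : U * R -> Prop) :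
  (forall p, D1 p -> D2 p -> D3 p -> D' p) ->
  (\forall p \near (x0, 0 : R), D1 p) -> (\forall p \near (x0, 0 : R), D2 p) ->
  (\forall p \near (x0, 0 : R), D3 p) -> \forall p \near (x0, 0 : R), D' p.
Proof. exact: filterS3. Qed.

Lemma near_comp (D : U * R -> Prop) (Psi : U * R -> U) (k : R) (x0 : U) :
  (forall x0 : U, \forall p \near (x0, 0 : R), D p) ->
  Psi p @[p --> (x0, 0 : R)] --> x0 ->
  \forall p \near (x0, 0 : R), D (Psi p, k * p.2).
Proof. by move=> DP cP; have := cvg_pair2 k cP; move=> /(_ _ (DP x0)). Qed.

Let T0 := scalep 2^-1 (expp r L1) * (expp r L2 * scalep 2^-1 (expp r L1)).

Let T n := triple_jump (fun n => gamma_ R n.*2.+2) T0 n.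

(** As time is a coordinate, each substep starts at the time where the previous one ended, and the
    nonautonomous composition becomes a product of series. Intermediate points converge to [x0],
    which puts them in the domains for small steps. *)
Lemma represents_Theta n :
  represents r (time_map (Theta_rec m e A phi a b n)) (T n) /\
  forall x0 : U, \forall p \near (x0, 0 : R),
    pm_dom (Theta_rec m e A phi a b n (p.1.2 + p.2) p.1.2) p.1.1.
Proof.
elim: n => [|n [IH ID]].
  have R1 := represents_scale 2^-1 (represents_psi1 r).
  have [R2 D2] := represents_psi2 A_smooth phi_smooth rk_r s2.
  have R12 := represents_comp R2 R1.
  have R121 := represents_comp R1 R12.
  split.
    have TE : T 0 = scalep 2^-1 (expp r L1) * expp r L2 * scalep 2^-1 (expp r L1).
      by rewrite -mulrA.
    have PE : time_map (Theta_rec m e A phi a b 0) = fun p => (psi1 m (2^-1 * p.2)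
      (psi2 m e A phi a b (p.1.2 + p.2) p.1.2 (psi1 m (2^-1 * p.2) p.1.1)), p.1.2 + p.2).
      apply/funext => -[[z t] h]; rewrite /time_map.
      have E : (t + h - t) / 2 = 2^-1 * h by rewrite [t + h]addrC addrK mulrC.
      by rewrite -E.
    rewrite TE PE; exact: R121.
  move=> x0; have [c1 _] := R1 x0.
  pose Q (p : U * R) := pm_dom (psi2 m e A phi a b (p.1.2 + p.2) p.1.2) p.1.1.
  have := near_comp (D := Q) 1 D2 c1.
  have sub (p : U * R) : Q ((psi1 m (2^-1 * p.2) p.1.1, p.1.2), 1 * p.2) ->
      pm_dom (Theta_rec m e A phi a b 0 (p.1.2 + p.2) p.1.2) p.1.1.
    rewrite /Q mul1r /=; have -> : (p.1.2 + p.2 - p.1.2) / 2 = 2^-1 * p.2.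
      by rewrite [p.1.2 + _]addrC addrK mulrC.
    by move=> H; split; [split; [exact: I|exact: H]|exact: I].
  exact: filter_sub_near.
set g := gamma_ R n.*2.+2; set d := 1 - 2 * g.
have Rg := represents_scale g IH; have Rd := represents_scale d IH.
have R1 := represents_comp Rd Rg; have R2 := represents_comp Rg R1.
have E (t h : R) : t + h - t = h by rewrite [t + h]addrC addrK.
have Ed (t h : R) : t + g * h + d * h = t + (1 - g) * h by rewrite /d; ring.
have Eg (t h : R) : t + (1 - g) * h + g * h = t + h by ring.
split.
  set Phi := time_map _; have -> : Phi = fun p => time_map (Theta_rec m e A phi a b n)
      (time_map (Theta_rec m e A phi a b n)
        (time_map (Theta_rec m e A phi a b n) (p.1, g * p.2), d * p.2), g * p.2).
    by apply/funext => -[[z t] h]; rewrite /Phi /time_map /= E -/g !Ed !Eg.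
  exact: R2.
move=> x0; have [cg _] := Rg x0; have [c1 _] := R1 x0.
pose Q (p : U * R) := pm_dom (Theta_rec m e A phi a b n (p.1.2 + p.2) p.1.2) p.1.1.
have c0 : fst p @[p --> (x0, 0 : R)] --> x0 by exact: cvg_fst.
have Dg := near_comp (D := Q) g ID c0.
have Dd := near_comp (D := Q) d ID cg; have D2 := near_comp (D := Q) g ID c1.
apply: (filter_sub_near3 _ Dg Dd D2) => -[[z t] h].
rewrite /Q /time_map /= !Ed !Eg E -/g => H1 H2 H3.
by split; [split|].
Qed.

Let Ltotal := Lie_endo fU (smooth_total_field m e A_smooth phi_smooth).

Lemma total_endoE : Ltotal = L1 + L2.
Proof. exact: Lie_endoD. Qed.

Lemma represents_Theta_exact : (2 <= r)%N -> ~~ odd r ->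
  represents r (time_map (Theta m e A phi a b r)) (expp r Ltotal) /\
  forall x0 : U, \forall p \near (x0, 0 : R),
    pm_dom (Theta m e A phi a b r (p.1.2 + p.2) p.1.2) p.1.1.
Proof.
(* Here r = 2n+2, so [n] triple jumps give agreement below degree 2n+3 = r+1, exactly the precision
   to which [psi2] is represented. *)
move=> r2 er; pose n := (r./2).-1.
have rE : n.*2.+2 = r.
  rewrite -doubleS /n prednK; last by rewrite half_gt0.
  by rewrite -[RHS]odd_double_half (negbTE er).
have [RT DT] := represents_Theta n; split=> //.
apply: represents_eqm RT; rewrite total_endoE.
have := @triple_jump_order R (endo U) (fun n => gamma_ R n.*2.+2) r (L1 + L2) T0 n.
rewrite rE => H; have [] := H _ _ _ (leqnn r).
- by move=> k; exact: gamma_cancel.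
- exact: strang_symmetric.
- by apply: strang_order1; exact: leq_trans r2.
- by [].
Qed.

(** The base point is frozen at [x0], with a constant [iota] in [approx_flow]: [exact_flow] says
    nothing about regularity in the initial condition. *)
Lemma exact_flow_approx Psi (x0 : U) (g : smoothfun U) : exact_flow m e A phi Psi ->
  bO r.+1 x0 (fun p => g (Psi (x0.2 + p.2) x0.2 x0.1, x0.2 + p.2) - tay r.+1
    (fun x => kinetic_field m x + ext_field (potential_field m e A phi) x) g x0 p.2).
Proof.
move=> /(_ x0.2 x0.1)[P0 dP].
pose c (p : U * R) : U := (Psi (x0.2 + p.2) x0.2 x0.1, x0.2 + p.2).
have sX := smooth_total_field m e A_smooth phi_smooth.
have shift (h : R) : is_diff h (fun s : R => x0.2 + s) id.
  have [H1 H2] := is_diffD (is_diff_cst x0.2 h) (is_diff_id h).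
  apply: DiffDef; first exact: H1.
  etransitivity; first exact: H2.
  by apply/funext => v; rewrite -[LHS]/(0 + v) add0r.
have dc : \forall h \near (0 : R), is_derive h (1 : R) (fun s => (Psi (x0.2 + s) x0.2 x0.1, x0.2 + s) : U)
   (kinetic_field m (Psi (x0.2 + h) x0.2 x0.1, x0.2 + h) +
    ext_field (potential_field m e A phi) (Psi (x0.2 + h) x0.2 x0.1, x0.2 + h)).
  have cs : x0.2 + h @[h --> (0 : R)] --> x0.2.
    have sc : smooth (fun h : R => x0.2 + h).
      by apply: smoothD; [exact: smooth_cst|exact: smooth_id].
    by have := smooth_continuous sc (x := 0); rewrite /continuous_at addr0.
  have dP' : \forall h \near (0 : R), is_derive (x0.2 + h) (1 : R) (fun t => Psi t x0.2 x0.1)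
      (hamilton_field m e A phi (Psi (x0.2 + h) x0.2 x0.1) (x0.2 + h)) := cs _ dP.
  apply: filterS dP' => h [dh eh].
  rewrite -(hamilton_fieldE e m_gt0 A_smooth phi_smooth) -eh.
  have /derivable1_diffP/differentiableP dY := dh.
  have dY' := is_diff_comp (shift h) dY.
  apply: is_derive_pair.
    apply: DeriveDef; first by apply/derivable1_diffP; case: dY'.
    by rewrite (is_diff_derive _ dY') /= (is_diff_derive _ dY).
  apply: DeriveDef; first by apply/derivable1_diffP; case: (shift h).
  by rewrite (is_diff_derive _ (shift h)).
have c0 : c (x0, 0) = x0 by rewrite /c /= addr0 P0; case: (x0).
have cc : c p @[p --> (x0, 0 : R)] --> x0.
  have c2 : (fun s => (Psi (x0.2 + s) x0.2 x0.1, x0.2 + s) : U) h @[h --> (0 : R)] --> x0.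
    (* [solves] includes the initial time itself, so the curve is differentiable and hence
       continuous at [h = 0]. *)
    have /nbhs_singleton [d0 _] := dc.
    have c3 : ((Psi (x0.2 + h) x0.2 x0.1, x0.2 + h) : U) @[h --> (0 : R)] -->
        ((Psi (x0.2 + 0) x0.2 x0.1, x0.2 + 0) : U).
      apply: (@differentiable_continuous _ _ _ 0
        (fun s : R => (Psi (x0.2 + s) x0.2 x0.1, x0.2 + s) : U)).
      exact/derivable1_diffP.
    by move: c3; rewrite addr0 P0 -surjective_pairing.
  have s2' : snd p @[p --> (x0, 0 : R)] --> (0 : R) by exact: cvg_snd.
  exact: (cvg_comp _ _ s2' c2).
have := @approx_flow R U U R
  (fun x => kinetic_field m x + ext_field (potential_field m e A phi) x) x0 (fun=> x0)
  c (fun=> 0) r.+1 fU (findim_R R) sX cc (@cst_continuous _ _ x0 _).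
have H1 : \forall x \near x0, c (x, 0) = x0.
  by apply: near_all_pt => x; rewrite -[RHS]c0.
have H2 : \forall p \near (x0, 0 : R), is_derive (p.2 : R) (1 : R) (fun s => c (p.1, s))
    (kinetic_field m (c p) + ext_field (potential_field m e A phi) (c p) + 0).
  have := near_snd x0 dc; apply: filter_sub_near => p.
  by rewrite addr0.
by move=> /(_ H1 H2 (bO0 _ _ _) g (smfP g)).
Qed.

Lemma Theta_order : (2 <= r)%N -> ~~ odd r ->
  forall Psi, exact_flow m e A phi Psi -> forall (t : R) (z : phase R),
   (\forall h \near (0 : R), pm_dom (Theta m e A phi a b r (t + h) t) z) /\
   exists C, \forall h \near (0 : R),
     `|Theta m e A phi a b r (t + h) t z - Psi (t + h) t z| <= C * `|h| ^+ r.+1.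
Proof.
move=> r2 er Psi PsiE t z; have [RT DT] := represents_Theta_exact r2 er.
pose x0 : U := (z, t).
split.
  have [d d0 hd] := near_box (DT x0).
  apply: filterS (near_norm_lt d0) => h hh.
  by apply: (hd x0 h) => //; rewrite subrr normr0.
pose D (p : U * R) := Theta m e A phi a b r (t + p.2) t z - Psi (t + p.2) t z.
(* The maps are recovered from their pullbacks by testing on coordinate functions. *)
have H (j : 'I_(3 + 3)) : bO r.+1 x0 (fun p => D p 0 j : R).
  have sg : smooth (fun x : U => x.1 0 j : R) by apply: smooth_coord; exact: smooth_fst.
  have [_ /(_ (SFun sg)) H1] := RT x0.
  have H2 := exact_flow_approx x0 (SFun sg) PsiE.
  have cx0 : (fun p : U * R => (x0, p.2)) p @[p --> (x0, 0 : R)] --> (x0, 0 : R).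
    by apply: cvg_pairP; [exact: cvg_cst|exact: cvg_snd].
  have H3 := bO_subst (s := fun p : U * R => (x0, p.2)) (K := 1) cx0 _ H1.
  have H4 : \forall p \near (x0, 0 : R), `|(x0, p.2).2| <= 1 * `|p.2|.
    by apply: near_all => p; rewrite mul1r.
  move: (bOB (H3 H4) H2); apply: bO_near; apply: near_all => p.
  by rewrite horner_expp opprB addrA subrK /D !mxE.
have [C /near_box[d d0 hd]] : bO r.+1 x0 D.
  have -> : D = fun p => \sum_j (D p 0 j : R) *: (delta_mx 0 j : phase R).
    by apply/funext => p; exact: row_sum_delta.
  apply: bO_sum => j _; rewrite -[r.+1]addn0; apply: bO_scale; first exact: H.
  by apply: bO_cvg; exact: cvg_cst.
exists C; apply: filterS (near_norm_lt d0) => h hh.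
by apply: (hd x0 h); rewrite // subrr normr0.
Qed.

End ThetaOrder.

(** * Symplecticity *)

Section Schwarz.
Context (R : realType).

(** For fixed [g] and [x], the two truncated expansions are polynomials of degree at most [N] in [h]
    that differ by [O(h^(N+1))], hence coincide. *)
Lemma represents_inj (U : normedModType R) N Phi (P Q : {poly endo U}) :
  represents N Phi P -> represents N Phi Q -> eqm N.+1 P Q.
Proof.
move=> rP rQ.
have trunc (S : {poly endo U}) : eqm N.+1 S (take_poly N.+1 S).
  by move=> k kN; rewrite coef_take_poly kN.
have {}rP := represents_eqm (trunc P) rP; have {}rQ := represents_eqm (trunc Q) rQ.
move=> k kN; rewrite (trunc P) // (trunc Q) //.
move: (take_poly _ P) (take_poly _ Q) (size_take_poly N.+1 P) (size_take_poly N.+1 Q) rP rQ.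
move=> {}P {}Q sP sQ rP rQ; apply: endo_eq => g; apply: smf_eq => x.
have [_ /(_ g) HP] := rP x; have [_ /(_ g) HQ] := rQ x.
have [C /near_box[d d0 hd]] := bOB HQ HP.
apply/eqP; rewrite -subr_eq0; apply/eqP.
apply: (@sum_expZ_bigO_eq0 R R N.+1 (fun k => P`_k g x - Q`_k g x) C) => //.
apply: filterS (near_norm_lt d0) => h hh.
have -> : \sum_(k < N.+1) h ^+ k *: (P`_k g x - Q`_k g x) = P.[h%:A] g x - Q.[h%:A] g x.
  rewrite (horner_endo _ _ _ sP) (horner_endo _ _ _ sQ) -sumrB.
  by apply: eq_bigr => j _; rewrite -mulrBr.
have := hd x h; rewrite subrr normr0 => /(_ d0 hh) /=.
by rewrite opprB addrC addrA subrK.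
Qed.

(* The translations by [h u] and [h v] commute; compare the coefficients of
   [h^2] in the expansions of their composite. *)
Lemma derive_comm (U : normedModType R) (g : U -> R) (u v x : U) : findim U -> smooth g ->
  'D_u (fun x => 'D_v g x) x = 'D_v (fun x => 'D_u g x) x.
Proof.
move=> fU sg.
have sc (w : U) : smooth (fun _ : U => w) by exact: smooth_cst.
have flow (w : U) : represents 2 (fun p => p.1 + p.2 *: w) (expp 2 (Lie_endo fU (sc w))).
  apply: represents_flow => [|y|y h].
  - apply: smoothD; first exact: smooth_fst.
    by apply: smooth_scale; [exact: smooth_snd|exact: smooth_cst].
  - by rewrite scale0r addr0.
  - have dS := is_diff_scale (is_diff_id h) (is_diff_cst w h).
    have dS1 : is_derive h (1 : R) (fun h : R => h *: cst w h) w.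
      apply: DeriveDef; first by apply: diff_derivable; case: dS.
      by rewrite (is_diff_derive _ dS) /= scaler0 add0r scale1r.
    by have := is_deriveD (is_derive_cst y h (1 : R)) dS1; rewrite add0r.
have H := represents_comp (flow u) (flow v).
(* The composite is itself the flow of the constant field [v + u], so by uniqueness the product of
   exponentials is the exponential of the sum through degree 2. *)
have E : (fun p : U * R => p.1 + p.2 *: v + p.2 *: u) = (fun p => p.1 + p.2 *: (v + u)).
  by apply/funext => p; rewrite -addrA -scalerDr.
have suv : smooth (fun _ : U => v + u) by exact: smooth_cst.
have H2 := flow (v + u).
have LD : Lie_endo fU (sc (v + u)) = Lie_endo fU (sc v) + Lie_endo fU (sc u).
  have := @Lie_endoD _ _ fU (fun=> v) (fun=> u) (sc v) (sc u) (sc (v + u)).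
  exact.
rewrite LD in H2; move: H; rewrite /= E => H.
set Lu := Lie_endo fU (sc u) in H H2; set Lv := Lie_endo fU (sc v) in H H2.
have := expp_comm (represents_inj H H2).
move=> /(congr1 (fun T : endo U => T (SFun sg) x)).
have EL w (h : smoothfun U) : smf_val (Lie_endo fU (sc w) h) = (fun y => 'D_w h y) by [].
by rewrite !endoME /Lu /Lv !EL /= => ->.
Qed.

End Schwarz.

(** * Symplectic maps: compositions and cotangent lifts *)

Section Symplectic.
Context (R : realType).

Lemma derive_coord (U : normedModType R) k n (f : U -> 'M[R]_(k, n)) x v i j :
  differentiable f x -> 'D_v f x i j = 'D_v (fun x => f x i j) x.
Proof. by move=> df; rewrite derive_mx ?mxE //; exact: diff_derivable. Qed.

Lemma derive_comm_mx (U : normedModType R) k n (g : U -> 'M[R]_(k, n)) (u v x : U) :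
  findim U -> smooth g ->
  'D_u (fun x => 'D_v g x) x = 'D_v (fun x => 'D_u g x) x.
Proof.
move=> fU sg; apply/matrixP => i j.
have E w : (fun x => 'D_w g x i j) = (fun x => 'D_w (fun x => g x i j) x).
  by apply/funext => y; rewrite derive_coord //; exact: smooth_differentiable.
have D w w' : ('D_w' (fun y => 'D_w g y) x) i j =
    'D_w' (fun y => 'D_w (fun y => g y i j) y) x.
  rewrite (derive_coord _ _ _ (smooth_differentiable x (smooth_derive w sg))).
  by rewrite E.
etransitivity; first exact: (D v u).
etransitivity; last exact: (esym (D u v)).
by apply: derive_comm; exact: smooth_coord.
Qed.

Lemma derive_linear (U V W : normedModType R) (l : V -> W) (f : U -> V) x v : findim V ->
  linear l -> differentiable f x -> 'D_v (fun x => l (f x)) x = l ('D_v f x).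
Proof.
move=> fV ll /differentiableP df.
have cl : continuous (mklin ll) by apply: lin_continuous.
have dl := is_diff_comp df (is_diff_lin (f x) cl).
by rewrite (is_diff_derive _ dl) (is_diff_derive _ df).
Qed.

Lemma smooth_autonomous_Jac n p (f : 'rV[R]_n -> 'rV[R]_p) : smooth f -> smooth (Jac f).
Proof.
move=> sf; have sf' : smooth (fun x : 'rV[R]_n * R => f x.1).
  by apply: (smooth_comp _ (smooth_fst _ _)).
exact: (smooth_partial 0 _ _ (smooth_Jac (f := fun x _ => f x) sf')).
Qed.

Lemma smooth_autonomous_grad n (g : 'rV[R]_n -> R) : smooth g -> smooth (grad g).
Proof.
move=> sg; have sg' : smooth (fun x : 'rV[R]_n * R => g x.1).
  by apply: (smooth_comp _ (smooth_fst _ _)).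
exact: (smooth_partial 0 _ _ (smooth_grad (g := fun x _ => g x) sg')).
Qed.

Lemma hessian_sym n (g : 'rV[R]_n -> R) x u v : smooth g ->
  'D_v (grad g) x *m u^T = ('D_u (grad g) x *m v^T)^T.
Proof.
move=> sg.
have lw (w : 'rV[R]_n) : linear (fun z : 'rV[R]_n => z *m w^T).
  by move=> k y z; rewrite mulmxDl scalemxAl.
have E w w' : 'D_w' (grad g) x *m w^T = ('D_w' (fun y => 'D_w g y) x)%:M.
  have dg := smooth_differentiable x (smooth_autonomous_grad sg).
  have D1 := derive_linear w' (findim_mx R 1 n) (lw w) dg.
  have ls : linear (fun c : R => c%:M : 'M[R]_1).
    by move=> k y z; rewrite scale_scalar_mx -raddfD.
  have dD := smooth_differentiable x (smooth_derive w sg).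
  have D2 := derive_linear w' (findim_R R) ls dD.
  have Ef : (fun y => grad g y *m w^T) = (fun y => ('D_w g y)%:M : 'M[R]_1).
    apply/funext => y; rewrite derive_gradE; last exact: smooth_differentiable.
    apply/matrixP => i j; rewrite !ord1 !mxE eqxx mulr1n.
    by apply: eq_bigr => k _; rewrite !mxE mulrC.
  by rewrite Ef in D1; rewrite -D1 D2.
etransitivity; first exact: (E u v).
rewrite (E v u).
rewrite tr_scalar_mx.
by rewrite (derive_comm v u x (findim_mx R 1 n) sg).
Qed.

Lemma derive_Jac_sym n p (f : 'rV[R]_n -> 'rV[R]_p) x u v : smooth f ->
  'D_v (Jac f) x *m u^T = 'D_u (Jac f) x *m v^T.
Proof.
move=> sf.
have lw (w : 'rV[R]_n) : linear (fun M : 'M[R]_(p, n) => M *m w^T).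
  by move=> k y z; rewrite mulmxDl scalemxAl.
have E w w' : 'D_w' (Jac f) x *m w^T = ('D_w' (fun y => 'D_w f y) x)^T.
  have dg := smooth_differentiable x (smooth_autonomous_Jac sf).
  have D1 := derive_linear w' (findim_mx R p n) (lw w) dg.
  have ls : linear (@trmx R 1 p) by move=> k y z; rewrite linearP.
  have dD := smooth_differentiable x (smooth_derive w sf).
  have D2 := derive_linear w' (findim_mx R 1 p) ls dD.
  have Ef : (fun y => Jac f y *m w^T) = (fun y => ('D_w f y)^T).
    apply/funext => y; rewrite derive_jacobianE; last exact: smooth_differentiable.
    by rewrite trmx_mul trmxK.
  by rewrite Ef in D1; rewrite -D1 D2.
have C := derive_comm_mx v u x (findim_mx R 1 n) sf.
etransitivity; first exact: (E u v).
etransitivity; last exact: (esym (E v u)).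
by rewrite C.
Qed.

Lemma symplectic_formP (f : phase R -> phase R) z : differentiable f z ->
  (forall u v, 'd f z u *m sympl_mx R *m ('d f z v)^T = u *m sympl_mx R *m v^T) ->
  (Jac f z)^T *m sympl_mx R *m Jac f z = sympl_mx R.
Proof.
move=> df H; apply/matrixP => i j.
have E (S : 'M[R]_(3 + 3)) : S i j =
    ((delta_mx 0 i : phase R) *m S *m (delta_mx 0 j : phase R)^T) 0 0.
  by rewrite -rowE trmx_delta -colE !mxE.
rewrite [RHS]E -H [LHS]E; congr (fun_of_matrix _ _ _).
rewrite -!(deriveE _ df) !derive_jacobianE // trmx_mul trmxK.
by rewrite !mulmxA.
Qed.

Lemma symplectic_form (f : phase R -> phase R) z : differentiable f z ->
  (Jac f z)^T *m sympl_mx R *m Jac f z = sympl_mx R ->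
  forall u v, 'd f z u *m sympl_mx R *m ('d f z v)^T = u *m sympl_mx R *m v^T.
Proof.
move=> df H u v; rewrite -!(deriveE _ df) !derive_jacobianE // trmx_mul trmxK -{2}H.
by rewrite /Jac trmxK !mulmxA.
Qed.

Lemma sympl_form (u v : phase R) : u *m sympl_mx R *m v^T =
  lsubmx u *m (rsubmx v)^T - rsubmx u *m (lsubmx v)^T.
Proof.
rewrite -{1}[u]hsubmxK -{1}[v]hsubmxK /sympl_mx mul_row_block !mulmx0 add0r addr0 mulmx1.
by rewrite mulmxN mulmx1 tr_row_mx mul_row_col mulNmx addrC.
Qed.

Lemma symplectic_comp (g f : Defs.pmap R) : symplectic g -> symplectic f ->
  symplectic (Defs.pcomp g f).
Proof.
move=> [og Hg] [of_ Hf]; split.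
  (* Continuity of [f] is known only at points of its domain, through differentiability there, so
     openness is checked point by point. *)
  rewrite openE => z [/= fz gz]; have [df _] := Hf z fz.
  apply: filterI; first exact: (open_nbhs_nbhs (conj of_ fz)).
  have := differentiable_continuous df; apply.
  exact: (open_nbhs_nbhs (conj og gz)).
move=> z [/= fz gz]; have [df Jf] := Hf z fz; have [dg Jg] := Hg _ gz.
have dgf : differentiable (g \o f) z by exact: differentiable_comp.
have E u : 'd (g \o f) z u = 'd g (f z) ('d f z u) := congr1 (fun k => k u) (diff_comp df dg).
split; first exact: dgf.
apply: (@symplectic_formP (g \o f) z dgf) => u v.
have S2 := symplectic_form dg Jg ('d f z u) ('d f z v).
refine (etrans _ (etrans S2 (symplectic_form df Jf u v))).
exact: (congr2 (fun a b : phase R => a *m sympl_mx R *m b^T) (E u) (E v)).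
Qed.

Lemma symplectic_psi1 (m tau : R) : symplectic (psi1 m tau).
Proof.
have l1 : linear (psi1 m tau).
  move=> k u v; rewrite /= !linearP scale_row_mx add_row_mx scalerDr.
  by rewrite addrACA.
have cl : continuous (mklin l1) by apply: lin_continuous.
split=> [|z _]; first exact: openT.
have dz := is_diff_lin z cl; have [dl dE] := dz.
split=> //; apply: symplectic_formP => // u v.
have -> : 'd (psi1 m tau) z = psi1 m tau :> (phase R -> phase R) := dE.
rewrite !sympl_form /= !row_mxKl !row_mxKr linearD linearZ /= mulmxDl mulmxDr.
rewrite -scalemxAl -scalemxAr opprD addrACA subrr addr0.
by [].
Qed.

(** Differentiability is local. This matters for [invmx], which agrees with a differentiable formula
    only where the matrix is invertible. *)
Lemma near_eq_is_diff (U V : normedModType R) (f g dg : U -> V) x :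
  (\forall y \near x, f y = g y) -> is_diff x g dg -> is_diff x f dg.
Proof.
move=> fg [Dg <-]; have fgx : f x = g x := nbhs_singleton fg.
have E : f \o shift x = cst (f x) + 'd g x +o_ 0 id.
  apply/eqaddoP => d d0; have /diff_locally/eqaddoP/(_ d d0) H := Dg.
  have fg0 : \forall y \near (0 : U), f (y + x) = g (y + x).
    have cs : y + x @[y --> (0 : U)] --> x.
      rewrite -[X in _ --> X]add0r.
      exact: (cvgD cvg_id (cvg_cst x)).
    exact: (cs _ fg).
  apply: filterS2 H fg0 => y /=.
  by rewrite -[(f \o shift x - _) y]/(f (y + x) - (f x + 'd g x y)) => H ->; rewrite fgx.
have dE : 'd f x = 'd g x :> (U -> V) by apply: diff_unique => //; exact: diff_continuous.
apply: DiffDef => //.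
by apply/diff_locallyP; rewrite dE; split => //; exact: diff_continuous.
Qed.

(* The cotangent lift of the point map [Q] after the gauge change [p - grad L]. *)
Lemma symplectic_point_map (Q : 'rV[R]_3 -> 'rV[R]_3) (L : 'rV[R]_3 -> R) :
  smooth Q -> smooth L ->
  symplectic (PMap [set z : phase R | Jac Q (lsubmx z) \in unitmx]
    (fun z => row_mx (Q (lsubmx z))
      ((rsubmx z - grad L (lsubmx z)) *m invmx (Jac Q (lsubmx z))))).
Proof.
move=> sQ sL.
pose M (z : phase R) := Jac Q (lsubmx z); pose w (z : phase R) := rsubmx z - grad L (lsubmx z).
pose P (z : phase R) := w z *m invmx (M z).
pose dom := [set z | M z \in unitmx].
have sid : smooth (fun z : phase R => z) by exact: smooth_id.
have sl := smooth_lsubmx sid; have sr := smooth_rsubmx sid.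
have sJ := smooth_autonomous_Jac sQ; have sg := smooth_autonomous_grad sL.
have sM : smooth M by apply: (smooth_comp _ sl sJ).
have sw : smooth w by apply: smoothB => //; apply: (smooth_comp _ sl sg).
have sdet := smooth_det sM.
have domE : dom = (fun z => \det (M z)) @^-1` [set x | x != 0].
  by apply/seteqP; split => z; rewrite /dom /= unitmxE unitfE.
have odom : open dom.
  rewrite domE; apply: open_comp; last exact: open_neq.
  by move=> z _; apply: smooth_continuous.
split=> [|z zd]; first exact: odom.
have nd : \forall y \near z, dom y by exact: (open_nbhs_nbhs (conj odom zd)).
have dP : differentiable P z.
  (* Cramer's rule gives an expression for [P] that is visibly differentiable on the domain. *)
  pose P' (y : phase R) := (\det (M y))^-1 *: (w y *m \adj (M y)).
  have PP' : \forall y \near z, P y = P' y.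
    apply: filterS nd => y yd; rewrite /P /P' /invmx.
    by rewrite (yd : M y \in unitmx) -scalemxAr.
  have dV : differentiable (fun y => (\det (M y))^-1) z.
    apply: differentiableV; first exact: (smooth_differentiable z sdet).
    by move: zd; rewrite /dom /= unitmxE unitfE.
  have dA := smooth_differentiable z (smooth_mulmx sw (smooth_adj sM)).
  have [] := near_eq_is_diff PP' (is_diff_scale (differentiableP dV) (differentiableP dA)).
  by [].
have lrow : linear (fun y : 'rV[R]_3 * 'rV[R]_3 => row_mx y.1 y.2 : phase R).
  by move=> k u v; rewrite /= scale_row_mx add_row_mx.
have crow : continuous (mklin lrow) by apply: lin_continuous.
have sQl : smooth (fun y : phase R => Q (lsubmx y)) by apply: (smooth_comp _ sl sQ).
have dQ := smooth_differentiable z sQl.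
have DP := differentiableP dP; have DQ := differentiableP dQ.
have DF := is_diff_comp (is_diff_pair DQ DP) (is_diff_lin (Q (lsubmx z), P z) crow).
pose F (y : phase R) := row_mx (Q (lsubmx y)) (P y).
have dF : differentiable F z by case: DF.
have FE u : 'd F z u = row_mx ('d (fun y : phase R => Q (lsubmx y)) z u) ('d P z u).
  by have [_ E] := DF; exact: (congr1 (fun k => k u) E).
split; first exact: dF.
apply: (@symplectic_formP F z dF) => u v.
pose q := lsubmx z.
have ll : linear (lsubmx : phase R -> 'rV[R]_3) by move=> k x y; rewrite linearP.
have lr : linear (rsubmx : phase R -> 'rV[R]_3) by move=> k x y; rewrite linearP.
have cll : continuous (mklin ll) by apply: lin_continuous.
have clr : continuous (mklin lr) by apply: lin_continuous.
have Dl := is_diff_lin z cll; have Dr := is_diff_lin z clr.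
have pull (V : normedModType R) (f : 'rV[R]_3 -> V) : differentiable f q ->
    is_diff z (fun y : phase R => f (lsubmx y)) (fun x => 'D_(lsubmx x) f q).
  move=> df; have := is_diff_comp Dl (differentiableP (df : differentiable f (mklin ll z))).
  have -> : (fun x : phase R => 'D_(lsubmx x) f q) = 'd f (mklin ll z) \o mklin ll.
    by apply/funext => x; rewrite deriveE.
  exact.
have dQE x : 'd (fun y : phase R => Q (lsubmx y)) z x = lsubmx x *m (M z)^T.
  have [_ E] := pull _ Q (smooth_differentiable q sQ).
  rewrite (congr1 (fun k => k x) E).
  by rewrite derive_jacobianE; last exact: smooth_differentiable.
have DM := pull _ _ (smooth_differentiable q sJ).
have Dg := pull _ _ (smooth_differentiable q sg).
(* Differentiating the relation [P M = w] gives [dP M] without any formula for the derivative of an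
   inverse. *)
have dPE x : 'd P z x *m M z =
    rsubmx x - 'D_(lsubmx x) (grad L) q - P z *m 'D_(lsubmx x) (Jac Q) q.
  have near_PM : \forall y \near z, P y *m M y = w y.
    by apply: filterS nd => y yd; rewrite /P mulmxKV.
  have [_ E1] := near_eq_is_diff near_PM (is_diffB Dr Dg).
  have [_ E2] := is_diff_mulmx DP DM.
  have := congr1 (fun k => k x) (etrans (esym E1) E2) => /= E.
  apply/eqP; rewrite eq_sym subr_eq eq_sym addrC; apply/eqP.
  exact: (esym E).
have scalar_tr (S : 'M[R]_1) : S^T = S by apply/matrixP => i j; rewrite !ord1 mxE.
have FE' x : 'd F z x = row_mx (lsubmx x *m (M z)^T) ('d P z x).
  exact: (etrans (FE x) (congr1 (fun y => row_mx y _) (dQE x))).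
refine (etrans (congr2 (fun a b : phase R => a *m sympl_mx R *m b^T) (FE' u) (FE' v)) _).
have := hessian_sym q (lsubmx u) (lsubmx v) sL.
have := derive_Jac_sym q (lsubmx u) (lsubmx v) sQ.
move: (dPE u) (dPE v).
move: ('d P z u) ('d P z v) (P z) (M z) ('D_(lsubmx u) (grad L) q) ('D_(lsubmx v) (grad L) q)
  ('D_(lsubmx u) (Jac Q) q) ('D_(lsubmx v) (Jac Q) q).
move=> pu pv p N gu gv Ju Jv Eu Ev EJ Eg.
(* In the symplectic form the momentum variations appear only multiplied by [N], so [Eu] and [Ev]
   apply. The gradient terms cancel by symmetry of the Hessian of [L], the [Jac] terms by symmetry
   of the second derivative of [Q]. *)
rewrite !sympl_form !row_mxKl !row_mxKr.
rewrite trmx_mul trmxK mulmxA Eu -[_ *m N^T *m _]mulmxA -trmx_mul Ev.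
rewrite -[X in X - _]scalar_tr trmx_mul trmxK !mulmxBl -!mulmxA EJ Eg scalar_tr.
rewrite -[in RHS](scalar_tr (lsubmx u *m _)) trmx_mul trmxK.
by rewrite opprB addrA subrK opprB addrA subrK.
Qed.

End Symplectic.

(** * The shadowed map as a cotangent lift with gauge change *)

Section ShadowSymplectic.
Context (R : realType).

Lemma is_derive_sumr (U V : normedModType R) I (l : seq I) (Q : pred I)
    (F : I -> U -> V) (dF : I -> V) x v :
  (forall i, Q i -> is_derive x v (F i) (dF i)) ->
  is_derive x v (fun y => \sum_(i <- l | Q i) F i y) (\sum_(i <- l | Q i) dF i).
Proof.
move=> HF; rewrite -fct_sumE; elim/big_ind2 : _ => //.
  exact: is_derive_cst.
by move=> f df g dg H1 H2; exact: is_deriveD.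
Qed.

Lemma derive_comp (U V W : normedModType R) (f : U -> V) (g : V -> W) x v :
  differentiable f x -> differentiable g (f x) ->
  'D_v (fun x => g (f x)) x = 'D_('D_v f x) g (f x).
Proof.
move=> /differentiableP df /differentiableP dg.
by rewrite (is_diff_derive _ (is_diff_comp df dg)) (is_diff_derive _ df) (is_diff_derive _ dg).
Qed.

Lemma Jac_unique n p (f : 'rV[R]_n -> 'rV[R]_p) x K : differentiable f x ->
  (forall v, 'D_v f x = v *m K^T) -> Jac f x = K.
Proof.
move=> df H; apply/matrixP => i j; rewrite JacE // H -rowE !mxE.
by [].
Qed.

Context (m e : R) (A : 'rV[R]_3 -> R -> 'rV[R]_3) (phi : 'rV[R]_3 -> R -> R)
  (A_smooth : smooth (fun x : 'rV[R]_3 * R => A x.1 x.2))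
  (phi_smooth : smooth (fun x : 'rV[R]_3 * R => phi x.1 x.2))
  (s : nat) (a : 'M[R]_s) (b : 'I_s -> R) (t h : R).

Let k q i := k_ m e A a t h q i.
Let arg q i := arg_ m e A a t h q i.
Let k' q i := k'_ m e A a t h q i.

Lemma smooth_slice (V : normedModType R) (g : 'rV[R]_3 -> R -> V) c :
  smooth (fun x : 'rV[R]_3 * R => g x.1 x.2) -> smooth (g ^~ c).
Proof. exact: (smooth_partial c (findim_mx R 1 3) (findim_R R)). Qed.

Lemma smooth_k i : smooth (fun q => k q i).
Proof.
apply: (@smooth_stage _ _ a _ _ (fun i q v => - (e / m) *: A (q + h *: v) (t + h * node a i))) => {}i.
apply: smoothZ; apply: (smooth_at A_smooth); last exact: smooth_cst.
by apply: smoothD; [exact: smooth_fst|apply: smoothZ; exact: smooth_snd].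
Qed.

Lemma smooth_arg i : smooth (fun q => arg q i).
Proof.
apply: smoothD; first exact: smooth_id.
by apply: smoothZ; apply: smooth_sum => j _; apply: smoothZ; exact: smooth_k.
Qed.

Lemma is_derive_k q v i : is_derive q v (fun q => k q i) ('D_v (fun q => k q i) q).
Proof. by apply: derivableP; apply: diff_derivable; exact: (smooth_differentiable q (smooth_k i)). Qed.

Lemma derive_combination q v (Q : pred 'I_s) (c : 'I_s -> R) :
  'D_v (fun q => q + h *: \sum_(j < s | Q j) c j *: k q j) q =
  v + h *: \sum_(j < s | Q j) c j *: 'D_v (fun q => k q j) q.
Proof.
have H : is_derive q v (fun q => \sum_(j < s | Q j) c j *: k q j)
    (\sum_(j < s | Q j) c j *: 'D_v (fun q => k q j) q).
  apply: is_derive_sumr => j _; exact: (is_deriveZ (c j) (is_derive_k q v j)).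
have D := is_deriveD (is_derive_id q v) (is_deriveZ h H).
by have [_ E] := D.
Qed.

Lemma derive_arg q v (i : 'I_s) :
  (forall j : 'I_s, (j < i)%N -> k' q j = Jac (fun q => k q j) q) ->
  'D_v (fun q => arg q i) q = v *m (1%:M + h *: \sum_(j < s | (j < i)%N) a i j *: k' q j)^T.
Proof.
move=> H; rewrite derive_combination linearD /= trmx1 mulmxDr mulmx1; congr (_ + _).
rewrite linearZ /= -scalemxAr; congr (_ *: _).
rewrite linear_sum mulmx_sumr; apply: eq_bigr => j ji.
rewrite linearZ /= -scalemxAr H // derive_jacobianE //.
exact: (smooth_differentiable q (smooth_k j)).
Qed.

Lemma k'_Jac q i : k' q i = Jac (fun q => k q i) q.
Proof.
move: i; apply: stage_ind => i IH.
have sA := smooth_slice (t + h * node a i) A_smooth.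
apply/esym/Jac_unique; first exact: (smooth_differentiable q (smooth_k i)).
move=> v; rewrite /k' /k'_ stageE.
have -> : (fun q => k q i) = (fun q => - (e / m) *: A (arg q i) (t + h * node a i)).
  by apply/funext => x; rewrite /k /k_ stageE.
have da := smooth_differentiable q (smooth_arg i).
have dA := smooth_differentiable (arg q i) sA.
have dAa : derivable (fun q => A (arg q i) (t + h * node a i)) q v.
  by apply: diff_derivable; exact: (differentiable_comp da dA).
have -> : 'D_v (fun q => - (e / m) *: A (arg q i) (t + h * node a i)) q =
    - (e / m) *: 'D_v (fun q => A (arg q i) (t + h * node a i)) q.
  exact: (deriveZ _ dAa).
rewrite (derive_comp (g := A ^~ (t + h * node a i)) v da dA) derive_arg // derive_jacobianE //.
by rewrite [in RHS]linearZ /= trmx_mul -scalemxAr mulmxA.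
Qed.

Let Qh q := q + h *: \sum_i b i *: k q i.
(** The gauge function: the values [l_i] of [f] at the stage arguments do not occur in [psi2], only
    their gradients do. *)
Let Lh q := h * \sum_i b i * fpot m e A phi (arg q i) (t + h * node a i).

Lemma smooth_Qh : smooth Qh.
Proof.
apply: smoothD; first exact: smooth_id.
by apply: smoothZ; apply: smooth_sum => j _; apply: smoothZ; exact: smooth_k.
Qed.

Lemma smooth_fpot_arg i : smooth (fun q => fpot m e A phi (arg q i) (t + h * node a i)).
Proof.
apply: (smooth_at (smooth_fpot m e A_smooth phi_smooth)); last exact: smooth_cst.
exact: smooth_arg.
Qed.

Lemma smooth_Lh : smooth Lh.
Proof.
apply: smoothM; first exact: smooth_cst.
by apply: smooth_sum => j _; apply: smoothM; [exact: smooth_cst|exact: smooth_fpot_arg].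
Qed.

Lemma shadow_mxE q : shadow_mx m e A a b t h q = Jac Qh q.
Proof.
apply/esym/Jac_unique; first exact: (smooth_differentiable q smooth_Qh).
move=> v; rewrite derive_combination /shadow_mx linearD /= trmx1 mulmxDr mulmx1; congr (_ + _).
rewrite linearZ /= -scalemxAr; congr (_ *: _).
rewrite linear_sum mulmx_sumr; apply: eq_bigr => j _.
rewrite linearZ /= -scalemxAr -/(k' q j) k'_Jac derive_jacobianE //.
exact: (smooth_differentiable q (smooth_k j)).
Qed.

Lemma grad_fpot_arg q i :
  grad (fun q => fpot m e A phi (arg q i) (t + h * node a i)) q = gradl_ m e A phi a t h q i.
Proof.
have sf := smooth_slice (t + h * node a i) (smooth_fpot m e A_smooth phi_smooth).
have da := smooth_differentiable q (smooth_arg i).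
have df := smooth_differentiable (arg q i) sf.
apply/rowP => j; rewrite mxE.
rewrite (derive_comp (g := (fpot m e A phi) ^~ (t + h * node a i)) _ da df).
rewrite derive_arg => [|l _]; last exact: k'_Jac.
rewrite derive_gradE // /gradl_ [RHS]mxE; apply: eq_bigr => l _.
by rewrite -rowE !mxE mulrC.
Qed.

Lemma gradl_sumE q : h *: \sum_i b i *: gradl_ m e A phi a t h q i = grad Lh q.
Proof.
apply/rowP => j; rewrite [RHS]mxE.
pose F i q := fpot m e A phi (arg q i) (t + h * node a i).
have D i : is_derive q (delta_mx 0 j) (F i) ('D_(delta_mx 0 j) (F i) q).
  by apply: derivableP; apply: diff_derivable; exact: (smooth_differentiable q (smooth_fpot_arg i)).
have DS : is_derive q (delta_mx 0 j) (fun q => \sum_i b i * F i q)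
    (\sum_i b i * 'D_(delta_mx 0 j) (F i) q).
  by apply: is_derive_sumr => i _; exact: (is_deriveZ (b i) (D i)).
have [_ E] := is_deriveZ h DS.
refine (etrans _ (esym E)); rewrite mxE; congr (_ * _).
rewrite summxE; apply: eq_bigr => i _.
by rewrite mxE -grad_fpot_arg mxE.
Qed.

Lemma symplectic_psi2 : symplectic (psi2 m e A phi a b (t + h) t).
Proof.
have H := symplectic_point_map smooth_Qh smooth_Lh.
have -> : psi2 m e A phi a b (t + h) t = PMap [set z : phase R | Jac Qh (lsubmx z) \in unitmx]
    (fun z => row_mx (Qh (lsubmx z))
      ((rsubmx z - grad Lh (lsubmx z)) *m invmx (Jac Qh (lsubmx z)))); last exact: H.
have E : t + h - t = h by rewrite [t + h]addrC addrK.
rewrite /psi2 E; congr PMap.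
  by apply/seteqP; split => z /=; rewrite shadow_mxE.
by apply/funext => z; rewrite shadow_mxE gradl_sumE.
Qed.

End ShadowSymplectic.

Lemma symplectic_Theta_rec (R : realType) (m e : R) A phi (s : nat) (a : 'M[R]_s)
    (b : 'I_s -> R) n (t1 t0 : R) :
  smooth (fun x : 'rV[R]_3 * R => A x.1 x.2) ->
  smooth (fun x : 'rV[R]_3 * R => phi x.1 x.2) ->
  symplectic (Theta_rec m e A phi a b n t1 t0).
Proof.
move=> sA sphi; elim: n t1 t0 => [|n IHn] t1 t0; last first.
  by do 2!apply: symplectic_comp => //.
apply: symplectic_comp; first exact: symplectic_psi1.
apply: symplectic_comp; last exact: symplectic_psi1.
have -> : t1 = t0 + (t1 - t0) by rewrite addrC subrK.
exact: symplectic_psi2.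
Qed.

Theorem mainTheorem1 (R : realType) (m e : R)
  (A : 'rV[R]_3 -> R -> 'rV[R]_3) (phi : 'rV[R]_3 -> R -> R)
  (m_gt0 : 0 < m)
  (A_smooth : smooth (fun x : 'rV[R]_3 * R => A x.1 x.2))
  (phi_smooth : smooth (fun x : 'rV[R]_3 * R => phi x.1 x.2))
  (r : nat) (r_ge2 : (2 <= r)%N) (r_even : ~~ odd r)
  (s : nat) (a : 'M[R]_s) (b : 'I_s -> R) (rk_r : rk_order a b r) :
  (forall t h : R, symplectic (Theta m e A phi a b r (t + h) t)) /\
  (forall Psi : R -> R -> phase R -> phase R, exact_flow m e A phi Psi ->
   forall (t : R) (q p : 'rV[R]_3),
     (\forall h \near (0 : R),
        pm_dom (Theta m e A phi a b r (t + h) t) (row_mx q p)) /\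
     (fun h : R => Theta m e A phi a b r (t + h) t (row_mx q p)
                   - Psi (t + h) t (row_mx q p))
       =O_ 0 (fun h : R => h ^+ r.+1)).
Proof.
split=> [t h|Psi PsiE t q p]; first exact: symplectic_Theta_rec.
have [Hdom [C HC]] :=
  Theta_order m_gt0 A_smooth phi_smooth rk_r r_ge2 r_even PsiE t (row_mx q p).
(* The constant must be positive here, while [C] carries no sign. *)
split=> //; apply/eqO_exP; exists (`|C| + 1); first by rewrite ltr_wpDl.
apply: filterS HC => h /le_trans; apply.
by rewrite normrX ler_wpM2r ?exprn_ge0 // (le_trans (ler_norm C)) // lerDl.
Qed.
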